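(* Let $d=3$, let $\Omega\subset\mathbb{R}^3$ be a bounded Lipschitz polytope, and let $s\in[3,4]$. Let $\nu,\kappa\in C^{0,1}(\mathbb{R})$, with Lipschitz constants $\mathcal{L}_\nu,\mathcal{L}_\kappa$, satisfy $\nu_-\le\nu(r)\le\nu_+$ and $\kappa_-\le\kappa(r)\le\kappa_+$ for all $r\in\mathbb{R}$, with positive constants $\nu_\pm,\kappa_\pm$. Let $\mathbf{f}\in\mathbf{H}^{-1}(\Omega)$ and $g\in H^{-1}(\Omega)$. Let $(\mathbf{u},\mathsf{p},T)\in(\mathbf{W}^{1,3}(\Omega)\cap\mathbf{H}_0^1(\Omega))\times L_0^2(\Omega)\times(W^{1,3}(\Omega)\cap H_0^1(\Omega))$ be a weak solution of the coupled problem, and let $(\mathbf{u}_h,\mathsf{p}_h,T_h)\in(\mathbf{W}^{1,3}(\Omega)\cap\mathbf{X}_h)\times M_h\times(W^{1,3}(\Omega)\cap Y_h)$ be a solution of the discrete coupled problem such that $$\frac{\mathcal{C}_N}{\nu_-^2}\|\mathbf{f}\|_{\mathbf{H}^{-1}(\Omega)}+\frac{\mathcal{L}_\nu\mathcal{C}_{6\hookrightarrow2}\mathcal{C}_{4\hookrightarrow2}^2\|g\|_{H^{-1}(\Omega)}\|\nabla\mathbf{u}_h\|_{\mathbf{L}^3(\Omega)}}{\nu_-\kappa_-\left(\kappa_--\mathcal{L}_\kappa\mathcal{C}_{6\hookrightarrow2}\|\nabla T_h\|_{\mathbf{L}^3(\Omega)}\right)}<1,\qquad\mathcal{L}_\kappa\mathcal{C}_{6\hookrightarrow2}\|\nabla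 T_h\|_{\mathbf{L}^3(\Omega)}<\kappa_-.$$ If $\mathfrak{M}(T)>0$ and $\mathfrak{N}(\mathbf{f},g,\mathbf{u})>0$ (quantities defined in the context), then there is a constant $C>0$ independent of $h$ such that $$\|\nabla(\mathbf{u}-\mathbf{u}_h)\|_{\mathbf{L}^2(\Omega)}+\|\nabla(T-T_h)\|_{\mathbf{L}^2(\Omega)}+\|\mathsf{p}-\mathsf{p}_h\|_{L^2(\Omega)}\le C\Big(\inf_{\mathbf{w}_h\in\mathbf{V}_h}\|\nabla(\mathbf{u}-\mathbf{w}_h)\|_{\mathbf{L}^2(\Omega)}+\inf_{R_h\in Y_h}\|\nabla(T-R_h)\|_{\mathbf{L}^2(\Omega)}+\inf_{\mathsf{q}_h\in M_h}\|\mathsf{p}-\mathsf{q}_h\|_{L^2(\Omega)}\Big).$$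
   Context: Bold letters denote $\mathbb{R}^d$-valued functions and their spaces; $|\cdot|$ is the Euclidean norm. $L_0^2(\Omega)$ is the space of $L^2(\Omega)$ functions with zero mean. $H^{-1}(\Omega)$ and $\mathbf{H}^{-1}(\Omega)$ are the duals of $H_0^1(\Omega)$ and $\mathbf{H}_0^1(\Omega)$, with dual norms taken with respect to the norm $\|\nabla\cdot\|_{L^2(\Omega)}$. Weak solution of the coupled problem: $(\mathbf{u},\mathsf{p},T)\in\mathbf{H}_0^1(\Omega)\times L_0^2(\Omega)\times H_0^1(\Omega)$ such that for all $(\mathbf{v},\mathsf{q},S)\in\mathbf{H}_0^1(\Omega)\times L_0^2(\Omega)\times H_0^1(\Omega)$ $$\int_\Omega\left(\nu(T)\nabla\mathbf{u}\cdot\nabla\mathbf{v}+(\mathbf{u}\cdot\nabla)\mathbf{u}\cdot\mathbf{v}+\mathbf{u}\cdot\mathbf{v}+|\mathbf{u}|^{s-2}\mathbf{u}\cdot\mathbf{v}-\mathsf{p}\,\mathrm{div}\,\mathbf{v}\right)\mathrm{d}x=\langle\mathbf{f},\mathbf{v}\rangle,$$ $$\int_\Omega\mathsf{q}\,\mathrm{div}\,\mathbf{u}\,\mathrm{d}x=0,\qquad\int_\Omega\left(\kappa(T)\nabla T\cdot\nabla S+(\mathbf{u}\cdot\nabla T)S\right)\mathrm{d}x=\langle g,S\rangle.$$ Meshes and spaces. $\mathbb{T}=\{\mathscr{T}_h\}_{h>0}$ is a shape-regular family of conforming partitions of $\bar\Omega$ into closed simplices $K$, refinements of an initial mesh $\mathscr{T}_0$,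 with $h=\max_K\mathrm{diam}(K)$. The pair $(\mathbf{X}_h,M_h)$ is one of: (1) Taylor--Hood: $\mathbf{X}_h=\{\mathbf{v}_h\in\mathbf{C}(\bar\Omega):\mathbf{v}_h|_K\in[\mathbb{P}_2(K)]^d\ \forall K\in\mathscr{T}_h\}\cap\mathbf{H}_0^1(\Omega)$, $M_h=\{\mathsf{q}_h\in L_0^2(\Omega)\cap C(\bar\Omega):\mathsf{q}_h|_K\in\mathbb{P}_1(K)\ \forall K\in\mathscr{T}_h\}$; (2) mini element: $\mathbf{X}_h=\{\mathbf{v}_h\in\mathbf{C}(\bar\Omega):\mathbf{v}_h|_K\in[\mathbb{P}_1(K)\oplus\mathbb{B}(K)]^d\ \forall K\in\mathscr{T}_h\}\cap\mathbf{H}_0^1(\Omega)$, with $\mathbb{B}(K)$ the span of a local bubble function on $K$, and the same $M_h$. It satisfies the uniform discrete inf-sup condition: with some $\tilde\beta>0$ independent of $h$, $\inf_{\mathsf{q}_h\in M_h\setminus\{0\}}\sup_{\mathbf{v}_h\in\mathbf{X}_h\setminus\{0\}}\frac{\int_\Omega\mathsf{q}_h\,\mathrm{div}\,\mathbf{v}_h\,\mathrm{d}x}{\|\nabla\mathbf{v}_h\|_{\mathbf{L}^2(\Omega)}\|\mathsf{q}_h\|_{L^2(\Omega)}}\ge\tilde\beta$. Further, $Y_h=\{S_h\in C(\bar\Omega):S_h|_K\in\mathbb{P}_{\mathfrak{r}}(K)\ \forall K\in\mathscr{T}_h\}\cap H_0^1(\Omega)$ with $\mathfrak{r}=2$ in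 case (1) and $\mathfrak{r}=1$ in case (2), and $\mathbf{V}_h=\{\mathbf{v}_h\in\mathbf{X}_h:\int_\Omega\mathsf{q}_h\,\mathrm{div}\,\mathbf{v}_h\,\mathrm{d}x=0\ \forall\mathsf{q}_h\in M_h\}$. Discrete coupled problem. Let $a_N(\mathbf{u};\mathbf{v},\mathbf{w})=\int_\Omega(\mathbf{u}\cdot\nabla)\mathbf{v}\cdot\mathbf{w}\,\mathrm{d}x$, $a_{SN}(\mathbf{u};\mathbf{v},\mathbf{w})=\frac12[a_N(\mathbf{u};\mathbf{v},\mathbf{w})-a_N(\mathbf{u};\mathbf{w},\mathbf{v})]$, $a_{ST}(\mathbf{v};T,S)=\frac12\int_\Omega((\mathbf{v}\cdot\nabla T)S-(\mathbf{v}\cdot\nabla S)T)\,\mathrm{d}x$. Find $(\mathbf{u}_h,\mathsf{p}_h,T_h)\in\mathbf{X}_h\times M_h\times Y_h$ such that for all $(\mathbf{v}_h,\mathsf{q}_h,S_h)\in\mathbf{X}_h\times M_h\times Y_h$ $$\int_\Omega(\nu(T_h)\nabla\mathbf{u}_h\cdot\nabla\mathbf{v}_h+\mathbf{u}_h\cdot\mathbf{v}_h)\,\mathrm{d}x+a_{SN}(\mathbf{u}_h;\mathbf{u}_h,\mathbf{v}_h)+\int_\Omega|\mathbf{u}_h|^{s-2}\mathbf{u}_h\cdot\mathbf{v}_h\,\mathrm{d}x-\int_\Omega\mathsf{p}_h\,\mathrm{div}\,\mathbf{v}_h\,\mathrm{d}x=\langle\mathbf{f},\mathbf{v}_h\rangle,$$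 $$\int_\Omega\mathsf{q}_h\,\mathrm{div}\,\mathbf{u}_h\,\mathrm{d}x=0,\qquad\int_\Omega\kappa(T_h)\nabla T_h\cdot\nabla S_h\,\mathrm{d}x+a_{ST}(\mathbf{u}_h;T_h,S_h)=\langle g,S_h\rangle.$$ Constants. $\mathcal{C}_N>0$ is a constant such that $|a_N(\mathbf{u};\mathbf{v},\mathbf{w})|\le\mathcal{C}_N\|\nabla\mathbf{u}\|_{\mathbf{L}^2(\Omega)}\|\nabla\mathbf{v}\|_{\mathbf{L}^2(\Omega)}\|\nabla\mathbf{w}\|_{\mathbf{L}^2(\Omega)}$ on $[\mathbf{H}_0^1(\Omega)]^3$. $\mathcal{C}_{p\hookrightarrow2}$ is the best constant in $\|v\|_{L^p(\Omega)}\le\mathcal{C}_{p\hookrightarrow2}\|\nabla v\|_{\mathbf{L}^2(\Omega)}$ for $v\in H_0^1(\Omega)$ (same symbol for vector-valued functions in $\mathbf{H}_0^1(\Omega)$). With $\tau=3/2$ and $\mu=6$, $$\Gamma_{s,\tau}(\mathbf{f}):=\mathcal{C}_{\tau(s-2)\hookrightarrow2}^{s-2}\,2^{s-2}\nu_-^{2-s}\|\mathbf{f}\|_{\mathbf{H}^{-1}(\Omega)}^{s-2},\qquad\mathfrak{M}(T):=\kappa_--\mathcal{L}_\kappa\mathcal{C}_{6\hookrightarrow2}\|\nabla T\|_{\mathbf{L}^3(\Omega)},$$ $$\mathfrak{O}(g,\mathbf{u}):=(\kappa_-\mathfrak{M}(T))^{-1}\mathcal{L}_\nu\mathcal{C}_{6\hookrightarrow2}\mathcal{C}_{4\hookrightarrow2}^2\|g\|_{H^{-1}(\Omega)}\|\nabla\mathbf{u}\|_{\mathbf{L}^3(\Omega)},$$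 $$\mathfrak{N}(\mathbf{f},g,\mathbf{u}):=\nu_--\nu_-^{-1}\mathcal{C}_N\|\mathbf{f}\|_{\mathbf{H}^{-1}(\Omega)}-\mathcal{C}_{2\hookrightarrow2}^2-\mathcal{C}_{\mu\hookrightarrow2}^2\Gamma_{s,\tau}(\mathbf{f})-\mathfrak{O}(g,\mathbf{u}).$$ *)

(* Defs.v *)
From HB Require Import structures.
From mathcomp Require Import all_boot all_order all_algebra.
From mathcomp Require Import all_classical all_reals all_analysis.

Set Implicit Arguments.
Unset Strict Implicit.
Unset Printing Implicit Defensive.

Import Order.TTheory GRing.Theory Num.Theory numFieldNormedType.Exports.

Local Open Scope classical_set_scope.
Local Open Scope ring_scope.

(* The product structure carries the topology and the Borel sigma-algebra of
   R^3; its norm is the sup norm, so the Euclidean norm is [enorm] below. *)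
Notation pt R :=
  (measurableTypeR R * measurableTypeR R * measurableTypeR R)%type.

(* A Sobolev function is a representative together with a representative of
   its weak gradient (the pair is constrained by [weak_gradient] below), so
   that the vector-space operations act on both components at once. *)
Notation sobf R := ((pt R -> R) * ('I_3 -> pt R -> R))%type.
Notation vsobf R := ('I_3 -> sobf R).

Section Space.
Context {R : realType}.
Implicit Types (x y : pt R) (i : 'I_3).

Definition leb3 : {measure set (pt R) -> \bar R} :=
  ((@lebesgue_measure R \x @lebesgue_measure R) \x @lebesgue_measure R)%E.

Definition crd i x : R :=
  match val i with 0%N => x.1.1 | 1%N => x.1.2 | _ => x.2 end.

Definition bvec i : pt R :=
  ((val i == 0%N)%:R, (val i == 1%N)%:R, (val i == 2%N)%:R).

Definition dot x y : R := \sum_(i < 3) crd i x * crd i y.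
Definition enorm x : R := Num.sqrt (dot x x).
Definition eball x (r : R) : set (pt R) := [set y | enorm (y - x) < r].

Definition diam (A : set (pt R)) : R :=
  sup [set enorm (z.1 - z.2) | z in A `*` A].
Definition inradius (A : set (pt R)) : R :=
  sup [set r | 0 <= r /\ exists c, eball c r `<=` A].

(* Bounded domains whose boundary is locally, in suitable orthonormal
   coordinates, the graph of a Lipschitz function, with the domain lying
   strictly above the graph. *)
Definition lipschitz_domain (Om : set (pt R)) : Prop :=
  [/\ open Om, exists M, forall x, Om x -> enorm x <= M &
   forall x, closure Om x -> ~ Om x ->
   exists (e : 'I_3 -> pt R) (gam : R -> R -> R) (L r : R),
     [/\ forall i j, dot (e i) (e j) = (i == j)%:R,
         forall a b a' b', `|gam a b - gam a' b'| <=
           L * Num.sqrt ((a - a') ^+ 2 + (b - b') ^+ 2),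
         0 < r &
         forall y, eball x r y ->
           (Om y <-> gam (dot y (e 0)) (dot y (e 1)) < dot y (e 2%:R))]].

End Space.

Section Meshes.
Context {R : realType}.
Implicit Types (a : 'I_4 -> pt R) (K F Om : set (pt R)) (Th : set (set (pt R))).

Definition affine_independent a : Prop :=
  forall l : 'I_4 -> R, \sum_i l i = 0 -> \sum_i l i *: a i = 0 ->
    forall i, l i = 0.

Definition hull a (J : {set 'I_4}) : set (pt R) :=
  [set x | exists l : 'I_4 -> R,
    [/\ forall i, 0 <= l i, forall i, i \notin J -> l i = 0,
        \sum_i l i = 1 & x = \sum_i l i *: a i]].

Definition simplex K : Prop :=
  exists2 a, affine_independent a & K = hull a [set: 'I_4].

(* Vertices, edges, triangles, [K] itself, and the empty face. *)
Definition face F K : Prop :=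
  exists a J, [/\ affine_independent a, K = hull a [set: 'I_4] & F = hull a J].

(* Not necessarily convex. *)
Definition polytope Om : Prop :=
  exists Th, [/\ finite_set Th, forall K, Th K -> simplex K
               & closure Om = \bigcup_(K in Th) K].

Definition conforming_mesh Om Th : Prop :=
  [/\ finite_set Th, forall K, Th K -> simplex K,
      closure Om = \bigcup_(K in Th) K,
      forall K K', Th K -> Th K' -> K <> K' ->
        interior K `&` interior K' = set0
    & forall K K', Th K -> Th K' ->
        face (K `&` K') K /\ face (K `&` K') K'].

Definition refines Th Th0 : Prop :=
  forall K, Th K -> exists2 K0, Th0 K0 & K `<=` K0.

Definition shape_regular (TT : set (set (set (pt R)))) : Prop :=
  exists sigma : R, forall Th, TT Th -> forall K, Th K ->
    diam K <= sigma * inradius K.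

Definition mesh_family Om (TT : set (set (set (pt R)))) : Prop :=
  [/\ forall Th, TT Th -> conforming_mesh Om Th,
      exists2 Th0, conforming_mesh Om Th0 & forall Th, TT Th -> refines Th Th0
    & shape_regular TT].

End Meshes.

Section Sobolev.
Context {R : realType}.
Implicit Types (Om : set (pt R)) (v T S : sobf R) (u w : vsobf R).

Definition fn v : pt R -> R := v.1.
Definition gr v (j : 'I_3) : pt R -> R := v.2 j.

Definition pderiv (i : 'I_3) (phi : pt R -> R) : pt R -> R :=
  fun x => 'D_(bvec i) phi x.

Definition smooth (phi : pt R -> R) : Prop :=
  forall l : seq 'I_3, let psi := foldr pderiv phi l in
    continuous psi /\ forall x i, derivable psi x (bvec i).

Definition test_function Om (phi : pt R -> R) : Prop :=
  smooth phi /\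
  exists K, [/\ compact K, K `<=` Om & forall x, ~ K x -> phi x = 0].

Definition jet (phi : pt R -> R) : sobf R := (phi, pderiv ^~ phi).

Definition Lp_norm Om (p : R) (q : pt R -> R) : \bar R :=
  'N[leb3]_(p%:E)[EFin \o (q \_ Om)]%E.

Definition Lp Om (p : R) (q : pt R -> R) : Prop :=
  measurable_fun Om q /\ (Lp_norm Om p q < +oo)%E.

Definition L2_norm Om (q : pt R -> R) : R := fine (Lp_norm Om 2 q).

Definition L20 Om (q : pt R -> R) : Prop :=
  Lp Om 2 q /\ \int[leb3]_(x in Om) q x = 0.

Definition weak_gradient Om v : Prop :=
  forall phi, test_function Om phi -> forall i,
    \int[leb3]_(x in Om) (fn v x * pderiv i phi x) =
    - \int[leb3]_(x in Om) (gr v i x * phi x).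

Definition W1p Om (p : R) v : Prop :=
  [/\ Lp Om p (fn v), forall i, Lp Om p (gr v i) & weak_gradient Om v].

(* Euclidean (Frobenius) norms of values and gradients. *)
Definition gabs v (x : pt R) : R := Num.sqrt (\sum_(j < 3) gr v j x ^+ 2).
Definition vabs u (x : pt R) : R := Num.sqrt (\sum_(i < 3) fn (u i) x ^+ 2).
Definition vgabs u (x : pt R) : R :=
  Num.sqrt (\sum_(i < 3) \sum_(j < 3) gr (u i) j x ^+ 2).

Definition H10 Om v : Prop :=
  W1p Om 2 v /\
  forall eps : R, 0 < eps -> exists2 phi, test_function Om phi &
    (Lp_norm Om 2 (fn (v - jet phi)%R) + Lp_norm Om 2 (gabs (v - jet phi)%R)
       < eps%:E)%E.

Definition vH10 Om u : Prop := forall i, H10 Om (u i).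
Definition vW1p Om (p : R) u : Prop := forall i, W1p Om p (u i).

Definition grad_norm Om (p : R) v : R := fine (Lp_norm Om p (gabs v)).
Definition vgrad_norm Om (p : R) u : R := fine (Lp_norm Om p (vgabs u)).

Definition bounded_linear (V : lmodType R) (H : set V) (n : V -> R)
    (F : V -> R) : Prop :=
  (forall (c : R) (x y : V), H x -> H y -> F (c *: x + y) = c * F x + F y) /\
  exists C, forall x, H x -> `|F x| <= C * n x.

Definition dual_norm (V : lmodType R) (H : set V) (n : V -> R)
    (F : V -> R) : R :=
  sup [set `|F x| | x in [set x | H x /\ n x <= 1]].

Definition Hm1 Om (g : sobf R -> R) : Prop :=
  bounded_linear (H10 Om) (grad_norm Om 2) g.
Definition vHm1 Om (f : vsobf R -> R) : Prop :=
  bounded_linear (vH10 Om) (vgrad_norm Om 2) f.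
Definition Hm1_norm Om (g : sobf R -> R) : R :=
  dual_norm (H10 Om) (grad_norm Om 2) g.
Definition vHm1_norm Om (f : vsobf R -> R) : R :=
  dual_norm (vH10 Om) (vgrad_norm Om 2) f.

Definition least (A : set R) (c : R) : Prop := A c /\ lbound A c.

(* [c] is the best constant both for scalar and for vector-valued functions.
   The left-hand sides are extended reals: membership in L^p is part of the
   embedding. *)
Definition best_embedding Om (p c : R) : Prop :=
  least [set C | 0 <= C /\ forall v, H10 Om v ->
           (Lp_norm Om p (fn v) <= (C * grad_norm Om 2 v)%:E)%E] c /\
  least [set C | 0 <= C /\ forall u, vH10 Om u ->
           (Lp_norm Om p (vabs u) <= (C * vgrad_norm Om 2 u)%:E)%E] c.

End Sobolev.

Section Forms.
Context {R : realType}.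
Implicit Types (Om : set (pt R)) (T S : sobf R) (u v w : vsobf R).

Definition vdot u v (x : pt R) : R := \sum_(i < 3) fn (u i) x * fn (v i) x.
Definition gdot T S (x : pt R) : R := \sum_(j < 3) gr T j x * gr S j x.
Definition vgdot u v (x : pt R) : R :=
  \sum_(i < 3) \sum_(j < 3) gr (u i) j x * gr (v i) j x.
Definition div u (x : pt R) : R := \sum_(i < 3) gr (u i) i x.

(* ((u . grad) v) . w *)
Definition vconv u v w (x : pt R) : R :=
  \sum_(i < 3) (\sum_(j < 3) fn (u j) x * gr (v i) j x) * fn (w i) x.
(* (u . grad T) S *)
Definition sconv u T S (x : pt R) : R :=
  (\sum_(j < 3) fn (u j) x * gr T j x) * fn S x.

Definition aN Om u v w : R := \int[leb3]_(x in Om) vconv u v w x.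
Definition aSN Om u v w : R := 2^-1 * (aN Om u v w - aN Om u w v).
Definition aST Om v T S : R :=
  2^-1 * \int[leb3]_(x in Om) (sconv v T S x - sconv v S T x).

Definition trilinear_bound Om (CN : R) : Prop :=
  0 < CN /\ forall u v w, vH10 Om u -> vH10 Om v -> vH10 Om w ->
    `|aN Om u v w| <=
      CN * vgrad_norm Om 2 u * vgrad_norm Om 2 v * vgrad_norm Om 2 w.

Definition weak_solution Om (nu kap : R -> R) (s : R) (f : vsobf R -> R)
    (g : sobf R -> R) u (p : pt R -> R) T : Prop :=
  [/\ vH10 Om u, L20 Om p & H10 Om T] /\
  [/\ forall v, vH10 Om v ->
        \int[leb3]_(x in Om)
          (nu (fn T x) * vgdot u v x + vconv u u v x + vdot u v x
           + vabs u x `^ (s - 2) * vdot u v x - p x * div v x) = f v,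
      forall q, L20 Om q -> \int[leb3]_(x in Om) (q x * div u x) = 0
    & forall S, H10 Om S ->
        \int[leb3]_(x in Om)
          (kap (fn T x) * gdot T S x + sconv u T S x) = g S].

End Forms.

Section FiniteElements.
Context {R : realType}.
Implicit Types (Om K : set (pt R)) (Th : set (set (pt R))).

(* Polynomials in three variables of total degree at most [k]. *)
Definition poly_le (k : nat) (p : pt R -> R) : Prop :=
  exists c : nat -> nat -> nat -> R, forall x,
    p x = \sum_(i < k.+1) \sum_(j < k.+1) \sum_(l < k.+1 | (i + j + l <= k)%N)
            c i j l * crd 0 x ^+ i * crd 1 x ^+ j * crd 2%:R x ^+ l.

Definition is_bubble K (b : pt R -> R) : Prop :=
  [/\ {within K, continuous b},
      exists G, H10 (interior K) (b, G),
      forall x, K x -> ~ interior K x -> b x = 0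
    & exists2 x, K x & b x != 0].

(* The argument of [Mini] assigns to each simplex its local bubble function. *)
Inductive fe_pair := TaylorHood | Mini of (set (pt R) -> pt R -> R).

Definition admissible_pair (e : fe_pair) (TT : set (set (set (pt R)))) : Prop :=
  if e is Mini b then forall Th, TT Th -> forall K, Th K -> is_bubble K (b K)
  else True.

Definition local_velocity (e : fe_pair) K (v : pt R -> R) : Prop :=
  match e with
  | TaylorHood => exists2 p, poly_le 2 p & forall x, K x -> v x = p x
  | Mini b => exists2 p, poly_le 1 p &
      exists c : R, forall x, K x -> v x = p x + c * b K x
  end.

Definition temp_degree (e : fe_pair) : nat :=
  if e is TaylorHood then 2 else 1.

Definition Xh (e : fe_pair) Om Th (v : vsobf R) : Prop :=
  vH10 Om v /\
  forall i, {within closure Om, continuous (fn (v i))} /\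
    forall K, Th K -> local_velocity e K (fn (v i)).

Definition Mh Om Th (q : pt R -> R) : Prop :=
  [/\ L20 Om q, {within closure Om, continuous q}
    & forall K, Th K -> exists2 p, poly_le 1 p & forall x, K x -> q x = p x].

Definition Yh (e : fe_pair) Om Th (S : sobf R) : Prop :=
  [/\ H10 Om S, {within closure Om, continuous (fn S)}
    & forall K, Th K ->
        exists2 p, poly_le (temp_degree e) p & forall x, K x -> fn S x = p x].

Definition Vh (e : fe_pair) Om Th (v : vsobf R) : Prop :=
  Xh e Om Th v /\
  forall q, Mh Om Th q -> \int[leb3]_(x in Om) (q x * div v x) = 0.

(* A nonzero element of X_h or M_h is one of nonzero norm, since functions are
   identified almost everywhere; extended reals give the infimum over an empty
   set its usual value. *)
Definition inf_sup (e : fe_pair) Om Th (beta : R) : Prop :=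
  let Xh_neq0 := [set v | Xh e Om Th v /\ vgrad_norm Om 2 v != 0] in
  let Mh_neq0 := [set q | Mh Om Th q /\ L2_norm Om q != 0] in
  let quot q v := (\int[leb3]_(x in Om) (q x * div v x))
                  / (vgrad_norm Om 2 v * L2_norm Om q) in
  (beta%:E <= ereal_inf [set ereal_sup [set (quot q v)%:E | v in Xh_neq0]
                           | q in Mh_neq0])%E.

Definition discrete_solution (e : fe_pair) Om Th (nu kap : R -> R) (s : R)
    (f : vsobf R -> R) (g : sobf R -> R) (u : vsobf R) (p : pt R -> R)
    (T : sobf R) : Prop :=
  [/\ Xh e Om Th u, Mh Om Th p & Yh e Om Th T] /\
  [/\ forall v, Xh e Om Th v ->
        \int[leb3]_(x in Om) (nu (fn T x) * vgdot u v x + vdot u v x)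
        + aSN Om u u v
        + \int[leb3]_(x in Om) (vabs u x `^ (s - 2) * vdot u v x)
        - \int[leb3]_(x in Om) (p x * div v x) = f v,
      forall q, Mh Om Th q -> \int[leb3]_(x in Om) (q x * div u x) = 0
    & forall S, Yh e Om Th S ->
        \int[leb3]_(x in Om) (kap (fn T x) * gdot T S x) + aST Om u T S = g S].

End FiniteElements.

Arguments TaylorHood {R}.

Section Constants.
Context {R : realType}.

(* In these definitions [Ce p] stands for the best constant of the embedding
   into L^p. *)
Definition Gam (Om : set (pt R)) (Ce : R -> R) (tau s nu_m : R)
    (f : vsobf R -> R) : R :=
  Ce (tau * (s - 2)) `^ (s - 2) * 2 `^ (s - 2) * nu_m `^ (2 - s)
  * vHm1_norm Om f `^ (s - 2).

Definition frakM (Om : set (pt R)) (Ce : R -> R) (Lk kap_m : R) (T : sobf R) : R :=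
  kap_m - Lk * Ce 6 * grad_norm Om 3 T.

Definition frakO (Om : set (pt R)) (Ce : R -> R) (Ln Lk kap_m : R)
    (g : sobf R -> R) (u : vsobf R) (T : sobf R) : R :=
  (kap_m * frakM Om Ce Lk kap_m T)^-1
  * (Ln * Ce 6 * Ce 4 ^+ 2 * Hm1_norm Om g * vgrad_norm Om 3 u).

Definition frakN (Om : set (pt R)) (Ce : R -> R) (CN s Ln Lk nu_m kap_m : R)
    (f : vsobf R -> R) (g : sobf R -> R) (u : vsobf R) (T : sobf R) : R :=
  nu_m - nu_m^-1 * CN * vHm1_norm Om f - Ce 2 ^+ 2
  - Ce 6 ^+ 2 * Gam Om Ce (3 / 2) s nu_m f
  - frakO Om Ce Ln Lk kap_m g u T.

Definition bounded_lipschitz (k : R -> R) (L lo hi : R) : Prop :=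
  [/\ forall a b, `|k a - k b| <= L * `|a - b|, 0 < lo, 0 < hi
    & forall r, lo <= k r <= hi].

End Constants.

(* Main.v *)
Require Import Defs.
From HB Require Import structures.
From mathcomp Require Import all_boot all_order all_algebra.
From mathcomp Require Import all_classical all_reals all_analysis.
From mathcomp Require Import measurable_realfun lra ring.
Import Order.TTheory GRing.Theory Num.Theory numFieldNormedType.Exports.

(** The estimate is a quasi-optimality bound for the coupled problem; the
    constant depends only on the data and on the exact solution.

    Both problems can be tested with the same discrete functions, once the
    convective terms have the same form. The discrete forms are
    skew-symmetric by construction; the continuous ones are, because [u] is
    divergence free ([sconv_skew]): for test functions,
    [u . grad (phi psi)] integrates to zero by the definition of the weak
    gradient of [u], and the general case follows by density, the form being
    continuous in H^1. For this, test functions have to belong to H^1_0, that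
    is, partial derivatives of compactly supported functions must integrate
    to zero ([integral_pderiv_compact], from Fubini and the fundamental
    theorem of calculus). Testing with the solutions themselves bounds [u]
    and [uh] by [|f| / nu_m] and [T] by [|g| / kap_m].

    Subtracting the two problems gives the error equations [heat_error] and
    [momentum_error]. Tested with [Rh - Temph], the first one bounds the
    temperature error by the interpolation error and
    [Ce 4 ^+ 2 * (|g| / kap_m) / frakM] times the velocity error
    ([temperature_estimate]): the difference of the two conductivities costs
    [Lk * Ce 6 * |grad T|_3] times the temperature error, which [frakM > 0]
    lets the left-hand side absorb. Tested with [wh - uh], the second one
    bounds [nu_m |wh - uh|^2] by interpolation errors,
    [CN |f| / nu_m |wh - uh|^2] from convection and
    [frakO |wh - uh|^2] from the viscosity difference, after the temperature
    bound has been inserted ([velocity_inequality], [velocity_algebra]);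
    [frakN > 0] absorbs the last two. The map [a |-> |a|^(s-2) a] is monotone
    ([power_monotone]), so the Forchheimer term only contributes its pairing
    with the interpolation error, which is controlled by four L^4 norms
    because [1 <= s - 2 <= 2] ([power_lipschitz], [quartic_form]).

    The pressure error comes from the inf-sup condition applied to
    [qh - ph], with the momentum error equation as right-hand side
    ([pressure_inequality]); [cea_estimate] combines the three bounds. *)

Set Implicit Arguments.
Unset Strict Implicit.
Unset Printing Implicit Defensive.

Local Open Scope classical_set_scope.
Local Open Scope ring_scope.

(** * Integrals and Lebesgue norms on a measurable set *)

Local Notation integrable_on Om f := (leb3.-integrable Om (EFin \o f)).
Local Notation Int Om f := (\int[leb3]_(x in Om) f x).
Local Notation pnorm Om p q := (fine (Lp_norm Om p q)).

Section Toolkit.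
Context {R : realType} (Om : set (pt R)) (mOm : measurable Om).
Implicit Types (a b q : pt R -> R) (p : R) (k : nat).

Lemma eq_Int b a : (forall x, a x = b x) -> Int Om a = Int Om b.
Proof. by move=> ab; apply: eq_Rintegral => x _; exact: ab. Qed.

Lemma measurable_restr q : measurable_fun Om q -> measurable_fun setT (q \_ Om).
Proof. by move=> mq; apply/(measurable_restrictT _ mOm). Qed.

Lemma Lp_norm_powR p q : 0 < p ->
  (Lp_norm Om p q `^ p = \int[leb3]_(x in Om) (`|q x| `^ p)%:E)%E.
Proof.
move=> p0; have p1 : p != 0 by rewrite gt_eqF.
rewrite /Lp_norm (powR_Lnorm _ _ p1).
rewrite [RHS]integral_mkcond; apply: eq_integral => x _ /=.
by rewrite !patchE; case: ifP => //= _; rewrite normr0 powR0 ?gt_eqF.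
Qed.

Lemma Lp_integrable_on p q : 0 < p -> Lp Om p q ->
  integrable_on Om (fun x => `|q x| `^ p).
Proof.
move=> p0 [mq qfin]; apply/integrableP; split.
  apply/measurable_EFinP; apply: (measurableT_comp (measurable_powR _)).
  exact: measurableT_comp.
under eq_integral do rewrite /= ger0_norm ?powR_ge0//.
by rewrite -Lp_norm_powR// poweR_lty.
Qed.

Lemma integrable_on_Lp p q : 0 < p -> measurable_fun Om q ->
  integrable_on Om (fun x => `|q x| `^ p) -> Lp Om p q.
Proof.
move=> p0 mq /integrableP[_]; under eq_integral do rewrite /= ger0_norm ?powR_ge0//.
rewrite -Lp_norm_powR// => h; split => //.
rewrite ltey; apply/eqP => e; move: h; rewrite e poweRyr ?gt_eqF// ltxx.
Qed.

Lemma Lp_fin p q : Lp Om p q -> (pnorm Om p q)%:E = Lp_norm Om p q.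
Proof.
by move=> [_ h]; rewrite fineK// ge0_fin_numE// Lnorm_ge0.
Qed.

Lemma pnorm_ge0 p q : 0 <= pnorm Om p q.
Proof. by rewrite fine_ge0// Lnorm_ge0. Qed.

Lemma pnorm_powR p q : 0 < p -> Lp Om p q ->
  pnorm Om p q `^ p = Int Om (fun x => `|q x| `^ p).
Proof.
by move=> p0 h; rewrite /Rintegral -Lp_norm_powR// -Lp_fin.
Qed.

Lemma pnorm_expn k q : (0 < k)%N -> Lp Om k%:R q ->
  pnorm Om k%:R q ^+ k = Int Om (fun x => `|q x| ^+ k).
Proof.
move=> k0 h; have := pnorm_powR _ h; rewrite ltr0n => /(_ k0).
rewrite powR_mulrn ?pnorm_ge0// => ->.
by under eq_Rintegral do rewrite powR_mulrn//.
Qed.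

Lemma integrable_on_dom a b : measurable_fun Om a -> integrable_on Om b ->
  (forall x, Om x -> `|a x| <= b x) -> integrable_on Om a.
Proof.
move=> ma ib ab; apply: (le_integrable mOm _ _ ib).
  exact/measurable_EFinP.
by move=> x /ab h; rewrite /= lee_fin (le_trans h)// ler_norm.
Qed.

Lemma integrable_onD a b : integrable_on Om a -> integrable_on Om b ->
  integrable_on Om (fun x => a x + b x).
Proof. by move=> ia ib; exact: (integrableD mOm ia ib). Qed.

Lemma integrable_onB a b : integrable_on Om a -> integrable_on Om b ->
  integrable_on Om (fun x => a x - b x).
Proof. by move=> ia ib; exact: (integrableB mOm ia ib). Qed.

Lemma integrable_onZ c a : integrable_on Om a -> integrable_on Om (fun x => c * a x).
Proof. by move=> ia; exact: (integrableZl mOm c ia). Qed.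

(** The whole-space inequality, applied to the extensions by zero. *)
Lemma holder p r a b : 0 < p -> 0 < r -> p^-1 + r^-1 = 1 ->
  Lp Om p a -> Lp Om r b ->
  integrable_on Om (fun x => a x * b x) /\
  Int Om (fun x => `|a x * b x|) <= pnorm Om p a * pnorm Om r b.
Proof.
move=> p0 r0 pr la lb.
have mab : measurable_fun Om (fun x => a x * b x).
  by apply: measurable_funM; [case: la|case: lb].
have E : (\int[leb3]_(x in Om) `|(a x * b x)%:E| <=
    (pnorm Om p a * pnorm Om r b)%:E)%E.
  have := hoelder leb3 (measurable_restr la.1) (measurable_restr lb.1) p0 r0 pr.
  rewrite -!/(Lp_norm _ _ _) EFinM !Lp_fin//; apply: le_trans.
  rewrite Lnorm1 le_eqVlt; apply/orP; left; apply/eqP; rewrite [LHS]integral_mkcond.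
  apply: eq_integral => x _ /=.
  by rewrite !patchE; case: ifP => //= _; rewrite mulr0 normr0.
have S : integrable_on Om (fun x => a x * b x).
  apply/integrableP; split; first exact/measurable_EFinP.
  exact: (le_lt_trans E (ltry _)).
split => //; rewrite -lee_fin /Rintegral fineK//.
have := integrable_fin_num mOm (integrable_norm S).
exact.
Qed.

Lemma le_powR_inv (x y z : R) : 0 < z -> 0 <= x -> 0 <= y ->
  x `^ z <= y `^ z -> x <= y.
Proof.
by move=> z0 x0 y0; apply: contraTT; rewrite -!ltNge => yx; rewrite gt0_ltr_powR.
Qed.

(** Replacing a function by a power of its absolute value trades exponents;
    this reduces Hoelder inequalities with three exponents to conjugate ones. *)
Lemma Lp_powR p r a : 0 < p -> 0 < r -> Lp Om p a ->
  Lp Om (p / r) (fun x => `|a x| `^ r) /\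
  pnorm Om (p / r) (fun x => `|a x| `^ r) = pnorm Om p a `^ r.
Proof.
move=> p0 r0 la; have pr0 : 0 < p / r by rewrite divr_gt0.
have E x : `| `|a x| `^ r | `^ (p / r) = `|a x| `^ p.
  by rewrite ger0_norm ?powR_ge0// -powRrM mulrC divfK ?gt_eqF.
have lar : Lp Om (p / r) (fun x => `|a x| `^ r).
  apply: integrable_on_Lp => //; last by under eq_fun do rewrite E; exact: Lp_integrable_on.
  apply: (measurableT_comp (measurable_powR _)).
  by apply: measurableT_comp => //; case: la.
split => //; apply: (powR_injective pr0); rewrite ?nnegrE ?pnorm_ge0 ?powR_ge0//.
have r1 : r != 0 by rewrite gt_eqF.
rewrite -powRrM (mulrC r) (divfK r1) (pnorm_powR p0 la) (pnorm_powR pr0 lar).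
by under eq_Rintegral do rewrite E.
Qed.

(** The exponents [p / r] and [s / r] of [|a|^r] and [|b|^r] are conjugate. *)
Lemma Lp_mul p s r a b : 0 < p -> 0 < s -> 0 < r -> r / p + r / s = 1 ->
  Lp Om p a -> Lp Om s b ->
  Lp Om r (fun x => a x * b x) /\
  pnorm Om r (fun x => a x * b x) <= pnorm Om p a * pnorm Om s b.
Proof.
move=> p0 s0 r0 prs la lb.
have [la' Ea] := Lp_powR p0 r0 la; have [lb' Eb] := Lp_powR s0 r0 lb.
have prs' : (p / r)^-1 + (s / r)^-1 = 1 by rewrite !invf_div.
have [S H] := holder (divr_gt0 p0 r0) (divr_gt0 s0 r0) prs' la' lb'.
have E x : `|a x| `^ r * `|b x| `^ r = `|a x * b x| `^ r.
  by rewrite normrM powRM.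
have lab : Lp Om r (fun x => a x * b x).
  apply: integrable_on_Lp => //; last by under eq_fun do rewrite -E.
  by apply: measurable_funM; [case: la|case: lb].
split => //.
apply: (@le_powR_inv _ _ r); rewrite ?mulr_ge0 ?pnorm_ge0//.
rewrite (pnorm_powR r0 lab) powRM ?pnorm_ge0// -Ea -Eb; apply: le_trans H.
rewrite le_eqVlt; apply/orP; left; apply/eqP.
apply: eq_Rintegral => x _; rewrite /= E [RHS]ger0_norm//; exact: powR_ge0.
Qed.

Lemma pnorm_mono p a b : 0 < p -> measurable_fun Om a -> Lp Om p b ->
  (forall x, Om x -> `|a x| <= `|b x|) -> Lp Om p a /\ pnorm Om p a <= pnorm Om p b.
Proof.
move=> p0 ma lb ab.
have ab' x : Om x -> `|a x| `^ p <= `|b x| `^ p.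
  by move=> xO; rewrite ge0_ler_powR ?nnegrE ?ab// ltW.
have sa : integrable_on Om (fun x => `|a x| `^ p).
  apply: integrable_on_dom (Lp_integrable_on p0 lb) _ => //.
    by apply: (measurableT_comp (measurable_powR _)); exact: measurableT_comp.
  by move=> x xO; rewrite ger0_norm ?powR_ge0 ?ab'.
have la := integrable_on_Lp p0 ma sa; split => //.
apply: (@le_powR_inv _ _ p); rewrite ?pnorm_ge0//.
rewrite !pnorm_powR//; apply: le_Rintegral => //; exact: Lp_integrable_on.
Qed.

Lemma pnormZ p c a : 0 < p -> Lp Om p a ->
  Lp Om p (fun x => c * a x) /\ pnorm Om p (fun x => c * a x) = `|c| * pnorm Om p a.
Proof.
move=> p0 la.
have E x : `|c * a x| `^ p = `|c| `^ p * `|a x| `^ p by rewrite normrM powRM.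
have lca : Lp Om p (fun x => c * a x).
  apply: integrable_on_Lp => //; first by apply: measurable_funM => //; case: la.
  by under eq_fun do rewrite E; apply: integrable_onZ; exact: Lp_integrable_on.
split => //; apply: (powR_injective p0); rewrite ?nnegrE ?mulr_ge0 ?pnorm_ge0//.
rewrite powRM ?pnorm_ge0// !pnorm_powR//; under eq_Rintegral do rewrite E.
by rewrite RintegralZl//; exact: Lp_integrable_on.
Qed.

Lemma cauchy_schwarz a b : Lp Om 2 a -> Lp Om 2 b ->
  integrable_on Om (fun x => a x * b x) /\
  `|Int Om (fun x => a x * b x)| <= pnorm Om 2 a * pnorm Om 2 b.
Proof.
move=> la lb; have [] := holder _ _ _ la lb => //; first by lra.
move=> S H; split => //; apply: le_trans H; exact: le_normr_Rintegral.
Qed.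

Lemma L4_mul a b : Lp Om 4 a -> Lp Om 4 b ->
  Lp Om 2 (fun x => a x * b x) /\
  pnorm Om 2 (fun x => a x * b x) <= pnorm Om 4 a * pnorm Om 4 b.
Proof. by move=> la lb; apply: Lp_mul => //; lra. Qed.

Lemma L6_L3_mul a b : Lp Om 6 a -> Lp Om 3 b ->
  Lp Om 2 (fun x => a x * b x) /\
  pnorm Om 2 (fun x => a x * b x) <= pnorm Om 6 a * pnorm Om 3 b.
Proof. by move=> la lb; apply: Lp_mul => //; lra. Qed.

(** Bilinear forms are estimated by dominating the integrand pointwise by a
    product of two square-integrable functions; this gives integrability and
    the bound at once. *)
Lemma le_abs_Int a b c : measurable_fun Om a ->
  Lp Om 2 b -> Lp Om 2 c -> (forall x, Om x -> `|a x| <= `|b x| * `|c x|) ->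
  integrable_on Om a /\ `|Int Om a| <= pnorm Om 2 b * pnorm Om 2 c.
Proof.
move=> ma lb lc h.
have p0 : 0 < 2 :> R by [].
have n q : Lp Om 2 q -> Lp Om 2 (fun x => `|q x|) /\
    pnorm Om 2 (fun x => `|q x|) <= pnorm Om 2 q.
  move=> lq; apply: pnorm_mono => //; last by move=> x _; rewrite normr_id.
  by apply: measurableT_comp => //; case: lq.
have [lb' nb] := n _ lb; have [lc' nc] := n _ lc.
have [S H] := cauchy_schwarz lb' lc'.
have sa : integrable_on Om a by exact: integrable_on_dom S h.
split => //; apply: (le_trans (le_normr_Rintegral mOm sa)).
apply: (@le_trans _ _ (Int Om (fun x => `|b x| * `|c x|))).
  by apply: le_Rintegral => //; exact: (integrable_norm sa).
apply: (le_trans (ler_norm _)); apply: (le_trans H).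
by rewrite ler_pM// pnorm_ge0.
Qed.

Lemma pnorm2_sqr a : Lp Om 2 a -> pnorm Om 2 a ^+ 2 = Int Om (fun x => a x ^+ 2).
Proof.
by move=> la; rewrite (@pnorm_expn 2)//; under eq_Rintegral do rewrite real_normK ?num_real//.
Qed.

Lemma L2_integrable_on a : Lp Om 2 a -> integrable_on Om (fun x => a x ^+ 2).
Proof. by move=> la; have [+ _] := cauchy_schwarz la la; under eq_fun do rewrite -expr2. Qed.

End Toolkit.
Arguments eq_Int {R Om} b {a}.

(** * Borel sets and derivatives with compact support *)

Section Borel.
Context {R : realType}.

Lemma measurable_pt_ball (c : pt R) (r : R) : measurable (ball c r).
Proof.
rewrite (_ : ball c r = (ball c.1.1 r `*` ball c.1.2 r) `*` ball c.2 r).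
  by apply: measurableX; [apply: measurableX|]; exact: measurable_ball.
by apply/seteqP; split => -[[x1 x2] x3]; case => [[]].
Qed.

(** The sigma-algebra of the space is the product one, so that this needs the
    countable base of balls with rational centres and radii [1 / n]. *)
Lemma open_measurable_pt (A : set (pt R)) : open A -> measurable A.
Proof.
move=> oA.
pose c (q : rat * rat * rat * nat) : pt R :=
  (ratr q.1.1.1, ratr q.1.1.2, ratr q.1.2).
pose B q : set (pt R) := ball (c q) (q.2.+1%:R^-1).
have -> : A = \bigcup_(q in [set: (rat * rat * rat * nat)%type])
    (if `[< B q `<=` A >] then B q else set0).
  apply/seteqP; split => [x Ax|x [q _]]; last by case: asboolP => // BA /BA.
  have := open_nbhs_nbhs (conj oA Ax).
  rewrite -nbhs_ballE => -[e /= e0 eA].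
  (* a ball of radius 1/(n+1) with a point within that distance of its centre
     lies in the ball of radius 2/(n+1) about the point *)
  have [n n2] : exists n, 2 * n.+1%:R^-1 < e :> R.
    have e2 : 0 < e / 2 by rewrite divr_gt0.
    have := near_infty_natSinv_lt (PosNum e2).
    by move=> [n _ /(_ n (leqnn n)) /= h]; exists n; rewrite mulrC -ltr_pdivlMr.
  have d0 : 0 < n.+1%:R^-1 :> R by rewrite invr_gt0.
  have near (t : R) : exists q : rat, `|ratr q - t| < n.+1%:R^-1.
    have [q] : exists q : rat, ratr q \in `]t, (t + n.+1%:R^-1)[%R.
      by apply: rat_in_itvoo; rewrite ltrDl.
    by rewrite in_itv/= => /andP[h1 h2]; exists q; rewrite ger0_norm ?subr_ge0 ?ltW// ltrBlDl.
  have [q1 h1] := near x.1.1; have [q2 h2] := near x.1.2; have [q3 h3] := near x.2.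
  exists (q1, q2, q3, n) => //.
  have cx : B (q1, q2, q3, n) x by split => //=; split => //=.
  case: asboolP => // /existsNP[y /not_implyP[By]] nAy.
  exfalso; apply: nAy; apply: eA.
  have := ball_triangle (ball_sym cx) By.
  by apply: le_ball; apply: le_trans (ltW n2); rewrite mulr_natl mulr2n.
apply: countable_bigcupT_measurable => // q.
by case: asboolP => // _; exact: measurable_pt_ball.
Qed.

Lemma continuous_measurable_pt (D : set (pt R)) (f : pt R -> R) :
  continuous f -> measurable_fun D f.
Proof.
move=> cf; apply: measurable_funTS; apply: (measurability _ (RGenOpens.measurableE R)).
move=> _ [_ [a [b ->] <-]]; rewrite setTI; apply: open_measurable_pt.
by move/continuousP : cf; apply; exact: interval_open.
Qed.

Lemma bounded_integrable_on d (T : measurableType d) (mu : {measure set T -> \bar R})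
    (B : set T) (f : T -> R) (M : R) : measurable B -> (mu B < +oo)%E ->
  measurable_fun setT f -> (forall x, `|f x| <= M) ->
  (forall x, ~ B x -> f x = 0) -> mu.-integrable setT (EFin \o f).
Proof.
move=> mB fB mf fM f0.
have i1 : mu.-integrable setT (EFin \o (fun x => M * \1_B x)).
  have iB : mu.-integrable setT (EFin \o \1_B).
    apply/integrableP; split; first exact/measurable_EFinP.
    under eq_integral do rewrite /= ger0_norm//.
    by rewrite integral_indic// setIT.
  exact: (integrableZl measurableT M iB).
apply: (le_integrable measurableT _ _ i1); first exact/measurable_EFinP.
move=> x _; rewrite /= lee_fin.
have [Bx|Bx] := pselect (B x); first by rewrite indicE mem_set// mulr1 (le_trans (fM x))// ler_norm.
by rewrite f0// normr0.
Qed.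

(** Outside a closed set containing the support, [f] vanishes near the point. *)
Lemma derive_support (V : normedModType R) (K : set V) (f : V -> R) (v : V) :
  closed K -> (forall x, ~ K x -> f x = 0) -> forall x, ~ K x -> 'D_v f x = 0.
Proof.
move=> cK f0 x nKx; rewrite (@near_eq_derive _ _ _ f (cst 0)) ?derive_cst//.
have oK := closed_openC cK.
by have := open_nbhs_nbhs (conj oK nKx); apply: filterS => y; exact: f0.
Qed.

(** By the fundamental theorem of calculus on an interval slightly larger than
    the support, at whose end points [F] vanishes. *)
Lemma integral_derive_compact (F f : R -> R) (M : R) : 0 <= M -> continuous f ->
  (forall t : R, is_derive t (1 : R) F (f t)) -> (forall t, M < `|t| -> F t = 0) ->
  (\int[lebesgue_measure]_t (f t)%:E = 0)%E.
Proof.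
move=> M0 cf dF F0; pose L := M + 1.
have LM : - L < L by rewrite /L; lra.
have f0 t : ~ [set t | `|t| <= M] t -> f t = 0.
  have cK : closed [set t : R | `|t| <= M].
    rewrite (_ : [set _ | _] = `[- M, M]%classic); first exact: interval_closed.
    by apply/seteqP; split => x /=; rewrite in_itv/= ler_norml.
  move=> nt; rewrite -(@derive_val _ _ _ _ _ _ _ (dF t)); apply: derive_support nt => //.
  by move=> x /= /negP; rewrite -ltNge; exact: F0.
have E : (\int[lebesgue_measure]_t (f t)%:E = \int[lebesgue_measure]_(t in `[(- L)%R, L]) (f t)%:E)%E.
  rewrite [RHS]integral_mkcond; apply: eq_integral => t _; rewrite patchE.
  case: ifPn => // /negP tL; rewrite f0// => /= tM; apply: tL; rewrite inE/= in_itv/=.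
  by move: tM; rewrite ler_norml /L => /andP[? ?]; apply/andP; split; lra.
have dFt (t : R) : derivable F t (1 : R) by exact: ex_derive.
have cF : continuous F.
  by move=> t; apply: differentiable_continuous; apply/derivable1_diffP.
rewrite E (@continuous_FTC2 _ f F)//.
- rewrite !F0 ?subee//; rewrite /L ?normrN ger0_norm; lra.
- exact: continuous_subspaceT.
- by split => [t _ //| |]; [apply: cvg_at_right_filter|apply: cvg_at_left_filter]; exact: cF.
- by move=> t _; rewrite derive1E derive_val.
Qed.

End Borel.

Section Plane.
Context {R : realType}.

(** [leb3] is the product of [leb2] and the Lebesgue measure; Fubini needs
    [leb2] as a sigma-finite measure. *)
Definition leb2 : set (measurableTypeR R * measurableTypeR R) -> \bar R :=
  (@lebesgue_measure R \x @lebesgue_measure R)%E.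

HB.instance Definition _ := Measure.on leb2.

Let leb2_sigma_finite : sigma_finite setT leb2.
Proof.
have /sigma_finiteP[F [TF ndF Foo]] := sigma_finiteT (@lebesgue_measure R).
exists (fun n => F n `*` F n).
  rewrite -setXTT TF predeqE => -[x y]; split.
    move=> [/= [n _ Fnx] [k _ Fky]]; exists (maxn n k) => //; split.
    - by move: x Fnx; exact/subsetPset/ndF/leq_maxl.
    - by move: y Fky; exact/subsetPset/ndF/leq_maxr.
  by move=> [n _ []/= ? ?]; split; exists n.
move=> k; have [mF Fk] := Foo k; split; first exact: measurableX.
by rewrite /leb2 product_measure1E// lte_mul_pinfty// ge0_fin_numE.
Qed.

HB.instance Definition _ :=
  Measure_isSigmaFinite.Build _ _ _ leb2 leb2_sigma_finite.

Definition interval_box (M : R) : set (measurableTypeR R) := `[- M, M]%classic.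
Definition box2 M := interval_box M `*` interval_box M.
Definition box3 M : set (pt R) := box2 M `*` interval_box M.

Lemma measurable_interval_box M : measurable (interval_box M).
Proof. exact: measurable_itv. Qed.

Lemma measurable_box2 M : measurable (box2 M).
Proof. by apply: measurableX; exact: measurable_interval_box. Qed.

Lemma measurable_box3 M : measurable (box3 M).
Proof. by apply: measurableX; [exact: measurable_box2|exact: measurable_interval_box]. Qed.

Lemma interval_box_fin M : (lebesgue_measure (interval_box M) < +oo)%E.
Proof. by rewrite /interval_box lebesgue_measure_itv/=; case: ifP => _; rewrite ltry. Qed.

Lemma box2_fin M : (leb2 (box2 M) < +oo)%E.
Proof.
have m := measurable_interval_box M; have f := interval_box_fin M.
by rewrite /leb2 product_measure1E// lte_mul_pinfty// ge0_fin_numE.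
Qed.

Lemma box3_fin M : (leb3 (box3 M) < +oo)%E.
Proof.
have m := measurable_interval_box M; have f := interval_box_fin M.
have m2 := measurable_box2 M.
rewrite /leb3 [X in (X < _)%E](_ : _ = leb2 (box2 M) * lebesgue_measure (interval_box M))%E.
  by rewrite lte_mul_pinfty// ge0_fin_numE ?box2_fin.
exact: product_measure1E.
Qed.

(** Fubini, in either order of integration. *)
Lemma integral_leb3_slices0 (f : pt R -> R) : leb3.-integrable setT (EFin \o f) ->
  ((forall z, \int[lebesgue_measure]_y (f (z, y))%:E = 0) ->
     \int[leb3]_x (f x)%:E = 0)%E /\
  ((forall y, \int[leb2]_z (f (z, y))%:E = 0) -> \int[leb3]_x (f x)%:E = 0)%E.
Proof.
move=> h; split => H.
  rewrite -[LHS](@integral12_prod_meas1 _ _ _ _ R leb2 (@lebesgue_measure R) (EFin \o f) h).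
  by apply: integral0_eq => x _; exact: H.
rewrite -[LHS](@integral21_prod_meas1 _ _ _ _ R leb2 (@lebesgue_measure R) (EFin \o f) h).
by apply: integral0_eq => x _; exact: H.
Qed.

Lemma integral_leb2_slices0 (f : measurableTypeR R * measurableTypeR R -> R) :
  leb2.-integrable setT (EFin \o f) ->
  ((forall z, \int[lebesgue_measure]_y (f (z, y))%:E = 0) ->
     \int[leb2]_x (f x)%:E = 0)%E /\
  ((forall y, \int[lebesgue_measure]_z (f (z, y))%:E = 0) -> \int[leb2]_x (f x)%:E = 0)%E.
Proof.
move=> h; split => H.
  rewrite -[LHS](@integral12_prod_meas1 _ _ _ _ R (@lebesgue_measure R) (@lebesgue_measure R) (EFin \o f) h).
  by apply: integral0_eq => x _; exact: H.
rewrite -[LHS](@integral21_prod_meas1 _ _ _ _ R (@lebesgue_measure R) (@lebesgue_measure R) (EFin \o f) h).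
by apply: integral0_eq => x _; exact: H.
Qed.

(** The difference quotients along the line [c] are those of [chi] in the
    direction [v]. *)
Lemma is_derive_line (V : normedModType R) (chi : V -> R) (v : V) (c : R -> V) :
  (forall h t, c (h + t) = h *: v + c t) -> (forall x, derivable chi x v) ->
  forall t : R, is_derive t (1 : R) (chi \o c) ('D_v chi (c t)).
Proof.
move=> cE dchi t.
have E : (fun h : R => h^-1 *: (((chi \o c) \o shift t) (h *: (1 : R)) - (chi \o c) t)) =
   (fun h : R => h^-1 *: ((chi \o shift (c t)) (h *: v) - chi (c t))).
  by apply/funext => h; rewrite /= -cE /GRing.scale/= mulr1.
by apply: DeriveDef; [rewrite /derivable E; exact: dchi|rewrite /derive E].
Qed.

Lemma integral_line (V : normedModType R) (chi : V -> R) (v : V) (c : R -> V) (M : R) :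
  0 <= M -> (forall t, c t = t *: v + c 0) -> (forall x, derivable chi x v) ->
  continuous ('D_v chi) -> (forall t, M < `|t| -> chi (c t) = 0) ->
  (\int[lebesgue_measure]_t ('D_v chi (c t))%:E = 0)%E.
Proof.
move=> M0 cE dchi cd c0; apply: (integral_derive_compact (F := chi \o c) M0) => //.
- move=> t; apply: (@continuous_comp _ _ _ c ('D_v chi)); last exact: cd.
  rewrite (_ : c = (fun t => t *: v + c 0)); last exact/funext.
  by apply: cvgD; [exact: scalel_continuous|exact: cvg_cst].
- by apply: is_derive_line => // h t; rewrite cE [in RHS]cE scalerDl addrA.
Qed.

(** Integrating first along the lines parallel to the [i]-th axis, every inner
    integral is that of the derivative of a compactly supported function of
    one variable. Which order of integration puts that axis innermost depends
    on [i], hence the three cases at the end. *)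
Lemma integral_pderiv_compact (chi : pt R -> R) (i : 'I_3) (K : set (pt R)) :
  compact K -> (forall x, ~ K x -> chi x = 0) ->
  (forall x, derivable chi x (bvec i)) -> continuous (pderiv i chi) ->
  leb3.-integrable setT (EFin \o pderiv i chi) /\
  (\int[leb3]_x (pderiv i chi x)%:E = 0)%E.
Proof.
move=> cK chi0 dchi cd.
have clK : closed K by apply: compact_closed => //; exact: norm_hausdorff.
have d0 : forall x, ~ K x -> pderiv i chi x = 0 by exact: derive_support.
have [M M0 KM] : exists2 M : R, 0 <= M & forall x, K x -> `|x| <= M.
  have [M [_ hM]] := compact_bounded cK; exists (`|M| + 1); first by rewrite addr_ge0.
  by apply: hM; rewrite (le_lt_trans (ler_norm _))// ltrDl.
have KN (x : pt R) : K x -> [/\ `|x.1.1| <= M, `|x.1.2| <= M & `|x.2| <= M].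
  move=> /KM; rewrite !prod_normE /=.
  by rewrite !ge_max => /andP[/andP[]].
have [N KN'] : exists N, forall x, `|pderiv i chi x| <= N.
  have := continuous_compact (continuous_subspaceT cd) cK.
  move=> /compact_bounded[N [_ hN]]; exists (`|N| + 1) => x.
  have [Kx|nKx] := pselect (K x); last by rewrite d0// normr0 addr_ge0.
  by apply: hN; [rewrite (le_lt_trans (ler_norm _))// ltrDl|exists x].
have out (x : pt R) : M < `|x.1.1| \/ M < `|x.1.2| \/ M < `|x.2| -> ~ K x.
  move=> h /KN[h1 h2 h3]; move: h; rewrite !ltNge h1 h2 h3.
  by case=> [|[]].
have mB := @measurable_box3 M.
have I3 : leb3.-integrable setT (EFin \o pderiv i chi).
  apply: (bounded_integrable_on (B := box3 M) (M := N)) => //.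
  - exact: box3_fin.
  - exact: continuous_measurable_pt.
  - move=> x nB; apply: d0 => /KN[h1 h2 h3]; apply: nB.
    by rewrite /box3/box2/interval_box; split; [split|]; rewrite /= in_itv/= -ler_norml.
split => //.
have I2 (y : measurableTypeR R) : leb2.-integrable setT (EFin \o (fun z => pderiv i chi (z, y))).
  apply: (bounded_integrable_on (B := box2 M) (M := N)) => //.
  - exact: measurable_box2.
  - exact: box2_fin.
  - by apply: measurableT_comp; [exact: continuous_measurable_pt|exact: measurable_pair2].
  - move=> z nB; apply: d0 => /KN[h1 h2 h3]; apply: nB.
    by split; rewrite /interval_box /= in_itv/= -ler_norml.
have i3 (k : nat) : val i = k -> bvec i = ((k == 0%N)%:R, (k == 1%N)%:R, (k == 2%N)%:R) :> pt R.
  by rewrite /bvec => ->.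
have line (c : R -> pt R) (k : nat) : val i = k ->
    (forall t, c t = t *: (((k == 0%N)%:R, (k == 1%N)%:R, (k == 2%N)%:R) : pt R) + c 0) ->
    (forall t, M < `|t| -> ~ K (c t)) ->
    (\int[lebesgue_measure]_t (pderiv i chi (c t))%:E = 0)%E.
  move=> ik cE cK'; apply: (@integral_line _ chi (bvec i) c M) => //.
    by move=> t; rewrite (i3 _ ik).
  by move=> t /cK'; exact: chi0.
(* affine coordinates of the line: constant ones have slope 0, the i-th has slope 1 *)
have hz (a t : R) : a = t * 0 + a by rewrite mulr0 add0r.
have ho (t : R) : t = t * 1 + 0 by rewrite mulr1 addr0.
case: (ltnP (val i) 2) => [i2|i2]; last first.
  have ik : val i = 2 by apply/eqP; rewrite eqn_leq -ltnS ltn_ord.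
  apply: (integral_leb3_slices0 I3).1 => z; apply: (line (fun t => (z, t)) 2%N ik).
    move=> t /=; case: z => z1 z2; congr (_, _, _);
      [exact: (hz z1 t)|exact: (hz z2 t)|exact: (ho t)].
  by move=> t tM; apply: out; right; right.
apply: (integral_leb3_slices0 I3).2 => y; case: (posnP (val i)) => [ik|i1].
  apply: (integral_leb2_slices0 (I2 y)).2 => z; apply: (line (fun t => (t, z, y)) 0%N ik).
    move=> t /=; congr (_, _, _);
      [exact: (ho t)|exact: (hz z t)|exact: (hz y t)].
  by move=> t tM; apply: out; left.
have ik : val i = 1 by apply/eqP; rewrite eqn_leq -ltnS i2.
apply: (integral_leb2_slices0 (I2 y)).1 => z; apply: (line (fun t => (z, t, y)) 1%N ik).
  move=> t /=; congr (_, _, _);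
    [exact: (hz z t)|exact: (ho t)|exact: (hz y t)].
by move=> t tM; apply: out; right; left.
Qed.

End Plane.

(** * Euclidean norms of finite families *)

Section EuclideanSums.
Context {R : realType} {I : finType}.
Implicit Types a b : I -> R.

(** With [A], [B], [C] the sums of [a^2], [b^2] and [a b], the sum of the
    squares of [B a - C b] is [B (A B - C^2)]. *)
Lemma sum_cauchy_schwarz a b :
  `|\sum_i a i * b i| <= Num.sqrt (\sum_i a i ^+ 2) * Num.sqrt (\sum_i b i ^+ 2).
Proof.
set C := \sum_i a i * b i; set A := \sum_i a i ^+ 2; set B := \sum_i b i ^+ 2.
have A0 : 0 <= A by apply: sumr_ge0 => i _; exact: sqr_ge0.
have B0 : 0 <= B by apply: sumr_ge0 => i _; exact: sqr_ge0.
have h : 0 <= B * (A * B - C ^+ 2).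
  rewrite (_ : _ * _ = \sum_i (B * a i - C * b i) ^+ 2).
    by apply: sumr_ge0 => i _; exact: sqr_ge0.
  rewrite [RHS](eq_bigr (fun i => B ^+ 2 * a i ^+ 2 + (- (2 * B * C)) * (a i * b i)
    + C ^+ 2 * b i ^+ 2)); last by move=> i _; ring.
  by rewrite !big_split/= -!mulr_sumr -/A -/B -/C; ring.
rewrite -sqrtrM// -[leLHS]ger0_norm// -sqrtr_sqr real_normK ?num_real//.
apply: ler_wsqrtr; have [B1|B1] := eqVneq B 0.
  have b0 i : b i = 0.
    have : \sum_i b i ^+ 2 == 0 by rewrite -/B B1.
    rewrite psumr_eq0; last by move=> j _; exact: sqr_ge0.
    by move=> /allP /(_ i (mem_index_enum _)); rewrite sqrf_eq0 => /eqP.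
  by rewrite /C big1 ?expr0n/= ?mulr_ge0// => i _; rewrite b0 mulr0.
have Bp : 0 < B by rewrite lt_neqAle eq_sym B1.
by move: h; rewrite pmulr_rge0// subr_ge0.
Qed.

Lemma sqrt_sumD a b : Num.sqrt (\sum_i (a i + b i) ^+ 2) <=
  Num.sqrt (\sum_i a i ^+ 2) + Num.sqrt (\sum_i b i ^+ 2).
Proof.
have s0 c : 0 <= \sum_i c i ^+ 2 :> R by apply: sumr_ge0 => i _; exact: sqr_ge0.
rewrite -[leRHS]ger0_norm ?addr_ge0 ?sqrtr_ge0// -sqrtr_sqr; apply: ler_wsqrtr.
rewrite sqrrD !sqr_sqrtr//.
under eq_bigr do rewrite sqrrD.
rewrite !big_split/= lerD2r lerD2l -mulr2n.
rewrite ler_wMn2r//; exact: (le_trans (ler_norm _) (sum_cauchy_schwarz a b)).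
Qed.

Lemma sqrt_sumZ (c : R) a :
  Num.sqrt (\sum_i (c * a i) ^+ 2) = `|c| * Num.sqrt (\sum_i a i ^+ 2).
Proof.
under eq_bigr do rewrite exprMn.
by rewrite -mulr_sumr sqrtrM ?sqr_ge0// sqrtr_sqr.
Qed.

Lemma ler_sqrt_sum a i : `|a i| <= Num.sqrt (\sum_i a i ^+ 2).
Proof.
rewrite -sqrtr_sqr; apply: ler_wsqrtr; rewrite (bigD1 i)//= lerDl.
by apply: sumr_ge0 => j _; exact: sqr_ge0.
Qed.

Lemma sqrt_sum_le a : Num.sqrt (\sum_i a i ^+ 2) <= \sum_i `|a i|.
Proof.
have s0 : 0 <= \sum_i `|a i| by apply: sumr_ge0.
rewrite -[leRHS]ger0_norm// -sqrtr_sqr; apply: ler_wsqrtr.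
rewrite expr2 mulr_suml; apply: ler_sum => i _.
rewrite -real_normK ?num_real// expr2 ler_wpM2l// (bigD1 i)//= lerDl.
by apply: sumr_ge0.
Qed.

End EuclideanSums.

Section MoreLp.
Context {R : realType} (Om : set (pt R)) (mOm : measurable Om).
Implicit Types (a b q : pt R -> R) (p : R).

(** Minkowski on the whole space, for the extensions by zero. *)
Lemma LpD p a b : 1 <= p -> Lp Om p a -> Lp Om p b ->
  Lp Om p (fun x => a x + b x) /\
  pnorm Om p (fun x => a x + b x) <= pnorm Om p a + pnorm Om p b.
Proof.
move=> p1 la lb.
have E : (Lp_norm Om p (fun x => a x + b x)%R <= Lp_norm Om p a + Lp_norm Om p b)%E.
  have := minkowski_EFin leb3 (measurable_restr mOm la.1) (measurable_restr mOm lb.1) p1.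
  apply: le_trans; rewrite /Lp_norm le_eqVlt; apply/orP; left; apply/eqP.
  apply: eq_Lnorm => x /=.
  by rewrite !patchE; case: ifP => //= _; rewrite addr0.
have L : Lp Om p (fun x => a x + b x).
  split; first by apply: measurable_funD; [case: la|case: lb].
  by apply: (le_lt_trans E); rewrite -(Lp_fin la) -(Lp_fin lb) -EFinD ltry.
by split => //; rewrite -lee_fin EFinD !Lp_fin.
Qed.

Lemma Lp_cst0 p : 0 < p -> Lp Om p (cst 0).
Proof.
move=> p0; apply: integrable_on_Lp => //.
under eq_fun do rewrite /= normr0 powR0 ?gt_eqF//.
exact: integrable0.
Qed.

Lemma measurable_sqrt : measurable_fun setT (@Num.sqrt R).
Proof. by apply: continuous_measurable_fun; exact: sqrt_continuous. Qed.

Lemma measurable_euclid (I : finType) (a : I -> pt R -> R) :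
  (forall i, measurable_fun Om (a i)) ->
  measurable_fun Om (fun x => Num.sqrt (\sum_i a i x ^+ 2)).
Proof.
move=> ma; apply: (measurableT_comp measurable_sqrt).
apply: measurable_sum => i; exact: measurable_funX.
Qed.

(** The Euclidean norm is dominated by the sum of the absolute values. *)
Lemma Lp_euclid p (I : finType) (a : I -> pt R -> R) : 1 <= p ->
  (forall i, Lp Om p (a i)) -> Lp Om p (fun x => Num.sqrt (\sum_i a i x ^+ 2)).
Proof.
move=> p1 la; have p0 : 0 < p by exact: lt_le_trans p1.
have ls (r : seq I) : Lp Om p (fun x => \sum_(i <- r) `|a i x|).
  elim: r => [|i r IH].
    by under [X in Lp _ _ X]eq_fun do rewrite big_nil; exact: Lp_cst0.
  under [X in Lp _ _ X]eq_fun do rewrite big_cons.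
  apply: (LpD p1 _ IH).1; apply: (pnorm_mono mOm p0 _ (la i) _).1.
    by apply: measurableT_comp => //; case: (la i).
  by move=> x _; rewrite normr_id.
apply: (pnorm_mono mOm p0 _ (ls (index_enum I)) _).1.
  by apply: measurable_euclid => i; case: (la i).
move=> x _; rewrite !ger0_norm ?sqrtr_ge0 ?sumr_ge0//; exact: sqrt_sum_le.
Qed.

End MoreLp.

(** * Test functions *)

Section SmoothFunctions.
Context {R : realType}.
Implicit Types (phi psi : pt R -> R) (Om : set (pt R)).

(** Smoothness speaks of all iterated partial derivatives; it is the largest
    class of continuous, partially derivable functions that is stable under
    partial derivatives, which is how it is established below. *)
Lemma smooth_coind (P : (pt R -> R) -> Prop) :
  (forall phi, P phi -> [/\ continuous phi, forall x i, derivable phi x (bvec i)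
     & forall i, P (pderiv i phi)]) ->
  forall phi, P phi -> smooth phi.
Proof.
move=> HP phi Pphi l.
suff Pl : P (foldr pderiv phi l) by case: (HP _ Pl).
by elim: l => [|i l IH] //=; case: (HP _ IH).
Qed.

Lemma smooth_inv phi : smooth phi -> [/\ continuous phi,
  forall x i, derivable phi x (bvec i) & forall i, smooth (pderiv i phi)].
Proof.
move=> sphi; split; [exact: (sphi [::]).1|exact: (sphi [::]).2|].
by move=> i l; have := sphi (rcons l i); rewrite foldr_rcons.
Qed.

Lemma pderiv_lin (c : R) phi psi i :
  (forall x, derivable phi x (bvec i)) -> (forall x, derivable psi x (bvec i)) ->
  pderiv i (fun x => c * phi x + psi x) = (fun x => c * pderiv i phi x + pderiv i psi x).
Proof.
move=> d1 d2; apply/funext => x; rewrite /pderiv.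
have d3 : derivable (c \*: phi) x (bvec i) by exact: derivableZ.
by have := deriveD d3 (d2 x); rewrite (deriveZ c (d1 x)).
Qed.

Lemma derivable_lin (c : R) phi psi x (v : pt R) : derivable phi x v -> derivable psi x v ->
  derivable (fun x => c * phi x + psi x) x v.
Proof.
move=> d1 d2; have d3 : derivable (c \*: phi) x v by exact: derivableZ.
exact: (derivableD d3 d2).
Qed.

Lemma smooth_lin (c : R) phi psi : smooth phi -> smooth psi ->
  smooth (fun x => c * phi x + psi x).
Proof.
move=> s1 s2.
pose P f := exists phi psi, [/\ smooth phi, smooth psi & f = (fun x => c * phi x + psi x)].
apply: (smooth_coind (P := P)); last by exists phi, psi.
move=> _ [a [b [/smooth_inv[ca da sa] /smooth_inv[cb db sb] ->]]]; split.
- by move=> x; apply: cvgD; [apply: cvgM; [exact: cvg_cst|exact: ca]|exact: cb].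
- by move=> x i; exact: derivable_lin.
- move=> i; exists (pderiv i a), (pderiv i b).
  by split; [exact: sa|exact: sb|exact: (pderiv_lin _ (da ^~ i) (db ^~ i))].
Qed.

Lemma smooth0 : smooth (fun _ : pt R => 0 : R).
Proof.
apply: (smooth_coind (P := fun f => f = fun=> 0)) => // _ ->; split.
- exact: cst_continuous.
- by move=> x i; exact: derivable_cst.
- by move=> i; apply/funext => x; exact: derive_cst.
Qed.

Lemma pderivM phi psi i :
  (forall x, derivable phi x (bvec i)) -> (forall x, derivable psi x (bvec i)) ->
  pderiv i (fun x => phi x * psi x) =
  (fun x => phi x * pderiv i psi x + psi x * pderiv i phi x).
Proof. by move=> d1 d2; apply/funext => x; have := deriveM (d1 x) (d2 x); exact. Qed.

(** Products of smooth functions are not stable under derivation, by the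
    Leibniz rule; their finite sums are. *)
Inductive product_sum : (pt R -> R) -> Prop :=
| ProductSum0 a b : smooth a -> smooth b -> product_sum (fun x => a x * b x)
| ProductSumD f g : product_sum f -> product_sum g -> product_sum (fun x => f x + g x).

Lemma smoothM phi psi : smooth phi -> smooth psi -> smooth (fun x => phi x * psi x).
Proof.
move=> s1 s2; apply: (smooth_coind (P := product_sum)); last exact: ProductSum0.
move=> h; elim=> {h} [a b sa sb|f g _ [cf df pf] _ [cg dg pg]].
  have [ca da ha] := smooth_inv sa; have [cb db hb] := smooth_inv sb; split.
  - by move=> x; apply: cvgM; [exact: ca|exact: cb].
  - by move=> x i; have := derivableM (da x i) (db x i); exact.
  - move=> i; rewrite (pderivM (da ^~ i) (db ^~ i)).
    exact: (ProductSumD (ProductSum0 sa (hb i)) (ProductSum0 sb (ha i))).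
split.
- by move=> x; apply: cvgD; [exact: cf|exact: cg].
- by move=> x i; exact: (derivableD (df x i) (dg x i)).
- move=> i; rewrite (_ : pderiv i _ = (fun x => pderiv i f x + pderiv i g x)).
    exact: ProductSumD.
  by apply/funext => x; exact: (deriveD (df x i) (dg x i)).
Qed.

Lemma test0 Om : test_function Om (fun=> 0).
Proof. by split; [exact: smooth0|exists set0; split => //; exact: compact0]. Qed.

Lemma test_lin Om (c : R) phi psi : test_function Om phi -> test_function Om psi ->
  test_function Om (fun x => c * phi x + psi x).
Proof.
move=> [s1 [K1 [c1 h1 z1]]] [s2 [K2 [c2 h2 z2]]]; split; first exact: smooth_lin.
exists (K1 `|` K2); split; first exact: compactU.
  by move=> x [/h1|/h2].
by move=> x /not_orP[n1 n2]; rewrite z1// z2// mulr0 addr0.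
Qed.

Lemma testM Om phi psi : test_function Om phi -> test_function Om psi ->
  test_function Om (fun x => phi x * psi x).
Proof.
move=> [s1 [K1 [c1 h1 z1]]] [s2 _]; split; first exact: smoothM.
by exists K1; split => // x /z1 ->; rewrite mul0r.
Qed.

Lemma test_pderiv Om phi i : test_function Om phi -> test_function Om (pderiv i phi).
Proof.
move=> [/smooth_inv[_ _ sphi] [K [cK KO z]]]; split; first exact: sphi.
exists K; split => //; apply: derive_support => //.
by apply: compact_closed => //; exact: norm_hausdorff.
Qed.

Lemma jet_lin (c : R) phi psi : smooth phi -> smooth psi ->
  jet (fun x => c * phi x + psi x) = c *: jet phi + jet psi.
Proof.
move=> /smooth_inv[_ d1 _] /smooth_inv[_ d2 _]; rewrite /jet.
congr (_, _); apply/funext => i; apply/funext => x.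
by rewrite pderiv_lin.
Qed.

Lemma test_bounded Om phi : test_function Om phi -> exists M, forall x, `|phi x| <= M.
Proof.
move=> [/smooth_inv[cphi _ _] [K [cK _ z]]].
have := continuous_compact (continuous_subspaceT cphi) cK.
move=> /compact_bounded[N [_ hN]]; exists (`|N| + 1) => x.
have [Kx|nKx] := pselect (K x); last by rewrite z// normr0 addr_ge0.
by apply: hN; [rewrite (le_lt_trans (ler_norm _))// ltrDl|exists x].
Qed.

Lemma test_measurable Om phi (D : set (pt R)) : test_function Om phi -> measurable_fun D phi.
Proof. by move=> [/smooth_inv[cphi _ _] _]; exact: continuous_measurable_pt. Qed.

Lemma Int_pderiv Om phi i : test_function Om phi -> Int Om (pderiv i phi) = 0.
Proof.
move=> tphi; have [_ [K' [_ K'O z']]] := test_pderiv i tphi.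
move: tphi => [/smooth_inv[_ d /(_ i)/smooth_inv[c _ _]] [K [cK KO z]]].
have [_ I0] := integral_pderiv_compact cK z (d ^~ i) c.
rewrite /Rintegral integral_mkcond.
rewrite (eq_integral (fun x => (pderiv i phi x)%:E)) ?I0//.
move=> x _; rewrite patchE; case: ifPn => // /negP h.
by rewrite z'// => /K'O xO; apply: h; rewrite inE.
Qed.

End SmoothFunctions.

(** * The space H^1_0 *)

(** A bounded set lies in a cube. *)
Lemma leb3_fin (R : realType) (Om : set (pt R)) : measurable Om ->
  (exists M, forall x, Om x -> enorm x <= M) -> (leb3 Om < +oo)%E.
Proof.
move=> mO [M hM]; apply: (le_lt_trans _ (box3_fin M)).
apply: le_measure; rewrite ?inE//; first exact: measurable_box3.
move=> x /hM xM.
have c i : `|crd i x| <= M.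
  apply: le_trans xM; rewrite /enorm /dot.
  under eq_bigr do rewrite -expr2.
  exact: (ler_sqrt_sum (fun i => crd i x)).
have c0 : `|x.1.1| <= M := c (@Ordinal 3 0 isT).
have c1 : `|x.1.2| <= M := c (@Ordinal 3 1 isT).
have c2 : `|x.2| <= M := c (@Ordinal 3 2 isT).
by rewrite /box3 /box2 /interval_box; split; [split|]; rewrite /= in_itv/= -ler_norml.
Qed.

Section Sobolev.
Context {R : realType} (Om : set (pt R)) (mOm : measurable Om)
  (fOm : (leb3 Om < +oo)%E).
Implicit Types (v w : sobf R) (phi psi : pt R -> R).

Lemma integrable_on_cst (c : R) : integrable_on Om (cst c).
Proof.
apply/integrableP; split; first exact/measurable_EFinP.
by rewrite [ltLHS](integral_cst _ mOm `|c|%:E) lte_mul_pinfty.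
Qed.

Lemma bounded_Lp (p M : R) phi : 0 < p -> measurable_fun Om phi ->
  (forall x, Om x -> `|phi x| <= M) -> Lp Om p phi.
Proof.
move=> p0 mphi hM; apply: integrable_on_Lp => //.
apply: (integrable_on_dom mOm _ (integrable_on_cst (M `^ p))).
  by apply: (measurableT_comp (measurable_powR _)); exact: measurableT_comp.
move=> x xO; rewrite ger0_norm ?powR_ge0//= ge0_ler_powR ?nnegrE ?hM//; first exact: ltW.
exact: (le_trans (normr_ge0 _) (hM x xO)).
Qed.

Lemma test_Lp (p : R) phi : 0 < p -> test_function Om phi -> Lp Om p phi.
Proof.
move=> p0 tphi; have [M hM] := test_bounded tphi.
by apply: (@bounded_Lp p M) => //; exact: test_measurable tphi.
Qed.

Lemma test_integrable_on phi : test_function Om phi -> integrable_on Om phi.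
Proof.
move=> tphi; have [M hM] := test_bounded tphi.
apply: (integrable_on_dom mOm _ (integrable_on_cst M)) => //.
exact: test_measurable tphi.
Qed.

(** Membership in H^1 without the relation between the two components, so
    that it holds for a function before its gradient is identified. *)
Definition L2jet v : Prop := Lp Om 2 (fn v) /\ forall i, Lp Om 2 (gr v i).

Lemma L2_lin (c : R) phi psi : Lp Om 2 phi -> Lp Om 2 psi ->
  Lp Om 2 (fun x => c * phi x + psi x) /\
  pnorm Om 2 (fun x => c * phi x + psi x) <= `|c| * pnorm Om 2 phi + pnorm Om 2 psi.
Proof.
move=> l1 l2; have p0 : 0 < 2 :> R by [].
have [l3 e3] := pnormZ mOm c p0 l1.
have p1 : 1 <= 2 :> R by rewrite ler1n.
by have [l4 e4] := LpD mOm p1 l3 l2; rewrite e3 in e4.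
Qed.

Lemma L2jet_lin (c : R) v w : L2jet v -> L2jet w -> L2jet (c *: v + w).
Proof.
move=> [v0 v1] [w0 w1]; split; first exact: (L2_lin c v0 w0).1.
by move=> i; exact: (L2_lin c (v1 i) (w1 i)).1.
Qed.

Lemma L2jet_gabs v : L2jet v -> Lp Om 2 (gabs v).
Proof. by move=> [_ h]; apply: Lp_euclid => //; rewrite ler1n. Qed.

(** The norm in which H^1_0 is the closure of the test functions. *)
Definition hnorm v : R := pnorm Om 2 (fn v) + pnorm Om 2 (gabs v).

Lemma gabs_lin (c : R) v w x : gabs (c *: v + w) x <= `|c| * gabs v x + gabs w x.
Proof.
rewrite /gabs -sqrt_sumZ; exact: (sqrt_sumD (fun j => c * gr v j x) (fun j => gr w j x)).
Qed.

Lemma gabs_ge0 v x : 0 <= gabs v x.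
Proof. exact: sqrtr_ge0. Qed.

Lemma gnorm_lin (c : R) v w : L2jet v -> L2jet w ->
  pnorm Om 2 (gabs (c *: v + w)) <= `|c| * pnorm Om 2 (gabs v) + pnorm Om 2 (gabs w).
Proof.
move=> hv hw; have p0 : 0 < 2 :> R by [].
have [l e] := L2_lin `|c| (L2jet_gabs hv) (L2jet_gabs hw).
rewrite normr_id in e; apply: le_trans e.
apply: (pnorm_mono mOm p0 _ l _).2; first by case: (L2jet_gabs (L2jet_lin c hv hw)).
move=> x _; rewrite ger0_norm ?gabs_ge0//.
rewrite ger0_norm ?addr_ge0 ?mulr_ge0 ?gabs_ge0//; exact: gabs_lin.
Qed.

Lemma hnorm_lin (c : R) v w : L2jet v -> L2jet w ->
  hnorm (c *: v + w) <= `|c| * hnorm v + hnorm w.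
Proof.
move=> hv hw; have := gnorm_lin c hv hw; have := (L2_lin c hv.1 hw.1).2.
rewrite /hnorm -[pnorm _ _ (fn (_ + _))]/(pnorm Om 2 (fun x => c * fn v x + fn w x)); lra.
Qed.

Lemma jet_L2jet phi : test_function Om phi -> L2jet (jet phi).
Proof. by move=> tphi; split=> [|i]; apply: test_Lp => //; exact: test_pderiv. Qed.

(** The norms in the definition of H^1_0 are extended reals; on
    square-integrable components they are finite, and density can be used with
    real numbers. *)
Lemma H10P v : H10 Om v <-> [/\ L2jet v, weak_gradient Om v &
  forall eps : R, 0 < eps -> exists2 phi, test_function Om phi & hnorm (v - jet phi) < eps].
Proof.
have E phi : L2jet v -> test_function Om phi -> ((Lp_norm Om 2 (fn (v - jet phi)%R)
    + Lp_norm Om 2 (gabs (v - jet phi)%R)) = (hnorm (v - jet phi))%:E)%E.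
  move=> hv tphi; have h : L2jet (v - jet phi).
    by rewrite addrC -scaleN1r; apply: L2jet_lin => //; exact: jet_L2jet.
  by rewrite EFinD !Lp_fin//; [exact: L2jet_gabs|case: h].
split => [[[v1 v2 v3] v4]|[v1 v2 v3]].
  split => // eps e0; have [phi tphi h] := v4 _ e0; exists phi => //.
  by rewrite -lte_fin -E.
case: (v1) => v1a v1b; split; first by [].
by move=> eps e0; have [phi tphi h] := v3 _ e0; exists phi => //; rewrite E// lte_fin.
Qed.

Lemma hnorm0 : hnorm 0 = 0.
Proof.
have z : L2jet 0 by split=> [|i]; apply: Lp_cst0.
have := hnorm_lin (-1) z z; rewrite scaler0 addr0 normrN1 mul1r => h.
have h0 : 0 <= hnorm 0 by rewrite addr_ge0// pnorm_ge0.
have n0 : pnorm Om 2 (fn 0) = 0.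
  have := pnormZ mOm 0 (ltr0n _ 2) z.1; rewrite normr0 mul0r => -[_ <-].
  by congr fine; congr Lp_norm; apply/funext => x; rewrite mul0r.
have g0 : gabs 0 = cst 0 :> (pt R -> R).
  by apply/funext => x; rewrite /gabs big1 ?sqrtr0// => i _; rewrite expr0n.
by rewrite /hnorm g0 -[cst 0]/(fn 0) n0 addr0.
Qed.

(** Integration by parts between two test functions: the integral of
    a partial derivative of their product vanishes. *)
Lemma H10_jet phi : test_function Om phi -> H10 Om (jet phi).
Proof.
move=> tphi; apply/H10P; split; first exact: jet_L2jet.
  move=> psi tpsi i.
  have t1 := testM tphi (test_pderiv i tpsi); have t2 := testM (test_pderiv i tphi) tpsi.
  have := Int_pderiv i (testM tphi tpsi).
  rewrite pderivM; last 2 first.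
  - by move=> x; case: tphi => /smooth_inv[].
  - by move=> x; case: tpsi => /smooth_inv[].
  under eq_Rintegral do rewrite (mulrC (psi _)).
  rewrite RintegralD//; [|exact: test_integrable_on|exact: test_integrable_on].
  by move/eqP; rewrite addr_eq0 => /eqP.
by move=> eps e0; exists phi => //; rewrite subrr hnorm0.
Qed.

Lemma weak_gradient_lin (c : R) v w : L2jet v -> L2jet w ->
  weak_gradient Om v -> weak_gradient Om w -> weak_gradient Om (c *: v + w).
Proof.
move=> [v0 v1] [w0 w1] gv gw phi tphi i.
have l1 := test_Lp (ltr0n _ 2) (test_pderiv i tphi).
have l2 := test_Lp (ltr0n _ 2) tphi.
have S1 := (cauchy_schwarz mOm v0 l1).1; have S2 := (cauchy_schwarz mOm w0 l1).1.
have S3 := (cauchy_schwarz mOm (v1 i) l2).1; have S4 := (cauchy_schwarz mOm (w1 i) l2).1.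
rewrite (eq_Int (fun x => c * (fn v x * pderiv i phi x) + fn w x * pderiv i phi x)); last first.
  by move=> x; rewrite mulrA -mulrDl.
rewrite RintegralD//; last by apply: integrable_onZ.
rewrite RintegralZl// gv// gw//.
rewrite [in RHS](eq_Int (fun x => c * (gr v i x * phi x) + gr w i x * phi x)); last first.
  by move=> x; rewrite mulrA -mulrDl.
rewrite RintegralD//; last by apply: integrable_onZ.
by rewrite RintegralZl// opprD mulrN.
Qed.

(** Approximations of [v] and [w] combine to one of [c v + w] when that of [v]
    is sharper by a factor exceeding [|c|]. *)
Lemma H10_lin (c : R) v w : H10 Om v -> H10 Om w -> H10 Om (c *: v + w).
Proof.
move=> /H10P[v1 v2 v3] /H10P[w1 w2 w3]; apply/H10P; split.
- exact: L2jet_lin.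
- exact: weak_gradient_lin.
- move=> eps e0; have c1 : 0 < `|c| + 1 by rewrite ltr_wpDl.
  have [|phi tphi h1] := v3 (eps / 2 / (`|c| + 1)); first by rewrite !divr_gt0.
  have [|psi tpsi h2] := w3 (eps / 2); first by rewrite divr_gt0.
  exists (fun x => c * phi x + psi x); first exact: test_lin.
  rewrite jet_lin; [|by case: tphi|by case: tpsi].
  rewrite (_ : _ - _ = c *: (v - jet phi) + (w - jet psi)); last first.
    by rewrite scalerBr opprD addrACA.
  have sub a b : L2jet a -> L2jet b -> L2jet (a - b).
    by move=> ha hb; rewrite addrC -scaleN1r; exact: L2jet_lin.
  have h3 := hnorm_lin c (sub _ _ v1 (jet_L2jet tphi)) (sub _ _ w1 (jet_L2jet tpsi)).
  apply: (le_lt_trans h3).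
  have h4 : `|c| * hnorm (v - jet phi) <= eps / 2.
    have : (`|c| + 1) * hnorm (v - jet phi) <= eps / 2.
      by rewrite mulrC -ler_pdivlMr// ltW.
    apply: le_trans; rewrite ler_wpM2r ?lerDl//.
    by rewrite addr_ge0// pnorm_ge0.
  by rewrite [ltRHS](splitr eps); exact: ler_ltD.
Qed.

Lemma H100 : H10 Om 0.
Proof.
have := H10_lin (-1) (H10_jet (test0 Om)) (H10_jet (test0 Om)).
by rewrite scaleN1r addNr.
Qed.

Lemma H10D v w : H10 Om v -> H10 Om w -> H10 Om (v + w).
Proof. by move=> hv hw; rewrite -[v]scale1r; exact: H10_lin. Qed.

Lemma H10Z (c : R) v : H10 Om v -> H10 Om (c *: v).
Proof. by move=> hv; rewrite -[_ *: _]addr0; apply: H10_lin => //; exact: H100. Qed.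

Lemma H10B v w : H10 Om v -> H10 Om w -> H10 Om (v - w).
Proof. by move=> hv hw; rewrite addrC -scaleN1r; exact: H10_lin. Qed.

End Sobolev.

(** * The power nonlinearity *)

Section PowerNonlinearity.
Context {R : realType}.
Implicit Types (x y r : R).

(** For exponents between 1 and 2, powers are controlled by the square; this
    leads from an arbitrary [s] to L^4 norms. *)
Lemma powR_le_1sqr r x : 0 <= x -> 1 <= r <= 2 -> x `^ r <= 1 + x ^+ 2.
Proof.
move=> x0 /andP[r1 r2]; have r0 : 0 <= r by exact: le_trans r1.
have [x1|x1] := leP x 1.
  have : x `^ r <= 1 `^ r by rewrite ge0_ler_powR ?nnegrE.
  by rewrite powR1 => /le_trans; apply; rewrite lerDl sqr_ge0.
have : x `^ r <= x `^ 2%:R by rewrite ler_powR// ltW.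
by rewrite powR_mulrn// => /le_trans; apply; rewrite lerDr.
Qed.

(** With [t = y / x] in the unit interval and [r <= 2],
    [1 - t^r <= 1 - t^2 <= 2 (1 - t)]. *)
Lemma powR_diff_max r x y : 0 <= y -> y <= x -> 1 <= r <= 2 ->
  (x `^ r - y `^ r) * x <= 2 * (1 + x ^+ 2) * (x - y).
Proof.
move=> y0 yx hr; have x0 : 0 <= x by exact: le_trans yx.
have [xz|xn0] := eqVneq x 0.
  have -> : y = 0 by apply/eqP; rewrite eq_le y0 andbT -xz.
  by rewrite xz mulr0 subrr mulr0.
have xp : 0 < x by rewrite lt_neqAle eq_sym xn0.
pose t := y / x; have yE : y = x * t by rewrite /t mulrC divfK.
have t0 : 0 <= t by rewrite divr_ge0.
have t1 : t <= 1 by rewrite ler_pdivrMr ?mul1r.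
have ht : t ^+ 2 <= t `^ r.
  have [->|tn0] := eqVneq t 0; first by rewrite expr0n/= powR_ge0.
  have tp : 0 < t by rewrite lt_neqAle eq_sym tn0.
  rewrite -powR_mulrn//; apply: ger_powR; rewrite ?tp//.
  by case/andP: hr.
have xr := powR_le_1sqr x0 hr; have xr0 := powR_ge0 x r.
rewrite yE powRM//.
have h1 : x `^ r * (1 - t `^ r) <= (1 + x ^+ 2) * (2 * (1 - t)).
  apply: ler_pM => //; last by nra.
  rewrite subr_ge0; have := @ge0_ler_powR _ r _ t 1; rewrite powR1 ?nnegrE; apply => //.
  by case/andP: hr => r1 _; exact: le_trans r1.
have -> : (x `^ r - x `^ r * t `^ r) * x = x * (x `^ r * (1 - t `^ r)) by ring.
have -> : 2 * (1 + x ^+ 2) * (x - x * t) = x * ((1 + x ^+ 2) * (2 * (1 - t))) by ring.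
by rewrite ler_wpM2l.
Qed.

Lemma powR_diff r x y : 0 <= x -> 0 <= y -> 1 <= r <= 2 ->
  `|x `^ r - y `^ r| * y <= 2 * (1 + x ^+ 2 + y ^+ 2) * `|x - y|.
Proof.
move=> x0 y0 hr; have r0 : 0 <= r by case/andP: hr => r1 _; exact: le_trans r1.
have h (a b : R) : 0 <= b -> b <= a ->
    (a `^ r - b `^ r) * a <= 2 * (1 + a ^+ 2 + b ^+ 2) * (a - b).
  move=> b0 ba; apply: (le_trans (powR_diff_max b0 ba hr)).
  by rewrite ler_wpM2r ?subr_ge0// ler_wpM2l// lerDl sqr_ge0.
have mono (a b : R) : 0 <= b -> b <= a -> b `^ r <= a `^ r.
  by move=> b0 ba; rewrite ge0_ler_powR ?nnegrE// (le_trans b0).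
have [xy|/ltW yx] := leP y x.
  have m : 0 <= x `^ r - y `^ r by rewrite subr_ge0 mono.
  rewrite (ger0_norm m) ger0_norm ?subr_ge0//; apply: le_trans (h _ _ y0 xy).
  by rewrite ler_wpM2l.
have m : 0 <= y `^ r - x `^ r by rewrite subr_ge0 mono.
rewrite distrC (ger0_norm m) (distrC x) ger0_norm ?subr_ge0//.
by have := h _ _ x0 yx; rewrite -addrA (addrC (y ^+ 2)) addrA.
Qed.

Context {I : finType}.
Implicit Types (a b c : I -> R).
Local Notation N a := (Num.sqrt (\sum_i a i ^+ 2)).

Lemma sqrt_sum_sqr a : N a ^+ 2 = \sum_i a i * a i.
Proof.
rewrite sqr_sqrtr; last by apply: sumr_ge0 => i _; exact: sqr_ge0.
by apply: eq_bigr => i _; rewrite expr2.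
Qed.

Lemma sqrt_sum_dist a b : `|N a - N b| <= N (fun i => a i - b i).
Proof.
rewrite ler_norml; apply/andP; split.
  have := sqrt_sumD (fun i => b i - a i) a.
  under eq_bigr do rewrite subrK.
  under [X in _ <= Num.sqrt X + _]eq_bigr do rewrite -sqrrN opprB.
  by rewrite lerNl opprB lerBlDr.
have := sqrt_sumD (fun i => a i - b i) b.
under eq_bigr do rewrite subrK.
by rewrite lerBlDr.
Qed.

(** With [A] and [B] the norms of [a] and [b], the left-hand side is
    [(A^(r+1) - B^(r+1)) (A - B) + (A^r + B^r) (A B - a . b)], a sum of two
    nonnegative terms. *)
Lemma power_monotone r a b : 1 <= r <= 2 ->
  0 <= N a `^ r * (\sum_i a i * (a i - b i)) - N b `^ r * (\sum_i b i * (a i - b i)).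
Proof.
move=> hr; have r0 : 0 <= r by case/andP: hr => r1 _; exact: le_trans r1.
have -> : \sum_i a i * (a i - b i) = N a ^+ 2 - \sum_i a i * b i.
  by rewrite sqrt_sum_sqr -sumrB; apply: eq_bigr => i _; rewrite mulrBr.
have -> : \sum_i b i * (a i - b i) = \sum_i a i * b i - N b ^+ 2.
  by rewrite sqrt_sum_sqr -sumrB; apply: eq_bigr => i _; rewrite mulrBr (mulrC (b i)).
have := le_trans (ler_norm _) (sum_cauchy_schwarz a b).
have : 0 <= N a by exact: sqrtr_ge0.
have : 0 <= N b by exact: sqrtr_ge0.
move: (N a) (N b) (\sum_i a i * b i) => A B C B0 A0 CAB.
have Ar := powR_ge0 A r; have Br := powR_ge0 B r.
have h2 : 0 <= (A `^ r + B `^ r) * (A * B - C) by rewrite mulr_ge0 ?(addr_ge0 Ar Br) ?subr_ge0.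
have h3 : 0 <= (A `^ r * A - B `^ r * B) * (A - B).
  have [AB|AB] := leP A B.
    by rewrite mulr_le0 ?subr_le0// ler_pM// ge0_ler_powR ?nnegrE.
  have := ltW AB => BA.
  by rewrite mulr_ge0 ?subr_ge0// ler_pM// ge0_ler_powR ?nnegrE.
have -> : A `^ r * (A ^+ 2 - C) - B `^ r * (C - B ^+ 2) =
  (A `^ r * A - B `^ r * B) * (A - B) + (A `^ r + B `^ r) * (A * B - C) by ring.
exact: addr_ge0.
Qed.

(** Split [|a|^r a - |b|^r b] as [|a|^r (a - b) + (|a|^r - |b|^r) b]. *)
Lemma power_lipschitz r a b c : 1 <= r <= 2 ->
  `|N a `^ r * (\sum_i a i * c i) - N b `^ r * (\sum_i b i * c i)| <=
  3 * (1 + N a ^+ 2 + N b ^+ 2) * (N (fun i => a i - b i) * N c).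
Proof.
move=> hr; have Na0 : 0 <= N a by exact: sqrtr_ge0.
have Nb0 : 0 <= N b by exact: sqrtr_ge0.
have Nc0 : 0 <= N c by exact: sqrtr_ge0.
have Nd0 : 0 <= N (fun i => a i - b i) by exact: sqrtr_ge0.
have -> : N a `^ r * (\sum_i a i * c i) - N b `^ r * (\sum_i b i * c i) =
  N a `^ r * (\sum_i (a i - b i) * c i) + (N a `^ r - N b `^ r) * (\sum_i b i * c i).
  rewrite (_ : \sum_i (a i - b i) * c i = \sum_i a i * c i - \sum_i b i * c i); first by ring.
  by rewrite -sumrB; apply: eq_bigr => i _; rewrite mulrBl.
apply: (le_trans (ler_normD _ _)); rewrite !normrM (ger0_norm (powR_ge0 _ _)).
have h1 := sum_cauchy_schwarz (fun i => a i - b i) c.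
have h2 := sum_cauchy_schwarz b c.
have h3 := powR_diff Na0 Nb0 hr; have h4 := powR_le_1sqr Na0 hr.
have h5 := sqrt_sum_dist a b.
set D := N (fun i => _) in h1 h5 Nd0 *.
have b1 : N a `^ r * `|\sum_i (a i - b i) * c i| <= (1 + N a ^+ 2 + N b ^+ 2) * (D * N c).
  apply: ler_pM => //.
  by apply: (le_trans h4); rewrite lerDl sqr_ge0.
have b2 : `|N a `^ r - N b `^ r| * `|\sum_i b i * c i| <= 2 * (1 + N a ^+ 2 + N b ^+ 2) * (D * N c).
  apply: (@le_trans _ _ (`|N a `^ r - N b `^ r| * (N b * N c))); first by rewrite ler_wpM2l.
  rewrite !mulrA ler_wpM2r//; apply: (le_trans h3).
  by rewrite ler_wpM2l// mulr_ge0// !addr_ge0// sqr_ge0.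
apply: (le_trans (lerD b1 b2)); rewrite le_eqVlt; apply/orP; left; apply/eqP; ring.
Qed.

End PowerNonlinearity.

(** * Pointwise inequalities, norms and embeddings *)

Section Pointwise.
Context {R : realType}.
Implicit Types (u v w : vsobf R) (T S : sobf R) (x : pt R).

(** Gradients of vector fields become single families indexed by pairs, to
    which the results on Euclidean norms apply. *)
Lemma vgabsE u x :
  vgabs u x = Num.sqrt (\sum_(ij : 'I_3 * 'I_3) gr (u ij.1) ij.2 x ^+ 2).
Proof. by rewrite /vgabs pair_bigA. Qed.

Lemma vgdotE u v x :
  vgdot u v x = \sum_(ij : 'I_3 * 'I_3) gr (u ij.1) ij.2 x * gr (v ij.1) ij.2 x.
Proof. by rewrite /vgdot pair_bigA. Qed.

Lemma vabs_ge0 u x : 0 <= vabs u x. Proof. exact: sqrtr_ge0. Qed.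
Lemma vgabs_ge0 u x : 0 <= vgabs u x. Proof. exact: sqrtr_ge0. Qed.

Lemma vgdot_le u v x : `|vgdot u v x| <= vgabs u x * vgabs v x.
Proof. by rewrite vgdotE !vgabsE; exact: sum_cauchy_schwarz. Qed.

Lemma gdot_le T S x : `|gdot T S x| <= gabs T x * gabs S x.
Proof. exact: (sum_cauchy_schwarz (fun j => gr T j x)). Qed.

Lemma vdot_le u v x : `|vdot u v x| <= vabs u x * vabs v x.
Proof. exact: (sum_cauchy_schwarz (fun j => fn (u j) x)). Qed.

Lemma vgdot_sqr u x : vgdot u u x = vgabs u x ^+ 2.
Proof.
by rewrite vgdotE vgabsE sqrt_sum_sqr.
Qed.

Lemma gdot_sqr T x : gdot T T x = gabs T x ^+ 2.
Proof. by rewrite /gabs sqrt_sum_sqr. Qed.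

Lemma vdot_sqr u x : vdot u u x = vabs u x ^+ 2.
Proof. by rewrite /vabs sqrt_sum_sqr. Qed.

Lemma vgabs_lin (c : R) u v x : vgabs (c *: u + v) x <= `|c| * vgabs u x + vgabs v x.
Proof.
rewrite !vgabsE -sqrt_sumZ.
exact: (sqrt_sumD (fun ij : 'I_3 * 'I_3 => c * gr (u ij.1) ij.2 x) (fun ij => gr (v ij.1) ij.2 x)).
Qed.

Lemma gr_le_vgabs u i j x : `|gr (u i) j x| <= vgabs u x.
Proof. by rewrite vgabsE; exact: (ler_sqrt_sum (fun ij : 'I_3 * 'I_3 => gr (u ij.1) ij.2 x) (i, j)). Qed.

Lemma div_le u x : `|div u x| <= 3 * vgabs u x.
Proof.
rewrite /div; apply: (le_trans (ler_norm_sum _ _ _)).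
apply: (@le_trans _ _ (\sum_(i < 3) vgabs u x)).
  by apply: ler_sum => i _; exact: gr_le_vgabs.
by rewrite sumr_const card_ord mulr_natl.
Qed.

Lemma sconv_le u T S x : `|sconv u T S x| <= vabs u x * gabs T x * `|fn S x|.
Proof.
rewrite /sconv normrM ler_wpM2r//.
exact: (sum_cauchy_schwarz (fun j => fn (u j) x) (fun j => gr T j x)).
Qed.

Lemma vconvE u v w x : vconv u v w x = \sum_(i < 3) sconv u (v i) (w i) x.
Proof. by []. Qed.

Lemma vgdotDl u v w x : vgdot (u + v) w x = vgdot u w x + vgdot v w x.
Proof.
rewrite /vgdot -big_split; apply: eq_bigr => i _ /=.
by rewrite -big_split; apply: eq_bigr => j _ /=; exact: mulrDl.
Qed.

Lemma gdotDl T S S' x : gdot (T + S) S' x = gdot T S' x + gdot S S' x.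
Proof. by rewrite /gdot -big_split; apply: eq_bigr => j _ /=; exact: mulrDl. Qed.

Lemma vdotDl u v w x : vdot (u + v) w x = vdot u w x + vdot v w x.
Proof. by rewrite /vdot -big_split; apply: eq_bigr => j _ /=; exact: mulrDl. Qed.

Lemma vdotDr u v w x : vdot w (u + v) x = vdot w u x + vdot w v x.
Proof. by rewrite /vdot -big_split; apply: eq_bigr => j _ /=; exact: mulrDr. Qed.

Lemma sconvDl u v T S x : sconv (u + v) T S x = sconv u T S x + sconv v T S x.
Proof.
rewrite /sconv -mulrDl; congr (_ * _).
by rewrite -big_split; apply: eq_bigr => j _ /=; exact: mulrDl.
Qed.

Lemma sconvDm u T T' S x : sconv u (T + T') S x = sconv u T S x + sconv u T' S x.
Proof.
rewrite /sconv -mulrDl; congr (_ * _).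
by rewrite -big_split; apply: eq_bigr => j _ /=; exact: mulrDr.
Qed.

Lemma sconvDr u T S S' x : sconv u T (S + S') x = sconv u T S x + sconv u T S' x.
Proof. exact: mulrDr. Qed.

End Pointwise.

Section Spaces.
Context {R : realType} (Om : set (pt R)) (mOm : measurable Om)
  (fOm : (leb3 Om < +oo)%E) (Ce : R -> R)
  (hCe : forall q : R, 1 <= q <= 6 -> best_embedding Om q (Ce q)).
Implicit Types (u v w : vsobf R) (T S : sobf R) (x : pt R) (k : pt R -> R).

Lemma vH10_lin (c : R) u v : vH10 Om u -> vH10 Om v -> vH10 Om (c *: u + v).
Proof. by move=> hu hv i; exact: (H10_lin mOm fOm c (hu i) (hv i)). Qed.

Lemma vH100 : vH10 Om 0.
Proof. by move=> i; exact: H100. Qed.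

Lemma vH10B u v : vH10 Om u -> vH10 Om v -> vH10 Om (u - v).
Proof. by move=> hu hv; rewrite addrC -scaleN1r; exact: vH10_lin. Qed.

Lemma vH10D u v : vH10 Om u -> vH10 Om v -> vH10 Om (u + v).
Proof. by move=> hu hv; rewrite -[u]scale1r; exact: vH10_lin. Qed.

Lemma H10_L2jet T : H10 Om T -> L2jet Om T.
Proof. by move=> [[]]. Qed.

Lemma H10_mfn T : H10 Om T -> measurable_fun Om (fn T).
Proof. by move=> [[[]]]. Qed.

Lemma H10_mgr T j : H10 Om T -> measurable_fun Om (gr T j).
Proof. by move=> [[_ /(_ j)[]]]. Qed.

Lemma measurable_vabs u : vH10 Om u -> measurable_fun Om (vabs u).
Proof. by move=> hu; apply: (@measurable_euclid _ Om _ (fun i => fn (u i))) => i; exact: H10_mfn. Qed.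

Lemma Lp_vgabs (p : R) u : 1 <= p -> (forall i j, Lp Om p (gr (u i) j)) -> Lp Om p (vgabs u).
Proof.
move=> p1 h; rewrite (funext (vgabsE u)).
exact: (Lp_euclid mOm p1 (a := fun ij : 'I_3 * 'I_3 => gr (u ij.1) ij.2) (fun ij => h ij.1 ij.2)).
Qed.

Lemma L2_vgabs u : vH10 Om u -> Lp Om 2 (vgabs u).
Proof. by move=> hu; apply: Lp_vgabs => [|i j]; [rewrite ler1n|case: (H10_L2jet (hu i))]. Qed.

Lemma L2_gabs T : H10 Om T -> Lp Om 2 (gabs T).
Proof. by move=> /H10_L2jet; exact: L2jet_gabs. Qed.

Lemma L3_vgabs u : vW1p Om 3 u -> Lp Om 3 (vgabs u).
Proof. by move=> hu; apply: Lp_vgabs => [|i j]; [rewrite ler1n|case: (hu i)]. Qed.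

Lemma L3_gabs T : W1p Om 3 T -> Lp Om 3 (gabs T).
Proof. by move=> [_ h _]; apply: Lp_euclid => //; rewrite ler1n. Qed.

Lemma vgrad_norm_lin (c : R) u v : vH10 Om u -> vH10 Om v ->
  vgrad_norm Om 2 (c *: u + v) <= `|c| * vgrad_norm Om 2 u + vgrad_norm Om 2 v.
Proof.
move=> hu hv; have p0 : 0 < 2 :> R by [].
have [l e] := L2_lin mOm `|c| (L2_vgabs hu) (L2_vgabs hv).
rewrite normr_id in e; apply: le_trans e.
apply: (pnorm_mono mOm p0 _ l _).2; first by case: (L2_vgabs (vH10_lin c hu hv)).
move=> x _; rewrite ger0_norm ?vgabs_ge0//.
rewrite ger0_norm ?addr_ge0 ?mulr_ge0 ?vgabs_ge0//; exact: vgabs_lin.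
Qed.

Lemma vgrad_normD u v : vH10 Om u -> vH10 Om v ->
  vgrad_norm Om 2 (u + v) <= vgrad_norm Om 2 u + vgrad_norm Om 2 v.
Proof. by move=> hu hv; have := vgrad_norm_lin 1 hu hv; rewrite scale1r normr1 mul1r. Qed.

Lemma grad_normD T S : H10 Om T -> H10 Om S ->
  grad_norm Om 2 (T + S) <= grad_norm Om 2 T + grad_norm Om 2 S.
Proof.
move=> hT hS; have := gnorm_lin mOm 1 (H10_L2jet hT) (H10_L2jet hS).
by rewrite scale1r normr1 mul1r.
Qed.

Lemma vgrad_normZ (c : R) u : vH10 Om u -> vgrad_norm Om 2 (c *: u) = `|c| * vgrad_norm Om 2 u.
Proof.
move=> hu; have p0 : 0 < 2 :> R by [].
have [_ h] := pnormZ mOm `|c| p0 (L2_vgabs hu).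
rewrite /vgrad_norm -[in RHS](normr_id c) -h.
congr fine; congr Lp_norm; apply/funext => x.
by rewrite !vgabsE -sqrt_sumZ.
Qed.

Lemma grad_normZ (c : R) T : H10 Om T -> grad_norm Om 2 (c *: T) = `|c| * grad_norm Om 2 T.
Proof.
move=> hT; have p0 : 0 < 2 :> R by [].
have [_ h] := pnormZ mOm `|c| p0 (L2_gabs hT).
rewrite /grad_norm -[in RHS](normr_id c) -h.
congr fine; congr Lp_norm; apply/funext => x.
by rewrite /gabs -sqrt_sumZ.
Qed.

Lemma Ce_ge0 (q : R) : 1 <= q <= 6 -> 0 <= Ce q.
Proof. by move=> /hCe[[[]]]. Qed.

Lemma embedding (q : R) T : 1 <= q <= 6 -> H10 Om T ->
  Lp Om q (fn T) /\ pnorm Om q (fn T) <= Ce q * grad_norm Om 2 T.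
Proof.
move=> hq hT; have [[[_ h] _] _] := hCe hq; have := h _ hT => {}h.
have l : Lp Om q (fn T) by split; [exact: H10_mfn|exact: (le_lt_trans h (ltry _))].
by split => //; rewrite -lee_fin Lp_fin.
Qed.

Lemma vembedding (q : R) u : 1 <= q <= 6 -> vH10 Om u ->
  Lp Om q (vabs u) /\ pnorm Om q (vabs u) <= Ce q * vgrad_norm Om 2 u.
Proof.
move=> hq hu; have [_ [[_ h] _]] := hCe hq; have := h _ hu => {}h.
have l : Lp Om q (vabs u) by split; [exact: measurable_vabs|exact: (le_lt_trans h (ltry _))].
by split => //; rewrite -lee_fin Lp_fin.
Qed.

End Spaces.

(** * Bounds of the forms *)

Section Forms.
Context {R : realType} (Om : set (pt R)) (mOm : measurable Om)
  (fOm : (leb3 Om < +oo)%E) (Ce : R -> R)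
  (hCe : forall q : R, 1 <= q <= 6 -> best_embedding Om q (Ce q)).
Implicit Types (u v w : vsobf R) (T S : sobf R) (x : pt R) (k q : pt R -> R).

Lemma le_abs_IntK (K : R) (a b c : pt R -> R) : 0 <= K -> measurable_fun Om a ->
  Lp Om 2 b -> Lp Om 2 c -> (forall x, Om x -> `|a x| <= K * (`|b x| * `|c x|)) ->
  integrable_on Om a /\ `|Int Om a| <= K * (pnorm Om 2 b * pnorm Om 2 c).
Proof.
move=> K0 ma lb lc h; have p0 : 0 < 2 :> R by [].
have [lb' e] := pnormZ mOm K p0 lb.
have [] := le_abs_Int mOm ma lb' lc.
  by move=> x xO; rewrite normrM (ger0_norm K0) -mulrA h.
by move=> i b'; split => //; rewrite mulrA -(ger0_norm K0) -e.
Qed.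

Lemma measurable_vgdot u v : vH10 Om u -> vH10 Om v -> measurable_fun Om (vgdot u v).
Proof.
move=> hu hv; apply: measurable_sum => i; apply: measurable_sum => j.
by apply: measurable_funM; exact: H10_mgr.
Qed.

Lemma measurable_gdot T S : H10 Om T -> H10 Om S -> measurable_fun Om (gdot T S).
Proof.
by move=> hT hS; apply: measurable_sum => j; apply: measurable_funM; exact: H10_mgr.
Qed.

Lemma measurable_vdot u v : vH10 Om u -> vH10 Om v -> measurable_fun Om (vdot u v).
Proof.
by move=> hu hv; apply: measurable_sum => j; apply: measurable_funM; exact: H10_mfn.
Qed.

Lemma measurable_div u : vH10 Om u -> measurable_fun Om (div u).
Proof. by move=> hu; apply: measurable_sum => j; exact: H10_mgr. Qed.

Lemma measurable_sconv u T S : vH10 Om u -> H10 Om T -> H10 Om S ->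
  measurable_fun Om (sconv u T S).
Proof.
move=> hu hT hS; apply: measurable_funM; last exact: H10_mfn.
apply: measurable_sum => j; apply: measurable_funM; [exact: H10_mfn|exact: H10_mgr].
Qed.

Lemma vgdot_form k (K : R) u v : measurable_fun Om k -> (forall x, `|k x| <= K) ->
  vH10 Om u -> vH10 Om v ->
  integrable_on Om (fun x => k x * vgdot u v x) /\
  `|Int Om (fun x => k x * vgdot u v x)| <= K * (vgrad_norm Om 2 u * vgrad_norm Om 2 v).
Proof.
move=> mk kK hu hv; apply: le_abs_IntK; [|
  exact: measurable_funM mk (measurable_vgdot hu hv)|exact: L2_vgabs|exact: L2_vgabs|].
  exact: le_trans (normr_ge0 _) (kK (0, 0, 0)).
move=> x _; rewrite normrM !(ger0_norm (vgabs_ge0 _ _)).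
by apply: ler_pM => //; exact: vgdot_le.
Qed.

Lemma gdot_form k (K : R) T S : measurable_fun Om k -> (forall x, `|k x| <= K) ->
  H10 Om T -> H10 Om S ->
  integrable_on Om (fun x => k x * gdot T S x) /\
  `|Int Om (fun x => k x * gdot T S x)| <= K * (grad_norm Om 2 T * grad_norm Om 2 S).
Proof.
move=> mk kK hT hS; apply: le_abs_IntK; [|
  exact: measurable_funM mk (measurable_gdot hT hS)|exact: L2_gabs|exact: L2_gabs|].
  exact: le_trans (normr_ge0 _) (kK (0, 0, 0)).
move=> x _; rewrite normrM !(ger0_norm (gabs_ge0 _ _)).
by apply: ler_pM => //; exact: gdot_le.
Qed.

Let r2 : 1 <= (2 : R) <= 6. Proof. by apply/andP; split; lra. Qed.
Let r4 : 1 <= (4 : R) <= 6. Proof. by apply/andP; split; lra. Qed.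
Let r6 : 1 <= (6 : R) <= 6. Proof. by apply/andP; split; lra. Qed.

Lemma vdot_form u v : vH10 Om u -> vH10 Om v ->
  integrable_on Om (vdot u v) /\
  `|Int Om (vdot u v)| <= Ce 2 ^+ 2 * (vgrad_norm Om 2 u * vgrad_norm Om 2 v).
Proof.
move=> hu hv; have [lu eu] := vembedding hCe r2 hu; have [lv ev] := vembedding hCe r2 hv.
have [] := le_abs_Int mOm (measurable_vdot hu hv) lu lv.
  by move=> x _; rewrite !(ger0_norm (vabs_ge0 _ _)); exact: vdot_le.
move=> i h; split => //; apply: (le_trans h).
have -> : Ce 2 ^+ 2 * (vgrad_norm Om 2 u * vgrad_norm Om 2 v) =
  (Ce 2 * vgrad_norm Om 2 u) * (Ce 2 * vgrad_norm Om 2 v) by ring.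
by apply: ler_pM => //; exact: pnorm_ge0.
Qed.

Lemma L4_vabs_mul u v : vH10 Om u -> vH10 Om v ->
  Lp Om 2 (fun x => vabs u x * vabs v x) /\
  pnorm Om 2 (fun x => vabs u x * vabs v x) <=
    Ce 4 ^+ 2 * (vgrad_norm Om 2 u * vgrad_norm Om 2 v).
Proof.
move=> hu hv; have [lu eu] := vembedding hCe r4 hu; have [lv ev] := vembedding hCe r4 hv.
have [l h] := L4_mul mOm lu lv; split => //; apply: (le_trans h).
have -> : Ce 4 ^+ 2 * (vgrad_norm Om 2 u * vgrad_norm Om 2 v) =
  (Ce 4 * vgrad_norm Om 2 u) * (Ce 4 * vgrad_norm Om 2 v) by ring.
by apply: ler_pM => //; exact: pnorm_ge0.
Qed.

(** The terms with a square are products of four L^4 functions, grouped in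
    two square-integrable pairs. *)
Lemma quartic_form (h : pt R -> R) a b u v : vH10 Om a -> vH10 Om b ->
  vH10 Om u -> vH10 Om v -> measurable_fun Om h ->
  (forall x, `|h x| <= (1 + vabs a x ^+ 2 + vabs b x ^+ 2) * (vabs u x * vabs v x)) ->
  integrable_on Om h /\
  `|Int Om h| <= (Ce 2 ^+ 2 + Ce 4 ^+ 4 * (vgrad_norm Om 2 a ^+ 2 + vgrad_norm Om 2 b ^+ 2))
    * (vgrad_norm Om 2 u * vgrad_norm Om 2 v).
Proof.
move=> ha hb hu hv mh hh.
have [lu eu] := vembedding hCe r2 hu; have [lv ev] := vembedding hCe r2 hv.
have [luv euv] := L4_vabs_mul hu hv.
have [laa eaa] := L4_vabs_mul ha ha; have [lbb ebb] := L4_vabs_mul hb hb.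
have [i1 e1] := cauchy_schwarz mOm lu lv.
have [i2 e2] := cauchy_schwarz mOm laa luv; have [i3 e3] := cauchy_schwarz mOm lbb luv.
(* the three terms of the expanded product, each a pairing in L^2 *)
have i23 := integrable_onD mOm (integrable_onD mOm i1 i2) i3.
have hh' x : Om x -> `|h x| <= vabs u x * vabs v x + (vabs a x * vabs a x) * (vabs u x * vabs v x)
    + (vabs b x * vabs b x) * (vabs u x * vabs v x).
  move=> _; apply: (le_trans (hh x)); rewrite le_eqVlt; apply/orP; left; apply/eqP.
  ring.
have ih := integrable_on_dom mOm mh i23 hh'.
split => //; apply: (le_trans (le_normr_Rintegral mOm ih)).
apply: (le_trans (le_Rintegral mOm (integrable_norm ih) i23 hh')).
rewrite (RintegralD mOm (integrable_onD mOm i1 i2) i3) (RintegralD mOm i1 i2).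
have f1 := le_trans (ler_norm _) e1; have f2 := le_trans (ler_norm _) e2.
have f3 := le_trans (ler_norm _) e3.
apply: (le_trans (lerD (lerD f1 f2) f3)).
have n := @pnorm_ge0 R Om 2.
have g1 := ler_pM (n _) (n _) eu ev; have g2 := ler_pM (n _) (n _) eaa euv.
have g3 := ler_pM (n _) (n _) ebb euv.
apply: (le_trans (lerD (lerD g1 g2) g3)).
rewrite le_eqVlt; apply/orP; left; apply/eqP; ring.
Qed.

Lemma measurable_power u v (r : R) : vH10 Om u -> vH10 Om v ->
  measurable_fun Om (fun x => vabs u x `^ r * vdot u v x).
Proof.
move=> hu hv; apply: measurable_funM; last exact: measurable_vdot.
by apply: (measurableT_comp (measurable_powR _)); exact: measurable_vabs.
Qed.

Lemma power_integrable u v (r : R) : 1 <= r <= 2 -> vH10 Om u -> vH10 Om v ->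
  integrable_on Om (fun x => vabs u x `^ r * vdot u v x).
Proof.
move=> hr hu hv.
have z := vH100 mOm fOm.
apply: (quartic_form hu z hu hv (measurable_power r hu hv) _).1 => x.
rewrite normrM (ger0_norm (powR_ge0 _ _)); apply: ler_pM => //; last exact: vdot_le.
  exact: powR_ge0.
by apply: (le_trans (powR_le_1sqr (vabs_ge0 u x) hr)); rewrite lerDl; exact: sqr_ge0.
Qed.

Lemma power_diff_form u w v (r : R) : 1 <= r <= 2 -> vH10 Om u -> vH10 Om w -> vH10 Om v ->
  `|Int Om (fun x => vabs u x `^ r * vdot u v x) - Int Om (fun x => vabs w x `^ r * vdot w v x)|
   <= 3 * (Ce 2 ^+ 2 + Ce 4 ^+ 4 * (vgrad_norm Om 2 u ^+ 2 + vgrad_norm Om 2 w ^+ 2))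
    * (vgrad_norm Om 2 (u - w) * vgrad_norm Om 2 v).
Proof.
move=> hr hu hw hv.
have iu := power_integrable hr hu hv; have iw := power_integrable hr hw hv.
rewrite -RintegralB//.
have i3 := integrable_onB mOm iu iw.
pose h x := 3^-1 * (vabs u x `^ r * vdot u v x - vabs w x `^ r * vdot w v x).
have mh : measurable_fun Om h.
  apply: measurable_funM => //; apply: measurable_funB; exact: measurable_power.
have c3 : `|3^-1 : R| = 3^-1 by rewrite ger0_norm.
have [] := quartic_form hu hw (vH10B mOm fOm hu hw) hv mh.
  move=> x; rewrite /h normrM c3 ler_pdivrMl// [leRHS]mulrA.
  exact: (power_lipschitz (fun i => fn (u i) x) (fun i => fn (w i) x) (fun i => fn (v i) x) hr).
move=> ih; by rewrite /h RintegralZl// normrM c3 ler_pdivrMl// !mulrA.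
Qed.

Lemma power_mono_form u w (r : R) : 1 <= r <= 2 -> vH10 Om u -> vH10 Om w ->
  0 <= Int Om (fun x => vabs u x `^ r * vdot u (u - w) x)
    - Int Om (fun x => vabs w x `^ r * vdot w (u - w) x).
Proof.
move=> hr hu hw; have h := vH10B mOm fOm hu hw.
rewrite -RintegralB//; [|exact: power_integrable|exact: power_integrable].
apply: Rintegral_ge0 => x _.
exact: (power_monotone (fun i => fn (u i) x) (fun i => fn (w i) x) hr).
Qed.

Lemma div_form q v : Lp Om 2 q -> vH10 Om v ->
  integrable_on Om (fun x => q x * div v x) /\
  `|Int Om (fun x => q x * div v x)| <= 3 * (L2_norm Om q * vgrad_norm Om 2 v).
Proof.
move=> lq hv; apply: le_abs_IntK => //; last 2 first.
- exact: L2_vgabs.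
- move=> x _; rewrite normrM (ger0_norm (vgabs_ge0 _ _)) mulrCA ler_wpM2l//; exact: div_le.
by apply: measurable_funM; [case: lq|exact: measurable_div].
Qed.

(** Exponents 4, 2 and 4, whence the constant [Ce 4 ^+ 2] of [frakO]. *)
Lemma sconv_form u T S : vH10 Om u -> H10 Om T -> H10 Om S ->
  integrable_on Om (sconv u T S) /\
  `|Int Om (sconv u T S)| <=
    Ce 4 ^+ 2 * (vgrad_norm Om 2 u * grad_norm Om 2 T * grad_norm Om 2 S).
Proof.
move=> hu hT hS.
have [lu eu] := vembedding hCe r4 hu; have [lS eS] := embedding hCe r4 hS.
have [luS euS] := L4_mul mOm lu lS.
have [] := le_abs_Int mOm (measurable_sconv hu hT hS) luS (L2_gabs mOm hT).
  move=> x _; rewrite [X in _ <= X * _]normrM (ger0_norm (vabs_ge0 _ _)) (ger0_norm (gabs_ge0 _ _)).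
  by rewrite mulrAC; exact: sconv_le.
move=> i h; split => //; apply: (le_trans h).
have n := @pnorm_ge0 R Om.
have := ler_pM (n _ _) (n _ _) eu eS => /(le_trans euS) g.
have := ler_wpM2r (n 2 (gabs T)) g => /le_trans; apply.
rewrite -/(grad_norm Om 2 T) le_eqVlt; apply/orP; left; apply/eqP; ring.
Qed.

Lemma sum3 (F : 'I_3 -> R) : \sum_(i < 3) F i = F 0 + F 1 + F 2.
Proof. by rewrite !big_ord_recr big_ord0/= add0r; congr (F _ + F _ + F _); apply: val_inj. Qed.

Lemma vconv_form u v w : vH10 Om u -> vH10 Om v -> vH10 Om w ->
  integrable_on Om (vconv u v w) /\
  aN Om u v w = \sum_(i < 3) Int Om (sconv u (v i) (w i)).
Proof.
move=> hu hv hw; have i (j : 'I_3) := (sconv_form hu (hv j) (hw j)).1.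
have E : vconv u v w = (fun x => sconv u (v 0) (w 0) x + sconv u (v 1) (w 1) x + sconv u (v 2) (w 2) x).
  by apply/funext => x; rewrite vconvE sum3.
have i01 := integrable_onD mOm (i 0) (i 1).
rewrite /aN E sum3 (RintegralD mOm i01 (i 2)) (RintegralD mOm (i 0) (i 1)).
by split => //; exact: (integrable_onD mOm i01 (i 2)).
Qed.

(** Exponents 6, 3 and 2; [k] stands for the difference of a Lipschitz
    coefficient at two temperatures whose difference is [T]. This is where
    [frakO] gets its factor [Ln * Ce 6] and the L^3 norm of the gradient. *)
Lemma coef_diff_form k (L : R) T u v : 0 <= L -> measurable_fun Om k ->
  (forall x, `|k x| <= L * `|fn T x|) -> H10 Om T -> vH10 Om u -> vW1p Om 3 u -> vH10 Om v ->
  integrable_on Om (fun x => k x * vgdot u v x) /\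
  `|Int Om (fun x => k x * vgdot u v x)| <=
     L * Ce 6 * vgrad_norm Om 3 u * grad_norm Om 2 T * vgrad_norm Om 2 v.
Proof.
move=> L0 mk kL hT hu hu3 hv.
have [lT eT] := embedding hCe r6 hT; have l3 := L3_vgabs mOm hu3.
have [lTu eTu] := L6_L3_mul mOm lT l3.
have [|i h] := le_abs_IntK L0 (measurable_funM mk (measurable_vgdot hu hv)) lTu (L2_vgabs mOm hv).
  move=> x _; rewrite !normrM !(ger0_norm (vgabs_ge0 _ _)) -(mulrA `|fn T x|) [leRHS]mulrA.
  apply: ler_pM; [exact: normr_ge0|exact: normr_ge0|exact: kL|exact: vgdot_le].
split => //; apply: (le_trans h).
have n := @pnorm_ge0 R Om.
have e3 := le_trans eTu (ler_wpM2r (n 3 (vgabs u)) eT).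
have := ler_wpM2l L0 (ler_wpM2r (n 2 (vgabs v)) e3) => /le_trans; apply.
rewrite -/(vgrad_norm Om 2 v) -/(vgrad_norm Om 3 u) le_eqVlt; apply/orP; left; apply/eqP; ring.
Qed.

(** The scalar counterpart, which produces the term subtracted in [frakM]. *)
Lemma scoef_diff_form k (L : R) T S S' : 0 <= L -> measurable_fun Om k ->
  (forall x, `|k x| <= L * `|fn T x|) -> H10 Om T -> H10 Om S -> W1p Om 3 S -> H10 Om S' ->
  integrable_on Om (fun x => k x * gdot S S' x) /\
  `|Int Om (fun x => k x * gdot S S' x)| <=
     L * Ce 6 * grad_norm Om 3 S * grad_norm Om 2 T * grad_norm Om 2 S'.
Proof.
move=> L0 mk kL hT hu hu3 hv.
have [lT eT] := embedding hCe r6 hT; have l3 := L3_gabs mOm hu3.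
have [lTu eTu] := L6_L3_mul mOm lT l3.
have [|i h] := le_abs_IntK L0 (measurable_funM mk (measurable_gdot hu hv)) lTu (L2_gabs mOm hv).
  move=> x _; rewrite !normrM !(ger0_norm (gabs_ge0 _ _)) -(mulrA `|fn T x|) [leRHS]mulrA.
  by apply: ler_pM; [exact: normr_ge0|exact: normr_ge0|exact: kL|exact: gdot_le].
split => //; apply: (le_trans h).
have n := @pnorm_ge0 R Om.
have e3 := le_trans eTu (ler_wpM2r (n 3 (gabs S)) eT).
have := ler_wpM2l L0 (ler_wpM2r (n 2 (gabs S')) e3) => /le_trans; apply.
rewrite -/(grad_norm Om 2 S') -/(grad_norm Om 3 S) le_eqVlt; apply/orP; left; apply/eqP; ring.
Qed.

End Forms.

(** * Skew-symmetry of convection by a divergence-free field *)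

Section Skew.
Context {R : realType} (Om : set (pt R)) (mOm : measurable Om)
  (fOm : (leb3 Om < +oo)%E) (Ce : R -> R)
  (hCe : forall q : R, 1 <= q <= 6 -> best_embedding Om q (Ce q)).
Implicit Types (u v w : vsobf R) (T S : sobf R) (x : pt R) (k q : pt R -> R).

Lemma small_eq0 (c y : R) : 0 <= c -> (forall eps, 0 < eps -> `|y| <= c * eps) -> y = 0.
Proof.
move=> c0 h; apply/eqP; rewrite -normr_le0; apply/ler_addgt0Pl => eps e0.
rewrite addr0; have c1 : 0 < c + 1 by rewrite ltr_wpDl.
apply: (le_trans (h (eps / (c + 1)) (divr_gt0 e0 c1))).
by rewrite mulrA ler_pdivrMr// mulrC ler_wpM2l ?(ltW e0)// lerDl.
Qed.

Lemma Lp2_cst (c : R) : Lp Om 2 (cst c).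
Proof. by apply: (bounded_Lp mOm fOm (M := `|c|)). Qed.

(** True for test functions, and continuous in the gradient because the
    domain has finite measure. *)
Lemma Int_gr (v : sobf R) i : H10 Om v -> Int Om (gr v i) = 0.
Proof.
move=> hv; apply: (@small_eq0 (pnorm Om 2 (cst 1))); first exact: pnorm_ge0.
move=> eps e0; have [_ _ /(_ _ e0)[phi tphi h]] := (H10P mOm fOm v).1 hv.
have hd : L2jet Om (v - jet phi) by apply: H10_L2jet; apply: H10B => //; exact: H10_jet.
have E : Int Om (gr v i) = Int Om (fun x => cst 1 x * gr (v - jet phi) i x).
  have [_ l1] := H10_L2jet hv; have [_ l2] := jet_L2jet mOm fOm tphi.
  have i1 := (cauchy_schwarz mOm (Lp2_cst 1) (l1 i)).1.
  have i2 := (cauchy_schwarz mOm (Lp2_cst 1) (l2 i)).1.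
  rewrite [RHS](eq_Int (fun x => cst 1 x * gr v i x - cst 1 x * gr (jet phi) i x)); last first.
    by move=> x; exact: mulrBr.
  rewrite RintegralB// [X in _ - X](eq_Int (pderiv i phi)); last by move=> x; exact: mul1r.
  by rewrite (Int_pderiv i tphi) subr0; apply: eq_Int => x; rewrite mul1r.
rewrite E; apply: (le_trans (cauchy_schwarz mOm (Lp2_cst 1) (hd.2 i)).2).
rewrite ler_wpM2l ?pnorm_ge0//; apply: le_trans (ltW h).
rewrite /hnorm; apply: le_trans (_ : _ <= pnorm Om 2 (gabs (v - jet phi))) _; last by rewrite lerDr pnorm_ge0.
have p0 : 0 < 2 :> R by [].
apply: (pnorm_mono mOm p0 _ (L2jet_gabs mOm hd) _).2; first by case: (hd.2 i).
move=> x _; rewrite [leRHS]ger0_norm ?gabs_ge0//.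
exact: (ler_sqrt_sum (fun j => gr (v - jet phi) j x)).
Qed.

Lemma L2_div u : vH10 Om u -> Lp Om 2 (div u).
Proof.
move=> hu; have p0 : 0 < 2 :> R by [].
have [l _] := pnormZ mOm 3 p0 (L2_vgabs mOm hu).
apply: (pnorm_mono mOm p0 _ l _).1; first exact: measurable_div.
move=> x _; rewrite [leRHS]ger0_norm ?mulr_ge0 ?vgabs_ge0//; exact: div_le.
Qed.

Lemma Int_div u : vH10 Om u -> Int Om (div u) = 0.
Proof.
move=> hu; have p0 : 0 < 2 :> R by [].
have i (j : 'I_3) : integrable_on Om (gr (u j) j).
  have := (cauchy_schwarz mOm (Lp2_cst 1) ((H10_L2jet (hu j)).2 j)).1.
  by under eq_fun do rewrite mul1r.
rewrite (eq_Int (fun x => gr (u 0) 0 x + gr (u 1) 1 x + gr (u 2) 2 x)); last first.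
  by move=> x; rewrite /div sum3.
have i01 := integrable_onD mOm (i 0) (i 1).
by rewrite (RintegralD mOm i01 (i 2)) (RintegralD mOm (i 0) (i 1)) !Int_gr// !addr0.
Qed.

(** The weak divergence condition only allows multipliers of zero mean.
    Subtracting the mean of [phi] is harmless, as the divergence itself has
    zero mean; the multiplier is scaled by the measure [m] of the domain
    instead of dividing by it, and [m = 0] is treated apart. *)
Lemma Int_test_div u phi : vH10 Om u ->
  (forall q, L20 Om q -> Int Om (fun x => q x * div u x) = 0) ->
  test_function Om phi -> Int Om (fun x => phi x * div u x) = 0.
Proof.
move=> hu hdiv tphi; have p0 : 0 < 2 :> R by [].
have lphi : Lp Om 2 phi := test_Lp mOm fOm p0 tphi.
have ldiv := L2_div hu.
have iphi : integrable_on Om phi := test_integrable_on mOm fOm tphi.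
pose m : R := Int Om (cst 1).
have [m0|m0] := eqVneq m 0.
  have [M hM] := test_bounded tphi.
  have n1 : pnorm Om 2 (cst 1) = 0.
    apply/eqP; rewrite -sqrf_eq0 (pnorm2_sqr (Lp2_cst 1)); apply/eqP.
    by rewrite -[RHS]m0; apply: eq_Int => x /=; rewrite expr1n.
  have [l1 e1] := pnormZ mOm M p0 (Lp2_cst 1).
  have [|_ n2] := pnorm_mono mOm p0 lphi.1 l1.
    by move=> x _; rewrite /= mulr1; apply: (le_trans (hM x)); exact: ler_norm.
  rewrite e1 n1 mulr0 in n2.
  apply/eqP; rewrite -normr_le0; apply: (le_trans (cauchy_schwarz mOm lphi ldiv).2).
  have n3 : pnorm Om 2 phi = 0 by apply/eqP; rewrite eq_le n2 pnorm_ge0.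
  by rewrite n3 mul0r.
pose q x := m * phi x - Int Om phi.
have ic c : integrable_on Om (cst c) := integrable_on_cst mOm fOm c.
have lq : Lp Om 2 q.
  have := (L2_lin mOm m lphi (Lp2_cst (- Int Om phi))).1; exact.
have hq : L20 Om q.
  split => //; rewrite (RintegralB mOm (integrable_onZ mOm m iphi) (ic _)).
  rewrite (RintegralZl m mOm iphi) [X in _ - X](eq_Int (fun x => Int Om phi * cst 1 x)); last by move=> x; rewrite mulr1.
  by rewrite (RintegralZl _ mOm (ic 1)) mulrC subrr.
have := hdiv _ hq.
have i1 := (cauchy_schwarz mOm lphi ldiv).1; have i2 := (cauchy_schwarz mOm (Lp2_cst (Int Om phi)) ldiv).1.
rewrite (eq_Int (fun x => m * (phi x * div u x) - cst (Int Om phi) x * div u x)); last first.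
  by move=> x; rewrite /q mulrBl mulrA.
have id : integrable_on Om (div u).
  have := (cauchy_schwarz mOm (Lp2_cst 1) ldiv).1.
  by under eq_fun do rewrite mul1r.
rewrite (RintegralB mOm (integrable_onZ mOm m i1) i2).
rewrite (RintegralZl m mOm i1) (RintegralZl _ mOm id) Int_div// mulr0 subr0 => /eqP.
by rewrite mulf_eq0 (negbTE m0)/= => /eqP.
Qed.

(** The sum of the two integrands is [u . grad (phi psi)]; the definition of
    the weak gradient of [u], tested with [phi psi], turns it into
    [- (phi psi) div u]. *)
Lemma sconv_skew_test u phi psi : vH10 Om u ->
  (forall q, L20 Om q -> Int Om (fun x => q x * div u x) = 0) ->
  test_function Om phi -> test_function Om psi ->
  Int Om (sconv u (jet phi) (jet psi)) + Int Om (sconv u (jet psi) (jet phi)) = 0.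
Proof.
move=> hu hdiv tphi tpsi; have p0 : 0 < 2 :> R by [].
have hphi := H10_jet mOm fOm tphi; have hpsi := H10_jet mOm fOm tpsi.
have tM := testM tphi tpsi.
have i1 := (sconv_form mOm hCe hu hphi hpsi).1.
have i2 := (sconv_form mOm hCe hu hpsi hphi).1.
rewrite -RintegralD//.
have l1 j : Lp Om 2 (pderiv j (fun x => phi x * psi x)) := test_Lp mOm fOm p0 (test_pderiv j tM).
have l0 : Lp Om 2 (fun x => phi x * psi x) := test_Lp mOm fOm p0 tM.
have iu j := (cauchy_schwarz mOm (H10_L2jet (hu j)).1 (l1 j)).1.
have ig j := (cauchy_schwarz mOm ((H10_L2jet (hu j)).2 j) l0).1.
have d1 x i : derivable phi x (bvec i) by case: tphi => /smooth_inv[].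
have d2 x i : derivable psi x (bvec i) by case: tpsi => /smooth_inv[].
pose P (j : 'I_3) x := fn (u j) x * pderiv j (fun x => phi x * psi x) x.
rewrite (eq_Int (fun x => P 0 x + P 1 x + P 2 x)); last first.
  move=> x; rewrite -(sum3 (P ^~ x)) /sconv !mulr_suml -big_split.
  apply: eq_bigr => j _; rewrite /P (pderivM (d1 ^~ j) (d2 ^~ j)) /=.
  by rewrite /fn /gr /jet /= mulrDr mulrCA addrC; congr (_ + _); ring.
pose G (j : 'I_3) x := gr (u j) j x * (phi x * psi x).
have wg j : Int Om (P j) = - Int Om (G j) by have [[_ _ h] _] := hu j; exact: h.
have i01 := integrable_onD mOm (iu 0) (iu 1).
have g01 := integrable_onD mOm (ig 0) (ig 1).
have -> : Int Om (fun x => P 0 x + P 1 x + P 2 x) = Int Om (P 0) + Int Om (P 1) + Int Om (P 2).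
  by rewrite (RintegralD mOm i01 (iu 2)) (RintegralD mOm (iu 0) (iu 1)).
transitivity (- Int Om (G 0) + - Int Om (G 1) + - Int Om (G 2)).
  exact: (f_equal2 +%R (f_equal2 +%R (wg 0) (wg 1)) (wg 2)).
rewrite -!opprD -[RHS]oppr0; congr (- _).
rewrite -[RHS](Int_test_div hu hdiv tM).
transitivity (Int Om (fun x => G 0 x + G 1 x + G 2 x)).
  by rewrite (RintegralD mOm g01 (ig 2)) (RintegralD mOm (ig 0) (ig 1)).
by apply: eq_Int => x; rewrite /G /div sum3 -!mulrDl mulrC.
Qed.

Lemma Int_sconvDm u T T' S : vH10 Om u -> H10 Om T -> H10 Om T' -> H10 Om S ->
  Int Om (sconv u (T + T') S) = Int Om (sconv u T S) + Int Om (sconv u T' S).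
Proof.
move=> hu hT hT' hS; rewrite (eq_Int _ (sconvDm u T T' S)) RintegralD//.
  exact: (sconv_form mOm hCe hu hT hS).1.
exact: (sconv_form mOm hCe hu hT' hS).1.
Qed.

Lemma Int_sconvDr u T S S' : vH10 Om u -> H10 Om T -> H10 Om S -> H10 Om S' ->
  Int Om (sconv u T (S + S')) = Int Om (sconv u T S) + Int Om (sconv u T S').
Proof.
move=> hu hT hS hS'; rewrite (eq_Int _ (sconvDr u T S S')) RintegralD//.
  exact: (sconv_form mOm hCe hu hT hS).1.
exact: (sconv_form mOm hCe hu hT hS').1.
Qed.

Lemma Int_sconvDl u v T S : vH10 Om u -> vH10 Om v -> H10 Om T -> H10 Om S ->
  Int Om (sconv (u + v) T S) = Int Om (sconv u T S) + Int Om (sconv v T S).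
Proof.
move=> hu hv hT hS; rewrite (eq_Int _ (sconvDl u v T S)) RintegralD//.
  exact: (sconv_form mOm hCe hu hT hS).1.
exact: (sconv_form mOm hCe hv hT hS).1.
Qed.

(** The symmetrised form is bilinear and continuous in the gradient norms, so
    that it vanishes by density in each argument in turn. *)
Lemma sconv_skew u : vH10 Om u ->
  (forall q, L20 Om q -> Int Om (fun x => q x * div u x) = 0) ->
  forall T S, H10 Om T -> H10 Om S ->
  Int Om (sconv u T S) + Int Om (sconv u S T) = 0.
Proof.
move=> hu hdiv T S hT hS.
pose B T S := Int Om (sconv u T S) + Int Om (sconv u S T).
pose c := 2 * (Ce 4 ^+ 2 * vgrad_norm Om 2 u).
have c0 : 0 <= c.
  rewrite /c mulr_ge0// mulr_ge0 ?pnorm_ge0 ?sqr_ge0//.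
have Bb T' S' : H10 Om T' -> H10 Om S' -> `|B T' S'| <= c * (grad_norm Om 2 T' * grad_norm Om 2 S').
  move=> hT' hS'; apply: (le_trans (ler_normD _ _)).
  apply: (le_trans (lerD (sconv_form mOm hCe hu hT' hS').2 (sconv_form mOm hCe hu hS' hT').2)).
  by rewrite le_eqVlt; apply/orP; left; apply/eqP; rewrite /c; ring.
have BC T' S' : B T' S' = B S' T' by rewrite /B addrC.
have BD T1 T2 S' : H10 Om T1 -> H10 Om T2 -> H10 Om S' -> B (T1 + T2) S' = B T1 S' + B T2 S'.
  by move=> h1 h2 h3; rewrite /B Int_sconvDm// Int_sconvDr// addrACA.
(* density in the first argument *)
have lim T' S' : H10 Om T' -> H10 Om S' ->
    (forall phi, test_function Om phi -> B (jet phi) S' = 0) -> B T' S' = 0.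
  move=> hT' hS' h; apply: (@small_eq0 (c * grad_norm Om 2 S')).
    by rewrite mulr_ge0// pnorm_ge0.
  move=> eps e0; have [_ _ /(_ _ e0)[phi tphi hphi]] := (H10P mOm fOm T').1 hT'.
  have hj := H10_jet mOm fOm tphi; have hd := H10B mOm fOm hT' hj.
  rewrite -[T'](subrK (jet phi)) BD// h// addr0.
  apply: (le_trans (Bb _ _ hd hS')); rewrite -mulrA ler_wpM2l// mulrC ler_wpM2l ?pnorm_ge0//.
  by apply: le_trans (ltW hphi); rewrite /hnorm lerDr pnorm_ge0.
apply: (lim _ _ hT hS) => phi tphi; have hj := H10_jet mOm fOm tphi.
rewrite BC; apply: (lim _ _ hS hj) => psi tpsi; exact: sconv_skew_test.
Qed.

End Skew.

(** * Dual norms, infima and coefficients *)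

(** By scaling to the unit ball; where the seminorm [n] vanishes, boundedness
    makes [F] vanish too. *)
Lemma dual_norm_bound (R : realType) (V : lmodType R) (H : set V) (n : V -> R) (F : V -> R) :
  (forall (c : R) x, H x -> H (c *: x)) -> (forall (c : R) x, H x -> n (c *: x) = `|c| * n x) ->
  (forall x, 0 <= n x) -> bounded_linear H n F ->
  forall x, H x -> 0 <= dual_norm H n F /\ `|F x| <= dual_norm H n F * n x.
Proof.
move=> HZ nZ n0 [lin [C hC]] x Hx.
have H0 : H 0 by rewrite -(scale0r x); exact: HZ.
have F0 : F 0 = 0.
  have := lin 1 _ _ H0 H0; rewrite scaler0 addr0 mul1r => /eqP.
  by rewrite -subr_eq0 opprD addrA subrr add0r oppr_eq0 => /eqP.
have FZ c y : H y -> F (c *: y) = c * F y.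
  by move=> Hy; have := lin c _ _ Hy H0; rewrite F0 !addr0.
rewrite /dual_norm; set S := (X in sup X).
have hs : has_sup S.
  split.
    exists `|F 0|; exists 0 => //; split => //=.
    by rewrite -(scale0r x) nZ// normr0 mul0r.
  exists `|C| => _ [y [Hy ny] <-]; apply: (le_trans (hC y Hy)).
  apply: (@le_trans _ _ (`|C| * n y)); first by rewrite ler_wpM2r// ler_norm.
  by rewrite -[leRHS]mulr1 ler_wpM2l.
have d0 : 0 <= sup S.
  apply: (le_trans (normr_ge0 (F 0))); apply: ub_le_sup; first by case: hs.
  by exists 0 => //; split => //=; rewrite -(scale0r x) nZ// normr0 mul0r.
split => //; have [nx0|nx0] := eqVneq (n x) 0.
  by have := hC _ Hx; rewrite nx0 !mulr0.
have np : 0 < n x by rewrite lt_neqAle eq_sym nx0 n0.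
have h : `|F ((n x)^-1 *: x)| <= sup S.
  apply: ub_le_sup; first by case: hs.
  exists ((n x)^-1 *: x) => //; split; first exact: HZ.
  by rewrite /= nZ// ger0_norm ?invr_ge0// mulVf.
rewrite -ler_pdivrMr// mulrC; apply: le_trans h.
by rewrite FZ// normrM [X in _ <= X * _]ger0_norm ?invr_ge0.
Qed.

Lemma le_inf3 (R : realType) (A B D : set R) (x : R) :
  A !=set0 -> B !=set0 -> D !=set0 ->
  (forall a b d, A a -> B b -> D d -> x <= a + b + d) -> x <= inf A + inf B + inf D.
Proof.
move=> A0 B0 D0 h.
have hA b d : B b -> D d -> x - b - d <= inf A.
  move=> Bb Dd; apply: lb_le_inf => // a Aa; have := h _ _ _ Aa Bb Dd; lra.
have hB d : D d -> x - inf A - d <= inf B.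
  move=> Dd; apply: lb_le_inf => // b Bb; have := hA _ _ Bb Dd; lra.
have : x - inf A - inf B <= inf D.
  apply: lb_le_inf => // d Dd; have := hB _ Dd; lra.
lra.
Qed.

Lemma lipschitz_measurable (R : realType) (k : R -> R) (L : R) :
  (forall a b, `|k a - k b| <= L * `|a - b|) -> measurable_fun setT k.
Proof.
move=> kL; apply: continuous_measurable_fun => x.
apply/cvgrPdist_le => eps e0.
have c0 : 0 < `|L| + 1 by rewrite ltr_wpDl.
near=> y; apply: (le_trans (kL x y)).
have d : `|x - y| <= eps / (`|L| + 1).
  by near: y; apply: cvgr_dist_le; [exact: cvg_id|rewrite divr_gt0].
apply: (@le_trans _ _ ((`|L| + 1) * `|x - y|)).
  by rewrite ler_wpM2r// (le_trans (ler_norm _))// lerDl.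
by rewrite mulrC -ler_pdivlMr.
Unshelve. all: by end_near.
Qed.

(** * Finite element spaces *)

Section FiniteElementSpaces.
Context {R : realType} (Om : set (pt R)) (mOm : measurable Om)
  (fOm : (leb3 Om < +oo)%E) (e : @fe_pair R) (Th : set (set (pt R))).

Lemma poly_leB n (a b : pt R -> R) : poly_le n a -> poly_le n b ->
  poly_le n (fun x => a x - b x).
Proof.
move=> [c hc] [c' hc']; exists (fun i j l => c i j l - c' i j l) => x.
rewrite hc hc' -sumrB; apply: eq_bigr => i _; rewrite -sumrB; apply: eq_bigr => j _.
by rewrite -sumrB; apply: eq_bigr => l _; rewrite !mulrBl.
Qed.

Lemma within_continuousB (A : set (pt R)) (a b : pt R -> R) :
  {within A, continuous a} -> {within A, continuous b} ->
  {within A, continuous (fun x => a x - b x)}.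
Proof. by move=> ca cb x; apply: cvgB; [exact: ca|exact: cb]. Qed.

Lemma local_velocityB K (a b : pt R -> R) : local_velocity e K a -> local_velocity e K b ->
  local_velocity e K (fun x => a x - b x).
Proof.
case: e => [|bub] /=.
  move=> [p hp ap] [q hq bq]; exists (fun x => p x - q x); first exact: poly_leB.
  by move=> x xK; rewrite ap// bq.
move=> [p hp [c ap]] [q hq [c' bq]]; exists (fun x => p x - q x); first exact: poly_leB.
by exists (c - c') => x xK; rewrite ap// bq//; ring.
Qed.

Lemma XhB v w : Xh e Om Th v -> Xh e Om Th w -> Xh e Om Th (v - w).
Proof.
move=> [hv cv] [hw cw]; split; first exact: vH10B.
move=> i; have [c1 l1] := cv i; have [c2 l2] := cw i; split.
  exact: within_continuousB.
by move=> K KT; apply: local_velocityB; [exact: l1|exact: l2].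
Qed.

Lemma YhB S S' : Yh e Om Th S -> Yh e Om Th S' -> Yh e Om Th (S - S').
Proof.
move=> [hv cv lv] [hw cw lw]; split; [exact: H10B|exact: within_continuousB|].
move=> K KT; have [p hp ap] := lv _ KT; have [q hq bq] := lw _ KT.
exists (fun x => p x - q x); first exact: poly_leB.
by move=> x xK; rewrite -[LHS]/(fn S x - fn S' x) ap// bq.
Qed.

Lemma L2B q q' : Lp Om 2 q -> Lp Om 2 q' -> Lp Om 2 (fun x => q x - q' x) /\
  L2_norm Om (fun x => q x - q' x) <= L2_norm Om q + L2_norm Om q'.
Proof.
move=> lq lq'; have [] := L2_lin mOm (-1) lq' lq.
rewrite normrN1 mul1r; under [X in Lp _ _ X]eq_fun do rewrite mulN1r addrC.
move=> l h; split => //; rewrite addrC; apply: le_trans h.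
by under [X in L2_norm _ X]eq_fun do rewrite addrC -mulN1r.
Qed.

Lemma L20B q q' : L20 Om q -> L20 Om q' -> L20 Om (fun x => q x - q' x).
Proof.
move=> [lq iq] [lq' iq']; split; first exact: (L2B lq lq').1.
have i r : Lp Om 2 r -> integrable_on Om r.
  move=> lr; have := (cauchy_schwarz mOm (Lp2_cst mOm fOm 1) lr).1.
  by under eq_fun do rewrite mul1r.
by rewrite (RintegralB mOm (i _ lq) (i _ lq')) iq iq' subrr.
Qed.

Lemma MhB q q' : Mh Om Th q -> Mh Om Th q' -> Mh Om Th (fun x => q x - q' x).
Proof.
move=> [hv cv lv] [hw cw lw]; split; [exact: L20B|exact: within_continuousB|].
move=> K KT; have [p hp ap] := lv _ KT; have [r hr br] := lw _ KT.
exists (fun x => p x - r x); first exact: poly_leB.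
by move=> x xK; rewrite ap// br.
Qed.

Lemma Int_divD q v w : Lp Om 2 q -> vH10 Om v -> vH10 Om w ->
  Int Om (fun x => q x * div (v + w) x) =
  Int Om (fun x => q x * div v x) + Int Om (fun x => q x * div w x).
Proof.
move=> lq hv hw.
have E x : q x * div (v + w) x = q x * div v x + q x * div w x.
  rewrite -mulrDr; congr (_ * _); rewrite /div -big_split; exact: eq_bigr.
rewrite (eq_Int _ E) (RintegralD mOm (div_form mOm lq hv).1 (div_form mOm lq hw).1)//.
Qed.

Lemma Int_divB q q' v : Lp Om 2 q -> Lp Om 2 q' -> vH10 Om v ->
  Int Om (fun x => (q x - q' x) * div v x) =
  Int Om (fun x => q x * div v x) - Int Om (fun x => q' x * div v x).
Proof.
move=> lq lq' hv.
rewrite -(RintegralB mOm (div_form mOm lq hv).1 (div_form mOm lq' hv).1).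
by apply: eq_Int => x; rewrite mulrBl.
Qed.

Lemma VhB v w : Vh e Om Th v -> Vh e Om Th w -> Vh e Om Th (v - w).
Proof.
move=> [hv dv] [hw dw]; split; first exact: XhB.
move=> q hq; have [[lq _] _ _] := hq.
have hvw := (XhB hv hw).1.
have := Int_divD lq hvw hw.1; rewrite subrK dw// addr0 => <-; exact: dv.
Qed.

(** If [q] is not zero, the inf-sup condition says that some quotient is almost
    [beta], whereas the hypothesis bounds all of them by [K / |q|]. *)
Lemma inf_sup_bound (beta K : R) q : inf_sup e Om Th beta -> Mh Om Th q -> 0 <= K ->
  (forall v, Xh e Om Th v -> Int Om (fun x => q x * div v x) <= K * vgrad_norm Om 2 v) ->
  beta * L2_norm Om q <= K.
Proof.
move=> hinf hq K0 hK; have [->|q0] := eqVneq (L2_norm Om q) 0; first by rewrite mulr0.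
have qp : 0 < L2_norm Om q by rewrite lt_neqAle eq_sym q0 pnorm_ge0.
rewrite -ler_pdivlMr// -lee_fin; apply: (le_trans hinf).
apply: ereal_inf_le; eexists; first by exists q.
apply: ge_ereal_sup => _ [v [hv v0] <-]; rewrite lee_fin.
have vp : 0 < vgrad_norm Om 2 v by rewrite lt_neqAle eq_sym v0 pnorm_ge0.
rewrite invfM mulrA ler_pM2r ?invr_gt0// ler_pdivrMr//; exact: hK.
Qed.

End FiniteElementSpaces.

(** * Linearity and coercivity of the forms *)

Local Notation diffusion Om k w v := (Int Om (fun x => k x * vgdot w v x)).
Local Notation heat Om k T S := (Int Om (fun x => k x * gdot T S x)).
Local Notation drag Om s w v := (Int Om (fun x => vabs w x `^ (s - 2) * vdot w v x)).
Local Notation pressure Om q v := (Int Om (fun x => q x * div v x)).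

Section Convection.
Context {R : realType} (Om : set (pt R)) (mOm : measurable Om)
  (fOm : (leb3 Om < +oo)%E) (Ce : R -> R)
  (hCe : forall q : R, 1 <= q <= 6 -> best_embedding Om q (Ce q)).
Implicit Types (u v w : vsobf R) (T S : sobf R).

Lemma aN_Dl u u' v w : vH10 Om u -> vH10 Om u' -> vH10 Om v -> vH10 Om w ->
  aN Om (u + u') v w = aN Om u v w + aN Om u' v w.
Proof.
move=> hu hu' hv hw; have huu := vH10D mOm fOm hu hu'.
rewrite (vconv_form mOm hCe huu hv hw).2 (vconv_form mOm hCe hu hv hw).2.
rewrite (vconv_form mOm hCe hu' hv hw).2 -big_split; apply: eq_bigr => i _ /=.
exact: (Int_sconvDl mOm hCe).
Qed.

Lemma aN_Dm u v v' w : vH10 Om u -> vH10 Om v -> vH10 Om v' -> vH10 Om w ->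
  aN Om u (v + v') w = aN Om u v w + aN Om u v' w.
Proof.
move=> hu hv hv' hw; have hvv := vH10D mOm fOm hv hv'.
rewrite (vconv_form mOm hCe hu hvv hw).2 (vconv_form mOm hCe hu hv hw).2.
rewrite (vconv_form mOm hCe hu hv' hw).2 -big_split; apply: eq_bigr => i _ /=.
exact: (Int_sconvDm mOm hCe).
Qed.

Lemma aN_Dr u v w w' : vH10 Om u -> vH10 Om v -> vH10 Om w -> vH10 Om w' ->
  aN Om u v (w + w') = aN Om u v w + aN Om u v w'.
Proof.
move=> hu hv hw hw'; have hww := vH10D mOm fOm hw hw'.
rewrite (vconv_form mOm hCe hu hv hww).2 (vconv_form mOm hCe hu hv hw).2.
rewrite (vconv_form mOm hCe hu hv hw').2 -big_split; apply: eq_bigr => i _ /=.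
exact: (Int_sconvDr mOm hCe).
Qed.

Lemma aN_skew u v w : vH10 Om u ->
  (forall q, L20 Om q -> pressure Om q u = 0) -> vH10 Om v -> vH10 Om w ->
  aN Om u v w + aN Om u w v = 0.
Proof.
move=> hu hd hv hw.
rewrite (vconv_form mOm hCe hu hv hw).2 (vconv_form mOm hCe hu hw hv).2 -big_split.
by apply: big1 => i _; exact: (sconv_skew mOm fOm hCe).
Qed.

Lemma aSN_Dl u u' v w : vH10 Om u -> vH10 Om u' -> vH10 Om v -> vH10 Om w ->
  aSN Om (u + u') v w = aSN Om u v w + aSN Om u' v w.
Proof. by move=> hu hu' hv hw; rewrite /aSN !aN_Dl//; ring. Qed.

Lemma aSN_Dm u v v' w : vH10 Om u -> vH10 Om v -> vH10 Om v' -> vH10 Om w ->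
  aSN Om u (v + v') w = aSN Om u v w + aSN Om u v' w.
Proof. by move=> hu hv hv' hw; rewrite /aSN aN_Dm// aN_Dr//; ring. Qed.

Lemma aSNxx u v : aSN Om u v v = 0.
Proof. by rewrite /aSN subrr mulr0. Qed.

Lemma aSN_bound (CN : R) u v w : trilinear_bound Om CN ->
  vH10 Om u -> vH10 Om v -> vH10 Om w ->
  `|aSN Om u v w| <= CN * vgrad_norm Om 2 u * vgrad_norm Om 2 v * vgrad_norm Om 2 w.
Proof.
move=> [CN0 h] hu hv hw; have h1 := h _ _ _ hu hv hw; have h2 := h _ _ _ hu hw hv.
rewrite /aSN normrM ger0_norm// ler_pdivrMl//; apply: (le_trans (ler_normB _ _)).
apply: (le_trans (lerD h1 h2)).
by rewrite le_eqVlt; apply/orP; left; apply/eqP; ring.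
Qed.

Lemma aSTE u T S : vH10 Om u -> H10 Om T -> H10 Om S ->
  aST Om u T S = 2^-1 * (Int Om (sconv u T S) - Int Om (sconv u S T)).
Proof.
move=> hu hT hS; rewrite /aST RintegralB//.
  exact: (sconv_form mOm hCe hu hT hS).1.
exact: (sconv_form mOm hCe hu hS hT).1.
Qed.

Lemma aST_Dl u u' T S : vH10 Om u -> vH10 Om u' -> H10 Om T -> H10 Om S ->
  aST Om (u + u') T S = aST Om u T S + aST Om u' T S.
Proof.
move=> hu hu' hT hS; have huu := vH10D mOm fOm hu hu'.
rewrite (aSTE huu hT hS) (aSTE hu hT hS) (aSTE hu' hT hS).
rewrite (Int_sconvDl mOm hCe hu hu' hT hS) (Int_sconvDl mOm hCe hu hu' hS hT); ring.
Qed.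

Lemma aST_Dm u T T' S : vH10 Om u -> H10 Om T -> H10 Om T' -> H10 Om S ->
  aST Om u (T + T') S = aST Om u T S + aST Om u T' S.
Proof.
move=> hu hT hT' hS; have hTT := H10D mOm fOm hT hT'.
rewrite (aSTE hu hTT hS) (aSTE hu hT hS) (aSTE hu hT' hS).
rewrite (Int_sconvDm mOm hCe hu hT hT' hS) (Int_sconvDr mOm hCe hu hS hT hT'); ring.
Qed.

Lemma aSTxx u T : vH10 Om u -> H10 Om T -> aST Om u T T = 0.
Proof. by move=> hu hT; rewrite aSTE// subrr mulr0. Qed.

Lemma aST_bound u T S : vH10 Om u -> H10 Om T -> H10 Om S ->
  `|aST Om u T S| <= Ce 4 ^+ 2 * (vgrad_norm Om 2 u * grad_norm Om 2 T * grad_norm Om 2 S).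
Proof.
move=> hu hT hS; have h1 := (sconv_form mOm hCe hu hT hS).2.
have h2 := (sconv_form mOm hCe hu hS hT).2.
rewrite aSTE// normrM ger0_norm// ler_pdivrMl//; apply: (le_trans (ler_normB _ _)).
apply: (le_trans (lerD h1 h2)).
by rewrite le_eqVlt; apply/orP; left; apply/eqP; ring.
Qed.

End Convection.

Section DiffusionForms.
Context {R : realType} (Om : set (pt R)) (mOm : measurable Om)
  (fOm : (leb3 Om < +oo)%E).
Context (k : R -> R) (L lo hi : R) (hk : bounded_lipschitz k L lo hi).
Implicit Types (u v w : vsobf R) (T S : sobf R).

Lemma coef_measurable T : H10 Om T -> measurable_fun Om (fun x => k (fn T x)).
Proof.
move=> hT; apply: (measurableT_comp (f := k)); last exact: H10_mfn.
by case: hk => kL _ _ _; exact: lipschitz_measurable kL.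
Qed.

Lemma coef_bound (r : R) : `|k r| <= hi.
Proof.
by case: hk => _ lo0 _ /(_ r)/andP[h1 h2]; rewrite ger0_norm// (le_trans (ltW lo0)).
Qed.

Lemma coef_lip_ge0 : 0 <= L.
Proof.
case: hk => /(_ 1 0) + _ _ _; rewrite subr0 normr1 mulr1; apply: le_trans.
exact: normr_ge0.
Qed.

Lemma coef_diff_bound T T' x : `|k (fn T x) - k (fn T' x)| <= L * `|fn (T - T') x|.
Proof. by case: hk => h _ _ _; exact: h. Qed.

Lemma diffusionD T u v w : H10 Om T -> vH10 Om u -> vH10 Om v -> vH10 Om w ->
  diffusion Om (fun x => k (fn T x)) (u + v) w =
  diffusion Om (fun x => k (fn T x)) u w + diffusion Om (fun x => k (fn T x)) v w.
Proof.
move=> hT hu hv hw; have mk := coef_measurable hT.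
have i1 := (vgdot_form mOm mk (fun x => coef_bound (fn T x)) hu hw).1.
have i2 := (vgdot_form mOm mk (fun x => coef_bound (fn T x)) hv hw).1.
rewrite -(RintegralD mOm i1 i2); apply: eq_Int => x; rewrite vgdotDl; exact: mulrDr.
Qed.

Lemma diffusion_bound T u v : H10 Om T -> vH10 Om u -> vH10 Om v ->
  `|diffusion Om (fun x => k (fn T x)) u v| <= hi * (vgrad_norm Om 2 u * vgrad_norm Om 2 v).
Proof.
move=> hT hu hv; have mk := coef_measurable hT.
exact: (vgdot_form mOm mk (fun x => coef_bound (fn T x)) hu hv).2.
Qed.

Lemma diffusion_coercive T u : H10 Om T -> vH10 Om u ->
  lo * vgrad_norm Om 2 u ^+ 2 <= diffusion Om (fun x => k (fn T x)) u u.
Proof.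
move=> hT hu; have mk := coef_measurable hT; have l := L2_vgabs mOm hu.
have i1 := (vgdot_form mOm mk (fun x => coef_bound (fn T x)) hu hu).1.
have i2 := L2_integrable_on mOm l.
rewrite (pnorm2_sqr l) -(RintegralZl _ mOm i2).
apply: (le_Rintegral mOm (integrable_onZ mOm _ i2) i1) => x _.
rewrite vgdot_sqr ler_wpM2r ?sqr_ge0//.
by case: hk => _ _ _ /(_ (fn T x))/andP[].
Qed.

Lemma diffusion_coef_diff T T' u w : H10 Om T -> H10 Om T' -> vH10 Om u -> vH10 Om w ->
  diffusion Om (fun x => k (fn T x)) u w - diffusion Om (fun x => k (fn T' x)) u w =
  diffusion Om (fun x => k (fn T x) - k (fn T' x)) u w.
Proof.
move=> hT hT' hu hw; have mk := coef_measurable hT; have mk' := coef_measurable hT'.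
have i1 := (vgdot_form mOm mk (fun x => coef_bound (fn T x)) hu hw).1.
have i2 := (vgdot_form mOm mk' (fun x => coef_bound (fn T' x)) hu hw).1.
by rewrite -(RintegralB mOm i1 i2); apply: eq_Int => x; rewrite mulrBl.
Qed.

Lemma heatD T T1 T2 S : H10 Om T -> H10 Om T1 -> H10 Om T2 -> H10 Om S ->
  heat Om (fun x => k (fn T x)) (T1 + T2) S =
  heat Om (fun x => k (fn T x)) T1 S + heat Om (fun x => k (fn T x)) T2 S.
Proof.
move=> hT hu hv hw; have mk := coef_measurable hT.
have i1 := (gdot_form mOm mk (fun x => coef_bound (fn T x)) hu hw).1.
have i2 := (gdot_form mOm mk (fun x => coef_bound (fn T x)) hv hw).1.
rewrite -(RintegralD mOm i1 i2); apply: eq_Int => x; rewrite gdotDl; exact: mulrDr.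
Qed.

Lemma heat_bound T T1 S : H10 Om T -> H10 Om T1 -> H10 Om S ->
  `|heat Om (fun x => k (fn T x)) T1 S| <= hi * (grad_norm Om 2 T1 * grad_norm Om 2 S).
Proof.
move=> hT hu hv; have mk := coef_measurable hT.
exact: (gdot_form mOm mk (fun x => coef_bound (fn T x)) hu hv).2.
Qed.

Lemma heat_coercive T S : H10 Om T -> H10 Om S ->
  lo * grad_norm Om 2 S ^+ 2 <= heat Om (fun x => k (fn T x)) S S.
Proof.
move=> hT hu; have mk := coef_measurable hT; have l := L2_gabs mOm hu.
have i1 := (gdot_form mOm mk (fun x => coef_bound (fn T x)) hu hu).1.
have i2 := L2_integrable_on mOm l.
rewrite (pnorm2_sqr l) -(RintegralZl _ mOm i2).
apply: (le_Rintegral mOm (integrable_onZ mOm _ i2) i1) => x _.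
rewrite gdot_sqr ler_wpM2r ?sqr_ge0//.
by case: hk => _ _ _ /(_ (fn T x))/andP[].
Qed.

Lemma heat_coef_diff T T' T1 S : H10 Om T -> H10 Om T' -> H10 Om T1 -> H10 Om S ->
  heat Om (fun x => k (fn T x)) T1 S - heat Om (fun x => k (fn T' x)) T1 S =
  heat Om (fun x => k (fn T x) - k (fn T' x)) T1 S.
Proof.
move=> hT hT' hu hw; have mk := coef_measurable hT; have mk' := coef_measurable hT'.
have i1 := (gdot_form mOm mk (fun x => coef_bound (fn T x)) hu hw).1.
have i2 := (gdot_form mOm mk' (fun x => coef_bound (fn T' x)) hu hw).1.
by rewrite -(RintegralB mOm i1 i2); apply: eq_Int => x; rewrite mulrBl.
Qed.

Context (Ce : R -> R)
  (hCe : forall q : R, 1 <= q <= 6 -> best_embedding Om q (Ce q)).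

Lemma diffusion_coef_diff_bound T T' u v : H10 Om T -> H10 Om T' ->
  vH10 Om u -> vW1p Om 3 u -> vH10 Om v ->
  `|diffusion Om (fun x => k (fn T x) - k (fn T' x)) u v| <=
  L * Ce 6 * vgrad_norm Om 3 u * grad_norm Om 2 (T - T') * vgrad_norm Om 2 v.
Proof.
move=> hT hT' hu hu3 hv.
have mk := measurable_funB (coef_measurable hT) (coef_measurable hT').
exact: (coef_diff_form mOm hCe coef_lip_ge0 mk (coef_diff_bound T T') (H10B mOm fOm hT hT') hu hu3 hv).2.
Qed.

Lemma heat_coef_diff_bound T T' T1 S : H10 Om T -> H10 Om T' ->
  H10 Om T1 -> W1p Om 3 T1 -> H10 Om S ->
  `|heat Om (fun x => k (fn T x) - k (fn T' x)) T1 S| <=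
  L * Ce 6 * grad_norm Om 3 T1 * grad_norm Om 2 (T - T') * grad_norm Om 2 S.
Proof.
move=> hT hT' hu hu3 hv.
have mk := measurable_funB (coef_measurable hT) (coef_measurable hT').
exact: (scoef_diff_form mOm hCe coef_lip_ge0 mk (coef_diff_bound T T') (H10B mOm fOm hT hT') hu hu3 hv).2.
Qed.

End DiffusionForms.

(** * Absorption arguments with real numbers *)

Lemma cancel_norm (R : realType) (c a n : R) : 0 < c -> 0 <= n -> 0 <= a ->
  c * n ^+ 2 <= a * n -> n <= a / c.
Proof.
move=> c0 n0 a0 h; rewrite ler_pdivlMr// mulrC.
have [->|n1] := eqVneq n 0; first by rewrite mulr0.
have np : 0 < n by rewrite lt_neqAle eq_sym n1.
by rewrite -(ler_pM2r np) -mulrA -expr2.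
Qed.

Section RealInequalities.
Context {R : realType}.

(** Divide by [rho]; the term [k3 * th] moves to the left-hand side, after
    [th <= eta + rho] has replaced [rho] by [th] there. *)
Lemma temperature_algebra (km kp k3 cU cT eta rho th e : R) :
  0 < km -> 0 <= kp -> 0 <= k3 -> 0 <= cU -> 0 <= cT ->
  0 <= eta -> 0 <= rho -> 0 <= th -> 0 <= e -> th <= eta + rho ->
  km * rho ^+ 2 <= kp * (eta * rho) + k3 * th * rho + cT * e * rho + cU * eta * rho ->
  (km - k3) * th <= (km + kp + cU) * eta + cT * e.
Proof.
move=> km0 kp0 k30 cU0 cT0 eta0 rho0 th0 e0 tr h.
have a0 : 0 <= kp * eta + k3 * th + cT * e + cU * eta by rewrite !addr_ge0// mulr_ge0.
have h1 : rho * km <= kp * eta + k3 * th + cT * e + cU * eta.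
  rewrite -ler_pdivlMr//; apply: cancel_norm => //; lra.
have h2 : km * th <= km * (eta + rho) by rewrite ler_pM2l.
lra.
Qed.

(** If [phi] exceeds [Z], then [Z^2 <= Z phi] and [phi] can be cancelled. *)
Lemma quadratic_bound (N0 A B phi Z : R) : 0 < N0 -> 0 <= A -> 0 <= B ->
  0 <= phi -> 0 <= Z -> N0 * phi ^+ 2 <= A * (Z * phi) + B * Z ^+ 2 ->
  phi <= (1 + (A + B) / N0) * Z.
Proof.
move=> N00 A0 B0 phi0 Z0 h.
have [pZ|Zp] := leP phi Z.
  by apply: (le_trans pZ); rewrite ler_peMl// lerDl divr_ge0 ?addr_ge0// ltW.
have h1 : B * Z ^+ 2 <= B * (Z * phi) by rewrite ler_wpM2l// expr2 ler_wpM2l// ltW.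
have h2 : phi <= (A + B) * Z / N0.
  apply: cancel_norm => //; first by rewrite mulr_ge0// addr_ge0.
  by apply: (le_trans h); rewrite -mulrA mulrDl lerD2l.
have -> : (1 + (A + B) / N0) * Z = Z + (A + B) * Z / N0 by ring.
by apply: (le_trans h2); rewrite lerDr.
Qed.

(** Inserting the temperature bound turns [k * th * phi] into
    [k c5 / M * e * phi] plus interpolation errors, and [e <= xi + phi] leaves
    the quadratic term with coefficient [k c5 / M] to be absorbed. *)
Lemma velocity_algebra (nm np cu c2 kp k M c1 c5 xi eta pi phi e th : R) :
  0 <= np -> 0 <= cu -> 0 <= c2 -> 0 <= kp -> 0 <= k -> 0 < M -> 0 <= c1 -> 0 <= c5 ->
  0 <= xi -> 0 <= eta -> 0 <= pi -> 0 <= phi -> e <= xi + phi ->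
  M * th <= c1 * eta + c5 * e ->
  nm * phi ^+ 2 <= np * (xi * phi) + k * th * phi + cu * (xi * phi) + cu * phi ^+ 2
    + cu * (xi * phi) + c2 * (xi * phi) + kp * (e * xi) + 3 * (pi * phi) ->
  0 < nm - cu - k * c5 / M ->
  phi <= (1 + ((np + 2 * cu + c2 + k * c5 / M + kp + k * c1 / M + 3) + kp)
     / (nm - cu - k * c5 / M)) * (xi + eta + pi).
Proof.
move=> np0 cu0 c20 kp0 k0 M0 c10 c50 xi0 eta0 pi0 phi0 exp Mth h N0.
have Mi : 0 <= M^-1 by rewrite invr_ge0 ltW.
have o0 : 0 <= k * c5 / M by rewrite divr_ge0 ?mulr_ge0// ltW.
have o1 : 0 <= k * c1 / M by rewrite divr_ge0 ?mulr_ge0// ltW.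
apply: quadratic_bound => //; rewrite ?addr_ge0 ?mulr_ge0//.
set Z := xi + eta + pi.
have xZ : xi * phi <= Z * phi by rewrite ler_wpM2r// /Z -addrA lerDl addr_ge0.
have eZ : eta * phi <= Z * phi by rewrite ler_wpM2r// /Z; lra.
have pZ : pi * phi <= Z * phi by rewrite ler_wpM2r// /Z; lra.
have xx : xi ^+ 2 <= Z ^+ 2 by rewrite lerXn2r ?nnegrE /Z; lra.
have h1 : k * th * phi <= k * c5 / M * (xi * phi + phi ^+ 2) + k * c1 / M * (eta * phi).
  have t1 : th <= (c1 * eta + c5 * (xi + phi)) / M.
    rewrite ler_pdivlMr// mulrC; apply: (le_trans Mth).
    by rewrite lerD2l ler_wpM2l.
  have -> : k * c5 / M * (xi * phi + phi ^+ 2) + k * c1 / M * (eta * phi) =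
    k * ((c1 * eta + c5 * (xi + phi)) / M) * phi by ring.
  by rewrite ler_wpM2r// ler_wpM2l.
have h2 : kp * (e * xi) <= kp * (Z ^+ 2 + Z * phi).
  rewrite ler_wpM2l//; apply: (@le_trans _ _ ((xi + phi) * xi)); first by rewrite ler_wpM2r.
  rewrite mulrDl -expr2 (mulrC phi); exact: lerD.
have m1 := ler_wpM2l np0 xZ; have m2 := ler_wpM2l cu0 xZ; have m3 := ler_wpM2l c20 xZ.
have m4 := ler_wpM2l o0 xZ; have m5 := ler_wpM2l o1 eZ.
move: m1 m2 m3 m4 m5 h1 h2 h pZ; move: (k * c5 / M) (k * c1 / M) => o o'.
move: (Z * phi) (Z ^+ 2) (xi * phi) (eta * phi) (k * th * phi) (e * xi) (pi * phi) => a b c d k' ex p'.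
lra.
Qed.

(** The linear bookkeeping behind [velocity_inequality]: the error equation,
    the splittings of its terms and their one-sided bounds. *)
Lemma velocity_combination (De Dxi Dphi K Se Sxi Sphi She Shxi Ve Vxi Vphi
    Gphi Hphi Ge He Gxi Hxi Pp Pph Pqh Pd B1 B2 B3 B4 B5 B6 B7 B8 : R) :
  De + K + Se + She + Ve + (Gphi - Hphi) = Pp - Pph ->
  De = Dxi + Dphi -> Se = Sxi + Sphi -> She = Shxi -> Ve = Vxi + Vphi ->
  Ge = Gxi + Gphi -> He = Hxi + Hphi -> Pd = Pp - Pqh -> Pqh - Pph = 0 ->
  0 <= Vphi -> 0 <= Ge - He ->
  - B1 <= Dxi -> - B2 <= K -> - B3 <= Sxi -> - B4 <= Sphi -> - B5 <= Shxi ->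
  - B6 <= Vxi -> Gxi - Hxi <= B7 -> Pd <= B8 ->
  Dphi <= B1 + B2 + B3 + B4 + B5 + B6 + B7 + B8.
Proof. lra. Qed.

(** The analogous bookkeeping for [pressure_inequality]. *)
Lemma pressure_combination (D K S Sh V Gh Pp Pph Pqh Pd Pdh k1 k2 k3 k4 k5 k6 e th pi n : R) :
  D + K + S + Sh + V + Gh = Pp - Pph -> Pdh = Pqh - Pph -> Pd = Pp - Pqh ->
  D <= k1 * (e * n) -> K <= k2 * th * n -> S <= k3 * (e * n) -> Sh <= k3 * (e * n) ->
  V <= k4 * (e * n) -> Gh <= k5 * (e * n) -> - (k6 * (pi * n)) <= Pd ->
  Pdh <= (k1 * e + k2 * th + 2 * k3 * e + k4 * e + k5 * e + k6 * pi) * n.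
Proof. lra. Qed.

(** From the three error inequalities to one bound, whose constant is chosen
    before the errors. *)
Lemma cea_algebra (nm np cu c2 kp k M c1 c5 beta : R) :
  0 <= np -> 0 <= cu -> 0 <= c2 -> 0 <= kp -> 0 <= k -> 0 < M -> 0 <= c1 -> 0 <= c5 ->
  0 < beta -> 0 < nm - cu - k * c5 / M ->
  exists2 C, 0 < C & forall xi eta pi phi e th dq err : R,
    0 <= xi -> 0 <= eta -> 0 <= pi -> 0 <= phi -> e <= xi + phi ->
    M * th <= c1 * eta + c5 * e ->
    nm * phi ^+ 2 <= np * (xi * phi) + k * th * phi + cu * (xi * phi) + cu * phi ^+ 2
      + cu * (xi * phi) + c2 * (xi * phi) + kp * (e * xi) + 3 * (pi * phi) ->
    beta * dq <= np * e + k * th + 2 * cu * e + c2 * e + kp * e + 3 * pi ->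
    err <= pi + dq -> e + th + err <= C * (xi + eta + pi).
Proof.
move=> np0 cu0 c20 kp0 k0 M0 c10 c50 beta0 N0.
(* cv, ct and cq bound phi, th and dq in terms of the interpolation errors *)
pose cv := 1 + ((np + 2 * cu + c2 + k * c5 / M + kp + k * c1 / M + 3) + kp)
     / (nm - cu - k * c5 / M).
have Mi : 0 <= M^-1 by rewrite invr_ge0 ltW.
have Ni : 0 <= (nm - cu - k * c5 / M)^-1 by rewrite invr_ge0 ltW.
have bi : 0 <= beta^-1 by rewrite invr_ge0 ltW.
have cv0 : 0 <= cv by rewrite /cv !(addr_ge0, mulr_ge0).
pose ct := (c1 + c5 * (1 + cv)) / M.
have ct0 : 0 <= ct by rewrite /ct !(addr_ge0, mulr_ge0).
pose cq := (np * (1 + cv) + k * ct + 2 * cu * (1 + cv) + c2 * (1 + cv) + kp * (1 + cv) + 3) / beta.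
have cq0 : 0 <= cq by rewrite /cq !(addr_ge0, mulr_ge0).
exists (1 + cv + ct + (1 + cq)); first by lra.
move=> xi eta pi phi e th dq err xi0 eta0 pi0 phi0 he hth hphi hdq herr.
have h1 := velocity_algebra np0 cu0 c20 kp0 k0 M0 c10 c50 xi0 eta0 pi0 phi0 he hth hphi N0.
rewrite -/cv in h1; set Z := xi + eta + pi in h1 *.
have xZ : xi <= Z by rewrite /Z; lra.
have eZ : eta <= Z by rewrite /Z; lra.
have pZ : pi <= Z by rewrite /Z; lra.
have h2 : e <= (1 + cv) * Z by lra.
have h3 : th <= ct * Z.
  rewrite /ct mulrAC ler_pdivlMr// mulrC; apply: (le_trans hth).
  by rewrite mulrDl -mulrA lerD// ler_wpM2l.
have h4 : dq <= cq * Z.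
  rewrite /cq mulrAC ler_pdivlMr// mulrC; apply: (le_trans hdq).
  by rewrite !mulrDl -!(mulrA _ (1 + cv)) -(mulrA k) !lerD// ?ler_wpM2l// mulr_ge0.
lra.
Qed.

Lemma one_le_six_le_six : 1 <= (6 : R) <= 6.
Proof. by apply/andP; split; lra. Qed.

Lemma norm_le (x y : R) : `|x| <= y -> - y <= x <= y.
Proof. by rewrite ler_norml. Qed.

End RealInequalities.

(** * Error estimates for the coupled problem *)

Section Coupled.
Context {R : realType} (Om : set (pt R)) (mOm : measurable Om)
  (fOm : (leb3 Om < +oo)%E) (Ce : R -> R)
  (hCe : forall q : R, 1 <= q <= 6 -> best_embedding Om q (Ce q))
  (nu kap : R -> R) (Ln Lk nu_m nu_p kap_m kap_p : R)
  (hnu : bounded_lipschitz nu Ln nu_m nu_p)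
  (hkap : bounded_lipschitz kap Lk kap_m kap_p)
  (s : R) (hs : 3 <= s <= 4)
  (f : vsobf R -> R) (g : sobf R -> R) (hf : vHm1 Om f) (hg : Hm1 Om g)
  (u : vsobf R) (p : pt R -> R) (T : sobf R)
  (hsol : weak_solution Om nu kap s f g u p T)
  (CN : R) (hCN : trilinear_bound Om CN) (hu3 : vW1p Om 3 u) (hT3 : W1p Om 3 T).

Local Notation nV := (vgrad_norm Om 2).
Local Notation nY := (grad_norm Om 2).
Local Notation U0 := (vHm1_norm Om f / nu_m).
Local Notation T0 := (Hm1_norm Om g / kap_m).

Let hr : 1 <= s - 2 <= 2.
Proof. by case/andP: hs => h1 h2; apply/andP; split; lra. Qed.

Let hu : vH10 Om u. Proof. by case: hsol => -[]. Qed.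
Let lp : Lp Om 2 p. Proof. by case: hsol => -[_ []]. Qed.
Let hT : H10 Om T. Proof. by case: hsol => -[]. Qed.
Let hdiv q : L20 Om q -> pressure Om q u = 0. Proof. by case: hsol => _ [_ + _]; apply. Qed.

Lemma f_bound v : vH10 Om v -> f v <= vHm1_norm Om f * nV v.
Proof.
move=> hv; apply: (le_trans (ler_norm _)).
apply: (dual_norm_bound _ _ _ hf hv).2.
- move=> c x hx; rewrite -[_ *: _]addr0; apply: (vH10_lin mOm fOm) => //; exact: vH100.
- by move=> c x hx; exact: vgrad_normZ.
- by move=> x; exact: pnorm_ge0.
Qed.

Lemma g_bound S : H10 Om S -> g S <= Hm1_norm Om g * nY S.
Proof.
move=> hv; apply: (le_trans (ler_norm _)).
apply: (dual_norm_bound _ _ _ hg hv).2.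
- by move=> c x hx; exact: H10Z.
- by move=> c x hx; exact: grad_normZ.
- by move=> x; exact: pnorm_ge0.
Qed.

Lemma f_norm_ge0 : 0 <= vHm1_norm Om f.
Proof.
apply: (dual_norm_bound _ _ _ hf hu).1.
- move=> c x hx; rewrite -[_ *: _]addr0; apply: (vH10_lin mOm fOm) => //; exact: vH100.
- by move=> c x hx; exact: vgrad_normZ.
- by move=> x; exact: pnorm_ge0.
Qed.

Lemma g_norm_ge0 : 0 <= Hm1_norm Om g.
Proof.
apply: (dual_norm_bound _ _ _ hg hT).1.
- by move=> c x hx; exact: H10Z.
- by move=> c x hx; exact: grad_normZ.
- by move=> x; exact: pnorm_ge0.
Qed.

(** Skew-symmetry allows the continuous problem to be written with the
    skew-symmetrised forms of the discrete one. *)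
Lemma momentum_eq v : vH10 Om v ->
  diffusion Om (fun x => nu (fn T x)) u v + aSN Om u u v + Int Om (vdot u v)
  + drag Om s u v - pressure Om p v = f v.
Proof.
move=> hv; case: (hsol) => _ [/(_ v hv) <- _ _].
have mk := coef_measurable hnu hT.
have i1 := (vgdot_form mOm mk (fun x => coef_bound hnu (fn T x)) hu hv).1.
have i2 := (vconv_form mOm hCe hu hu hv).1.
have i3 := (vdot_form mOm hCe hu hv).1.
have i4 := power_integrable mOm fOm hCe hr hu hv.
have i5 := (div_form mOm lp hv).1.
have i12 := integrable_onD mOm i1 i2; have i123 := integrable_onD mOm i12 i3.
have i1234 := integrable_onD mOm i123 i4.
rewrite (RintegralB mOm i1234 i5) (RintegralD mOm i123 i4) (RintegralD mOm i12 i3).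
rewrite (RintegralD mOm i1 i2) -/(aN Om u u v).
have E := aN_skew mOm fOm hCe hu hdiv hu hv.
have -> : aN Om u u v = aSN Om u u v by rewrite /aSN; lra.
by [].
Qed.

Lemma heat_eq S : H10 Om S ->
  heat Om (fun x => kap (fn T x)) T S + aST Om u T S = g S.
Proof.
move=> hS; case: (hsol) => _ [_ _ /(_ S hS) <-].
have mk := coef_measurable hkap hT.
have i1 := (gdot_form mOm mk (fun x => coef_bound hkap (fn T x)) hT hS).1.
have i2 := (sconv_form mOm hCe hu hT hS).1.
rewrite (RintegralD mOm i1 i2).
have E := sconv_skew mOm fOm hCe hu hdiv hT hS.
have -> : aST Om u T S = Int Om (sconv u T S) by rewrite (aSTE mOm hCe hu hT hS); lra.
by [].
Qed.

Lemma drag_ge0 (w : vsobf R) : 0 <= drag Om s w w.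
Proof.
apply: Rintegral_ge0 => x _; apply: mulr_ge0; first exact: powR_ge0.
by rewrite vdot_sqr sqr_ge0.
Qed.

Lemma Int_vdot_ge0 (w : vsobf R) : 0 <= Int Om (vdot w w).
Proof. by apply: Rintegral_ge0 => x _; rewrite vdot_sqr sqr_ge0. Qed.

Lemma nu_m_gt0 : 0 < nu_m. Proof. by case: hnu. Qed.
Lemma kap_m_gt0 : 0 < kap_m. Proof. by case: hkap. Qed.

(** Tested with the solution itself, convection and pressure disappear and the
    lower-order terms are nonnegative. *)
Lemma energy_velocity : nV u <= vHm1_norm Om f / nu_m.
Proof.
apply: cancel_norm; [exact: nu_m_gt0|exact: pnorm_ge0|exact: f_norm_ge0|].
apply: le_trans (f_bound hu); rewrite -(momentum_eq hu).
rewrite aSNxx addr0 (_ : pressure Om p u = 0); last first.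
  by case: hsol => -[_ hp _] _; exact: hdiv.
have h1 := diffusion_coercive mOm hnu hT hu; have h2 := drag_ge0 u.
have h3 := Int_vdot_ge0 u; lra.
Qed.

Lemma energy_temperature : nY T <= Hm1_norm Om g / kap_m.
Proof.
apply: cancel_norm; [exact: kap_m_gt0|exact: pnorm_ge0|exact: g_norm_ge0|].
apply: le_trans (g_bound hT); rewrite -(heat_eq hT) (aSTxx mOm hCe hu hT) addr0.
exact: (heat_coercive mOm hkap hT hT).
Qed.

Section Discrete.
Context (e : @fe_pair R) (Th : set (set (pt R))) (uh : vsobf R) (ph : pt R -> R)
  (Temph : sobf R)
  (hdisc : discrete_solution e Om Th nu kap s f g uh ph Temph).

Let Xuh : Xh e Om Th uh. Proof. by case: hdisc => -[]. Qed.
Let Mph : Mh Om Th ph. Proof. by case: hdisc => -[]. Qed.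
Let YTh : Yh e Om Th Temph. Proof. by case: hdisc => -[]. Qed.
Let huh : vH10 Om uh. Proof. by case: Xuh. Qed.
Let lph : Lp Om 2 ph. Proof. by case: Mph => -[]. Qed.
Let hTh : H10 Om Temph. Proof. by case: YTh. Qed.
Let hdivh q : Mh Om Th q -> pressure Om q uh = 0.
Proof. by case: hdisc => _ [_ + _]; apply. Qed.

Lemma discrete_momentum_eq v : Xh e Om Th v ->
  diffusion Om (fun x => nu (fn Temph x)) uh v + aSN Om uh uh v + Int Om (vdot uh v)
  + drag Om s uh v - pressure Om ph v = f v.
Proof.
move=> Xv; have hv := Xv.1; case: (hdisc) => _ [/(_ v Xv) <- _ _].
have mk := coef_measurable hnu hTh.
have i1 := (vgdot_form mOm mk (fun x => coef_bound hnu (fn Temph x)) huh hv).1.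
have i3 := (vdot_form mOm hCe huh hv).1.
rewrite (RintegralD mOm i1 i3); ring.
Qed.

Lemma energy_discrete_velocity : nV uh <= vHm1_norm Om f / nu_m.
Proof.
apply: cancel_norm; [exact: nu_m_gt0|exact: pnorm_ge0|exact: f_norm_ge0|].
apply: le_trans (f_bound huh); rewrite -(discrete_momentum_eq Xuh).
rewrite aSNxx addr0 (hdivh Mph).
have h1 := diffusion_coercive mOm hnu hTh huh; have h2 := drag_ge0 uh.
have h3 := Int_vdot_ge0 uh; lra.
Qed.

(** The terms are arranged so that the viscosity and the convecting field
    multiplying the error are the discrete ones: the difference of the
    viscosities then meets [grad u], whose L^3 norm does not depend on the
    mesh. *)
Lemma momentum_error v : Xh e Om Th v ->
  diffusion Om (fun x => nu (fn Temph x)) (u - uh) v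
  + diffusion Om (fun x => nu (fn T x) - nu (fn Temph x)) u v
  + aSN Om (u - uh) u v + aSN Om uh (u - uh) v + Int Om (vdot (u - uh) v)
  + (drag Om s u v - drag Om s uh v) = pressure Om p v - pressure Om ph v.
Proof.
move=> Xv; have hv := Xv.1; have he := vH10B mOm fOm hu huh.
have E1 := momentum_eq hv; have E2 := discrete_momentum_eq Xv.
have E3 := diffusionD mOm hnu hTh he huh hv; rewrite subrK in E3.
have E4 := diffusion_coef_diff mOm hnu hT hTh hu hv.
have E5 := aSN_Dl mOm fOm hCe he huh hu hv; rewrite subrK in E5.
have E6 := aSN_Dm mOm fOm hCe huh he huh hv; rewrite subrK in E6.
have E7 : Int Om (vdot u v) = Int Om (vdot (u - uh) v) + Int Om (vdot uh v).
  rewrite -(RintegralD mOm (vdot_form mOm hCe he hv).1 (vdot_form mOm hCe huh hv).1).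
  by apply: eq_Int => x; rewrite -vdotDl subrK.
lra.
Qed.

Lemma heat_error S : Yh e Om Th S ->
  heat Om (fun x => kap (fn Temph x)) (T - Temph) S
  + heat Om (fun x => kap (fn T x) - kap (fn Temph x)) T S
  + aST Om (u - uh) T S + aST Om uh (T - Temph) S = 0.
Proof.
move=> YS; have hS : H10 Om S by case: YS.
have he := vH10B mOm fOm hu huh; have ht := H10B mOm fOm hT hTh.
have E1 := heat_eq hS.
have E2 : heat Om (fun x => kap (fn Temph x)) Temph S + aST Om uh Temph S = g S.
  by case: hdisc => _ [_ _ ->].
have E3 := heatD mOm hkap hTh ht hTh hS; rewrite subrK in E3.
have E4 := heat_coef_diff mOm hkap hT hTh hT hS.
have E5 := aST_Dl mOm fOm hCe he huh hT hS; rewrite subrK in E5.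
have E6 := aST_Dm mOm fOm hCe huh ht hTh hS; rewrite subrK in E6.
lra.
Qed.

(** The error equation tested with [Rh - Temph], which the skew-symmetric form
    convecting by [uh] does not see. *)
Lemma temperature_estimate Rh : Yh e Om Th Rh ->
  (kap_m - Lk * Ce 6 * grad_norm Om 3 T) * nY (T - Temph) <=
  (kap_m + kap_p + Ce 4 ^+ 2 * U0) * nY (T - Rh) + Ce 4 ^+ 2 * T0 * nV (u - uh).
Proof.
move=> YR; have hR : H10 Om Rh by case: YR.
have Yr := YhB mOm fOm YR YTh; have hr' : H10 Om (Rh - Temph) := H10B mOm fOm hR hTh.
have he := vH10B mOm fOm hu huh; have hn := H10B mOm fOm hT hR.
have sp : T - Temph = (T - Rh) + (Rh - Temph) by rewrite addrA subrK.
have E := heat_error Yr.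
have E1 := heatD mOm hkap hTh hn hr' hr'; rewrite -sp in E1.
have E2 := aST_Dm mOm fOm hCe huh hn hr' hr'; rewrite -sp (aSTxx mOm hCe huh hr') addr0 in E2.
have C1 := heat_coercive mOm hkap hTh hr'.
have /norm_le/andP[b1 _] := heat_bound mOm hkap hTh hn hr'.
have /norm_le/andP[b2 _] := heat_coef_diff_bound mOm fOm hkap hCe hT hTh hT hT3 hr'.
have /norm_le/andP[b3 _] := aST_bound mOm hCe he hT hr'.
have /norm_le/andP[b4 _] := aST_bound mOm hCe huh hn hr'.
have c4 : 0 <= Ce 4 ^+ 2 by exact: sqr_ge0.
have n0 (S : sobf R) : 0 <= nY S by exact: pnorm_ge0.
have v0 (w : vsobf R) : 0 <= nV w by exact: pnorm_ge0.
have d3 : Ce 4 ^+ 2 * (nV (u - uh) * nY T * nY (Rh - Temph)) <=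
    Ce 4 ^+ 2 * T0 * nV (u - uh) * nY (Rh - Temph).
  rewrite -[leRHS]mulrA -[leRHS]mulrA ler_wpM2l// [leRHS]mulrCA -[leLHS]mulrA.
  by rewrite ler_wpM2l// ler_wpM2r// energy_temperature.
have d4 : Ce 4 ^+ 2 * (nV uh * nY (T - Rh) * nY (Rh - Temph)) <=
    Ce 4 ^+ 2 * U0 * nY (T - Rh) * nY (Rh - Temph).
  rewrite -[leRHS]mulrA -[leRHS]mulrA ler_wpM2l// -[leLHS]mulrA.
  by rewrite ler_wpM2r ?mulr_ge0// energy_discrete_velocity.
apply: (temperature_algebra (rho := nY (Rh - Temph)) kap_m_gt0) => //.
- exact: (le_trans (normr_ge0 _) (coef_bound hkap 0)).
- rewrite mulr_ge0 ?pnorm_ge0//; apply: mulr_ge0; first exact: (coef_lip_ge0 hkap).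
  exact: (Ce_ge0 hCe one_le_six_le_six).
- by rewrite mulr_ge0// divr_ge0 ?f_norm_ge0// ltW// nu_m_gt0.
- by rewrite mulr_ge0// divr_ge0 ?g_norm_ge0// ltW// kap_m_gt0.
- by rewrite sp; exact: grad_normD.
- apply: (le_trans C1).
  move: E E1 E2 b1 b2 d3 d4 b3 b4.
  lra.
Qed.

Lemma drag_diff_bound v : vH10 Om v ->
  `|drag Om s u v - drag Om s uh v| <=
  3 * (Ce 2 ^+ 2 + Ce 4 ^+ 4 * (U0 ^+ 2 + U0 ^+ 2)) * (nV (u - uh) * nV v).
Proof.
move=> hv; apply: (le_trans (power_diff_form mOm fOm hCe hr hu huh hv)).
rewrite ler_wpM2r ?mulr_ge0 ?pnorm_ge0// ler_wpM2l// lerD2l ler_wpM2l//.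
  by rewrite -[4%N]/(2 * 2)%N exprM sqr_ge0.
apply: lerD; rewrite lerXn2r ?nnegrE ?pnorm_ge0//.
- exact: le_trans (pnorm_ge0 _ _ _) energy_velocity.
- exact: energy_velocity.
- exact: le_trans (pnorm_ge0 _ _ _) energy_velocity.
- exact: energy_discrete_velocity.
Qed.

Let Vuh : Vh e Om Th uh. Proof. by split. Qed.

Lemma dragDr (w v v' : vsobf R) : vH10 Om w -> vH10 Om v -> vH10 Om v' ->
  drag Om s w (v + v') = drag Om s w v + drag Om s w v'.
Proof.
move=> hw hv hv'.
rewrite -(RintegralD mOm (power_integrable mOm fOm hCe hr hw hv) (power_integrable mOm fOm hCe hr hw hv')).
by apply: eq_Int => x; rewrite vdotDr mulrDr.
Qed.

Lemma convection_bound (a b c : vsobf R) (A B : R) : vH10 Om a -> vH10 Om b -> vH10 Om c ->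
  0 <= A -> nV a * nV b <= A * B -> `|aSN Om a b c| <= CN * A * (B * nV c).
Proof.
move=> ha hb hc A0 h; apply: (le_trans (aSN_bound hCN ha hb hc)).
have -> : CN * nV a * nV b * nV c = CN * ((nV a * nV b) * nV c) by ring.
have -> : CN * A * (B * nV c) = CN * ((A * B) * nV c) by ring.
by rewrite ler_wpM2l ?(ltW hCN.1)// ler_wpM2r// pnorm_ge0.
Qed.

Let U0_ge0 : 0 <= U0. Proof. exact: le_trans (pnorm_ge0 _ _ _) energy_velocity. Qed.

Lemma convection_bound_u (a c : vsobf R) : vH10 Om a -> vH10 Om c ->
  `|aSN Om a u c| <= CN * U0 * (nV a * nV c).
Proof.
move=> ha hc; apply: convection_bound => //.
by rewrite mulrC ler_wpM2r ?pnorm_ge0// energy_velocity.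
Qed.

Lemma convection_bound_uh (b c : vsobf R) : vH10 Om b -> vH10 Om c ->
  `|aSN Om uh b c| <= CN * U0 * (nV b * nV c).
Proof.
move=> hb hc; apply: convection_bound => //.
by rewrite ler_wpM2r ?pnorm_ge0// energy_discrete_velocity.
Qed.

(** The error equation tested with [wh - uh]. Convection of [wh - uh] by [uh]
    drops out by skew-symmetry, the pressure [p - ph] may be replaced by
    [p - qh] as the test function is discretely divergence free, and in the
    power term monotonicity disposes of the pairing with [u - uh], leaving
    the one with [u - wh]. *)
Lemma velocity_inequality wh qh : Vh e Om Th wh -> Mh Om Th qh ->
  nu_m * nV (wh - uh) ^+ 2 <= nu_p * (nV (u - wh) * nV (wh - uh))
  + Ln * Ce 6 * vgrad_norm Om 3 u * nY (T - Temph) * nV (wh - uh)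
  + CN * U0 * (nV (u - wh) * nV (wh - uh)) + CN * U0 * nV (wh - uh) ^+ 2
  + CN * U0 * (nV (u - wh) * nV (wh - uh))
  + Ce 2 ^+ 2 * (nV (u - wh) * nV (wh - uh))
  + 3 * (Ce 2 ^+ 2 + Ce 4 ^+ 4 * (U0 ^+ 2 + U0 ^+ 2)) * (nV (u - uh) * nV (u - wh))
  + 3 * (L2_norm Om (p - qh) * nV (wh - uh)).
Proof.
move=> Vw Mq; have hw : vH10 Om wh := Vw.1.1.
have Vphi := VhB mOm fOm Vw Vuh; have hphi := Vphi.1.1.
have hxi := vH10B mOm fOm hu hw; have he := vH10B mOm fOm hu huh.
have sp : u - uh = (u - wh) + (wh - uh) by rewrite addrA subrK.
have E := momentum_error Vphi.1.
have E1 := diffusionD mOm hnu hTh hxi hphi hphi; rewrite -sp in E1.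
have E2 := aSN_Dl mOm fOm hCe hxi hphi hu hphi; rewrite -sp in E2.
have E3 := aSN_Dm mOm fOm hCe huh hxi hphi hphi; rewrite -sp aSNxx addr0 in E3.
have E4 : Int Om (vdot (u - uh) (wh - uh)) =
    Int Om (vdot (u - wh) (wh - uh)) + Int Om (vdot (wh - uh) (wh - uh)).
  rewrite -(RintegralD mOm (vdot_form mOm hCe hxi hphi).1 (vdot_form mOm hCe hphi hphi).1).
  by apply: eq_Int => x; rewrite -vdotDl -sp.
have E5 := dragDr hu hxi hphi; rewrite -sp in E5.
have E6 := dragDr huh hxi hphi; rewrite -sp in E6.
have lq : Lp Om 2 qh by case: Mq => -[].
have E7 := Int_divB mOm lp lq hphi.
have E8 : pressure Om qh (wh - uh) - pressure Om ph (wh - uh) = 0.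
  rewrite -(Int_divB mOm lq lph hphi); apply: Vphi.2; exact: MhB.
have C1 := diffusion_coercive mOm hnu hTh hphi.
have C2 := Int_vdot_ge0 (wh - uh).
have C3 := power_mono_form mOm fOm hCe hr hu huh.
have /norm_le/andP[b1 _] := diffusion_bound mOm hnu hTh hxi hphi.
have /norm_le/andP[b2 _] := diffusion_coef_diff_bound mOm fOm hnu hCe hT hTh hu hu3 hphi.
have /norm_le/andP[b3 _] := convection_bound_u hxi hphi.
have /norm_le/andP[b4 _] := convection_bound_u hphi hphi.
have /norm_le/andP[b5 _] := convection_bound_uh hxi hphi.
have /norm_le/andP[b6 _] := (vdot_form mOm hCe hxi hphi).2.
have /norm_le/andP[_ b7] := drag_diff_bound hxi.
have /norm_le/andP[_ b8] := (div_form mOm (L2B mOm lp lq).1 hphi).2.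
apply: (le_trans C1); rewrite [nV (wh - uh) ^+ 2]expr2.
exact: (velocity_combination E E1 E2 E3 E4 E5 E6 E7 E8 C2 C3 b1 b2 b3 b4 b5 b6 b7 b8).
Qed.

(** The momentum error equation bounds the pairing of [qh - ph] with every
    discrete velocity. *)
Lemma pressure_inequality (beta : R) qh : inf_sup e Om Th beta -> Mh Om Th qh ->
  beta * L2_norm Om (fun x => qh x - ph x) <=
  nu_p * nV (u - uh) + Ln * Ce 6 * vgrad_norm Om 3 u * nY (T - Temph)
  + 2 * (CN * U0) * nV (u - uh) + Ce 2 ^+ 2 * nV (u - uh)
  + 3 * (Ce 2 ^+ 2 + Ce 4 ^+ 4 * (U0 ^+ 2 + U0 ^+ 2)) * nV (u - uh)
  + 3 * L2_norm Om (p - qh).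
Proof.
move=> hinf Mq; have he := vH10B mOm fOm hu huh.
have lq : Lp Om 2 qh by case: Mq => -[].
apply: (inf_sup_bound hinf (MhB mOm fOm Mq Mph)).
  have k0 : 0 <= Ln * Ce 6 * vgrad_norm Om 3 u.
    rewrite mulr_ge0 ?pnorm_ge0//; apply: mulr_ge0; first exact: (coef_lip_ge0 hnu).
    exact: (Ce_ge0 hCe one_le_six_le_six).
  have n0 : 0 <= nu_p by exact: (le_trans (normr_ge0 _) (coef_bound hnu 0)).
  have c0 : 0 <= CN * U0 by rewrite mulr_ge0// ltW// hCN.1.
  have c4 : 0 <= Ce 4 ^+ 4 by rewrite -[4%N]/(2 * 2)%N exprM sqr_ge0.
  have e0 : 0 <= nV (u - uh) by exact: pnorm_ge0.
  have p0 : 0 <= L2_norm Om (p - qh) by exact: pnorm_ge0.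
  have t0 : 0 <= nY (T - Temph) by exact: pnorm_ge0.
  have u2 := sqr_ge0 U0; have c2 := sqr_ge0 (Ce 2).
  by repeat (first [assumption|apply: addr_ge0|apply: mulr_ge0]).
move=> v Xv; have hv := Xv.1.
have E := momentum_error Xv.
have E1 := Int_divB mOm lq lph hv; have E2 := Int_divB mOm lp lq hv.
have /norm_le/andP[_ b1] := diffusion_bound mOm hnu hTh he hv.
have /norm_le/andP[_ b2] := diffusion_coef_diff_bound mOm fOm hnu hCe hT hTh hu hu3 hv.
have /norm_le/andP[_ b3] := convection_bound_u he hv.
have /norm_le/andP[_ b4] := convection_bound_uh he hv.
have /norm_le/andP[_ b5] := (vdot_form mOm hCe he hv).2.
have /norm_le/andP[_ b6] := drag_diff_bound hv.
have /norm_le/andP[b7 _] := (div_form mOm (L2B mOm lp lq).1 hv).2.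
exact: (pressure_combination E E1 E2 b1 b2 b3 b4 b5 b6 b7).
Qed.

End Discrete.

(** [frakN] contains two further negative terms, the squared embedding constant
    and the one with [Gam]; the coefficient left in front of
    [|wh - uh|^2] is therefore at least [frakN]. *)
Lemma cea_estimate (beta : R) : 0 < beta -> 0 < frakM Om Ce Lk kap_m T ->
  0 < frakN Om Ce CN s Ln Lk nu_m kap_m f g u T ->
  exists2 C : R, 0 < C & forall (e : @fe_pair R) (Th : set (set (pt R)))
    (uh : vsobf R) (ph : pt R -> R) (Temph : sobf R),
    inf_sup e Om Th beta -> discrete_solution e Om Th nu kap s f g uh ph Temph ->
    forall wh Rh qh, Vh e Om Th wh -> Yh e Om Th Rh -> Mh Om Th qh ->
    nV (u - uh) + nY (T - Temph) + L2_norm Om (p - ph) <=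
    C * (nV (u - wh) + nY (T - Rh) + L2_norm Om (p - qh)).
Proof.
move=> beta0 hM hN.
pose k := Ln * Ce 6 * vgrad_norm Om 3 u.
pose M := frakM Om Ce Lk kap_m T.
have U00 : 0 <= U0 by exact: le_trans (pnorm_ge0 _ _ _) energy_velocity.
have T00 : 0 <= T0 by exact: le_trans (pnorm_ge0 _ _ _) energy_temperature.
have k0 : 0 <= k.
  rewrite /k mulr_ge0 ?pnorm_ge0//; apply: mulr_ge0; first exact: (coef_lip_ge0 hnu).
  exact: (Ce_ge0 hCe one_le_six_le_six).
have N0 : 0 < nu_m - CN * U0 - k * (Ce 4 ^+ 2 * T0) / M.
  apply: (lt_le_trans hN); rewrite /frakN.
  have g0 : 0 <= Ce 6 ^+ 2 * Gam Om Ce (3 / 2) s nu_m f.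
    rewrite mulr_ge0 ?sqr_ge0// /Gam; apply: mulr_ge0; last exact: powR_ge0.
    by apply: mulr_ge0; [apply: mulr_ge0|]; exact: powR_ge0.
  have -> : frakO Om Ce Ln Lk kap_m g u T = k * (Ce 4 ^+ 2 * T0) / M.
    by rewrite /frakO -/M invfM /k; ring.
  have -> : nu_m^-1 * CN * vHm1_norm Om f = CN * U0 by ring.
  by rewrite lerD2r -addrA -opprD gerDl oppr_le0 addr_ge0 ?sqr_ge0.
have np0 : 0 <= nu_p by exact: (le_trans (normr_ge0 _) (coef_bound hnu 0)).
have kp0 : 0 <= kap_p by exact: (le_trans (normr_ge0 _) (coef_bound hkap 0)).
have cu0 : 0 <= CN * U0 by rewrite mulr_ge0// ltW// hCN.1.
have c40 := sqr_ge0 (Ce 4); have c20 := sqr_ge0 (Ce 2).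
have d0 : 0 <= 3 * (Ce 2 ^+ 2 + Ce 4 ^+ 4 * (U0 ^+ 2 + U0 ^+ 2)).
  rewrite mulr_ge0// addr_ge0// mulr_ge0 ?addr_ge0 ?sqr_ge0//.
  by rewrite -[4%N]/(2 * 2)%N exprM sqr_ge0.
have c10 : 0 <= kap_m + kap_p + Ce 4 ^+ 2 * U0.
  have km0 : 0 <= kap_m by rewrite ltW// kap_m_gt0.
  by apply: addr_ge0; [exact: addr_ge0|exact: mulr_ge0].
have [C C0 hC] := cea_algebra np0 cu0 c20 d0 k0 hM c10 (mulr_ge0 c40 T00) beta0 N0.
exists C => // e Th uh ph Temph hinf hdisc wh Rh qh Vw YR Mq.
have [[Xuh Mph YTh] _] := hdisc.
have hxi := vH10B mOm fOm hu Vw.1.1; have hphi := vH10B mOm fOm Vw.1.1 Xuh.1.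
have lq : Lp Om 2 qh by case: Mq => -[].
have lph : Lp Om 2 ph by case: Mph => -[].
apply: (hC _ _ _ (nV (wh - uh)) _ _ (L2_norm Om (fun x => qh x - ph x))); try exact: pnorm_ge0.
- by have := vgrad_normD mOm fOm hxi hphi; rewrite addrA subrK.
- exact: (temperature_estimate hdisc YR).
- exact: (velocity_inequality hdisc Vw Mq).
- exact: (pressure_inequality hdisc hinf Mq).
- have := (LpD mOm (ler1n _ 2) (L2B mOm lp lq).1 (L2B mOm lq lph).1).2.
  apply: le_trans; rewrite le_eqVlt; apply/orP; left; apply/eqP.
  by congr fine; congr Lp_norm; apply/funext => x; rewrite addrA subrK.
Qed.

End Coupled.

Theorem theorem4p5 (R : realType) (Om : set (pt R)) (s : R)
    (nu kap : R -> R) (Ln Lk nu_m nu_p kap_m kap_p : R)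
    (f : vsobf R -> R) (g : sobf R -> R)
    (CN : R) (Ce : R -> R)
    (TT : set (set (set (pt R)))) (e : @fe_pair R) (beta : R)
    (u : vsobf R) (p : pt R -> R) (T : sobf R)
    (hOm : lipschitz_domain Om) (hpoly : polytope Om)
    (hs : 3 <= s <= 4)
    (hnu : bounded_lipschitz nu Ln nu_m nu_p)
    (hkap : bounded_lipschitz kap Lk kap_m kap_p)
    (hf : vHm1 Om f) (hg : Hm1 Om g)
    (hCN : trilinear_bound Om CN)
    (hCe : forall q : R, 1 <= q <= 6 -> best_embedding Om q (Ce q))
    (hTT : mesh_family Om TT) (he : admissible_pair e TT)
    (hbeta : 0 < beta) (hinfsup : forall Th, TT Th -> inf_sup e Om Th beta)
    (hu3 : vW1p Om 3 u) (hT3 : W1p Om 3 T)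
    (hsol : weak_solution Om nu kap s f g u p T)
    (hM : 0 < frakM Om Ce Lk kap_m T)
    (hN : 0 < frakN Om Ce CN s Ln Lk nu_m kap_m f g u T) :
  exists2 C : R, 0 < C &
    forall Th, TT Th ->
    forall (uh : vsobf R) (ph : pt R -> R) (Temph : sobf R),
      vW1p Om 3 uh -> W1p Om 3 Temph ->
      discrete_solution e Om Th nu kap s f g uh ph Temph ->
      CN / nu_m ^+ 2 * vHm1_norm Om f
        + Ln * Ce 6 * Ce 4 ^+ 2 * Hm1_norm Om g * vgrad_norm Om 3 uh
          / (nu_m * kap_m * (kap_m - Lk * Ce 6 * grad_norm Om 3 Temph)) < 1 ->
      Lk * Ce 6 * grad_norm Om 3 Temph < kap_m ->
      vgrad_norm Om 2 (u - uh) + grad_norm Om 2 (T - Temph)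
        + L2_norm Om (p - ph)
      <= C * (inf [set vgrad_norm Om 2 (u - wh) | wh in Vh e Om Th]
              + inf [set grad_norm Om 2 (T - Rh) | Rh in Yh e Om Th]
              + inf [set L2_norm Om (p - qh) | qh in Mh Om Th]).
Proof.
have [oOm bOm _] := hOm.
have mOm : measurable Om := open_measurable_pt oOm.
have fOm := leb3_fin mOm bOm.
have [C C0 hC] := cea_estimate mOm fOm hCe hnu hkap hs hf hg hsol hCN hu3 hT3 hbeta hM hN.
exists C => // Th ThT uh ph Temph _ _ hdisc _ _.
have [[Xuh Mph YTh] [_ hdivh _]] := hdisc.
rewrite -ler_pdivrMl//; apply: le_inf3.
- by exists (vgrad_norm Om 2 (u - uh)), uh.
- by exists (grad_norm Om 2 (T - Temph)), Temph.
- by exists (L2_norm Om (p - ph)), ph.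
move=> _ _ _ [wh Vw <-] [Rh YR <-] [qh Mq <-]; rewrite ler_pdivrMl//.
exact: (hC _ _ _ _ _ (hinfsup _ ThT) hdisc).
Qed.
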